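(* Let $\{W_k\}$ be an arbitrary convex averaging sequence in $\mathbb{R}^d$ and $w(\cdot)$ a kernel function with an associated sequence of bandwidths $\{b_k\}$ satisfying Condition $(wb)$. Let $X_M=\sum_{n\ge1}\delta_{(X_n,M_n)}$ be a stationary (simple) marked point process on $\mathbb{R}^d$ with Polish mark space $\mathbb{M}$ and intensity $\lambda>0$ such that, for some $\delta>0$, $$\mathbb{E}\bigl(X_M([0,1]^d\times\mathbb{M})\bigr)^{4+\delta}<\infty\quad\text{and}\quad\int_1^\infty r^{d-1}\bigl(\beta^*_{X_M}(r)\bigr)^{\delta/(4+\delta)}\,dr<\infty.$$ Let $C_1,\dots,C_\ell\in\mathcal{B}(\mathbb{M})$ and, for $i,j\in\{1,\dots,\ell\}$, let $$(\widehat\sigma^{(3)}_{ij})_k=\frac{1}{|W_k|}\sum_{p\ge1}\mathbf{1}_{W_k}(X_p)\bigl(\mathbf{1}_{C_i\cap C_j}(M_p)-P_M^{\mathbf{o}}(C_i)P_M^{\mathbf{o}}(C_j)\bigr)$$ $$\qquad+\sum_{p,q\ge1}^{\neq}\frac{\mathbf{1}_{W_k}(X_p)\mathbf{1}_{W_k}(X_q)\bigl(\mathbf{1}_{C_i}(M_p)-P_M^{\mathbf{o}}(C_i)\bigr)\bigl(\mathbf{1}_{C_j}(M_q)-P_M^{\mathbf{o}}(C_j)\bigr)}{|(W_k-X_p)\cap(W_k-X_q)|}\,w\Bigl(\frac{\|X_q-X_p\|}{b_k|W_k|^{1/d}}\Bigr).$$ Then $$\mathbb{E}\bigl(\sigma_{ij}-(\widehat\sigma^{(3)}_{ij})_k\bigr)^2\longrightarrow0\quad\text{as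 }k\to\infty,$$ where $\sigma_{ij}=\lim_{k\to\infty}\mathbb{E}\,Y_k(C_i)Y_k(C_j)$ with $Y_k(C)=|W_k|^{-1/2}\sum_{n\ge1}\mathbf{1}_{W_k}(X_n)\bigl(\mathbf{1}_C(M_n)-P_M^{\mathbf{o}}(C)\bigr)$.
   Context: A marked point process (MPP) $X_M=\sum_{n\ge1}\delta_{(X_n,M_n)}$ is a random counting measure on $\mathcal{B}(\mathbb{R}^d\times\mathbb{M})$, with $\mathbb{M}$ Polish, such that $X_M(B\times\mathbb{M})<\infty$ for all bounded Borel $B\subset\mathbb{R}^d$; it is defined on a probability space $(\Omega,\mathcal{A},\mathbb{P})$. Throughout, $X_M$ is simple: all locations $X_n$ have multiplicity one regardless of their marks. It is stationary if $\sum_n\delta_{(X_n-x,M_n)}$ has the same distribution as $X_M$ for all $x\in\mathbb{R}^d$. The intensity is $\lambda=\mathbb{E}X_M([0,1)^d\times\mathbb{M})$, and the Palm mark distribution is $P_M^{\mathbf{o}}(C)=\lambda^{-1}\mathbb{E}X_M([0,1)^d\times C)$, $C\in\mathcal{B}(\mathbb{M})$. $|\cdot|$ is Lebesgue measure on $\mathbb{R}^d$, $\|\cdot\|$ the Euclidean norm, and $\sum^{\neq}$ denotes summation over pairs of distinct indices. A convex averaging sequence (CAS) is an increasing sequence $\{W_k\}$ of convex compact sets in $\mathbb{R}^d$ with $\varrho(W_k)=\sup\{r>0: B(x,r)\subset W_k\text{ for some }x\in W_k\}\to\infty$, where $B(x,r)$ is the closed Euclidean ball. Mixing: for Borel $B\subset\mathbb{R}^d$,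 $\mathcal{A}_{X_M}(B)$ is the sub-$\sigma$-algebra of $\mathcal{A}$ generated by the restriction of $X_M$ to $B\times\mathbb{M}$. The $\beta$-mixing coefficient is $$\beta(\mathcal{A}_{X_M}(B),\mathcal{A}_{X_M}(B'))=\tfrac12\sup\sum_{i,j}|\mathbb{P}(A_i\cap A_j')-\mathbb{P}(A_i)\mathbb{P}(A_j')|,$$ the supremum being over all finite partitions $\{A_i\}$, $\{A'_j\}$ of $\Omega$ with $A_i\in\mathcal{A}_{X_M}(B)$, $A_j'\in\mathcal{A}_{X_M}(B')$. With $K_a=[-a,a]^d$ and $K_a^c=\mathbb{R}^d\setminus K_a$, the mixing rate $\beta^*_{X_M}:[\frac12,\infty)\to[0,\infty)$ is a non-increasing function such that $\beta(\mathcal{A}_{X_M}(K_a),\mathcal{A}_{X_M}(K^c_{a+b}))\le\beta^*_{X_M}(b)$ for all $\frac12\le a\le b$. Condition $(wb)$: $w:\mathbb{R}\to\mathbb{R}$ is a non-negative, symmetric, Borel-measurable kernel function with $w(x)\to w(0)=1$ as $x\to0$; $w$ is bounded by some $m_w<\infty$ and vanishes outside $[-r_w,r_w]$ for some $r_w\in(0,\infty)$. Further, $\{b_k\}$ is a sequence of positive bandwidths such that $$\frac{\varrho(W_k)}{2\,d\,r_w\,|W_k|^{1/d}}\ge b_k\to0,\qquad b_k^d|W_k|\to\infty,\qquad b_k^{\frac32 d}|W_k|\to0\qquad(k\to\infty).$$ *)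

(* Defs.v *)
From HB Require Import structures.
From mathcomp Require Import all_boot all_order all_algebra.
From mathcomp Require Import all_classical all_reals all_analysis measurable_realfun.

Set Implicit Arguments.
Unset Strict Implicit.
Unset Printing Implicit Defensive.

Import Order.TTheory GRing.Theory Num.Theory.
Import numFieldNormedType.Exports.

Local Open Scope classical_set_scope.
Local Open Scope ring_scope.

Definition borel (T : topologicalType) : set (set T) := <<s @open T >>.

Definition polish (R : realType) (T : topologicalType) : Prop :=
  (exists2 D : set T, countable D & dense D) /\
  exists dist : T -> T -> R,
    [/\ [/\ forall x y, 0 <= dist x y,
            forall x y, dist x y = 0 <-> x = y,
            forall x y, dist x y = dist y x &
            forall x y z, dist x z <= dist x y + dist y z],
        forall x (A : set T),
          nbhs x A <-> exists2 e, 0 < e & [set y | dist x y < e] `<=` A &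
        forall u : nat -> T,
          (forall e, 0 < e -> exists N, forall m n,
             (N <= m)%N -> (N <= n)%N -> dist (u m) (u n) < e) ->
          exists l : T, u @ \oo --> l].

Section cons_measure.
Context (R : realType) (n : nat).
Let T := measurableTypeR R.
Variable m : {sigma_finite_measure set (n.-tuple T) -> \bar R}.

Definition tcons (p : T * n.-tuple T) : n.+1.-tuple T := [tuple of p.1 :: p.2].

Let measurable_tcons : measurable_fun [set: T * n.-tuple T] tcons.
Proof. exact: measurable_cons. Qed.

Definition cons_measure : set (n.+1.-tuple T) -> \bar R :=
  pushforward (@lebesgue_measure R \x m)%E tcons.

HB.instance Definition _ := Measure.copy cons_measure
  (measure_function_pushforward__canonical__measure_function_Measure
     (@lebesgue_measure R \x m)%E measurable_tcons).

Let cons_measure_sigma_finite : sigma_finite setT cons_measure.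
Proof.
have /sigma_finiteP[F [FT ndF Ffin]] := sigma_finiteT (@lebesgue_measure R).
have /sigma_finiteP[G [GT ndG Gfin]] := sigma_finiteT m.
pose g (t : n.+1.-tuple T) : T * n.-tuple T := (thead t, [tuple of behead t]).
have tK : cancel tcons g.
  by case=> x t; congr pair; apply/val_inj.
have gK : cancel g tcons by move=> t; rewrite [RHS]tuple_eta.
have mg : measurable_fun setT g.
  by apply/measurable_fun_pairP; split;
    [exact: measurable_tnth | exact: measurable_behead].
exists (fun i => g @^-1` (F i `*` G i)).
  apply/seteqP; split=> // t _.
  have [i _ Fi] : (\bigcup_i F i) (g t).1 by rewrite -FT.
  have [j _ Gj] : (\bigcup_j G j) (g t).2 by rewrite -GT.
  exists (maxn i j) => //; split.
    by move: (g t).1 Fi; exact/subsetPset/ndF/leq_maxl.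
  by move: (g t).2 Gj; exact/subsetPset/ndG/leq_maxr.
move=> i; have [mF Fi] := Ffin i; have [mG Gi] := Gfin i; split.
  by rewrite -[_ @^-1` _]setTI; apply: mg => //; exact: measurableX.
rewrite /cons_measure /pushforward.
suff -> : tcons @^-1` (g @^-1` (F i `*` G i)) = F i `*` G i.
  by rewrite product_measure1E// lte_mul_pinfty// ge0_fin_numE.
by rewrite -comp_preimage (_ : g \o tcons = id) ?preimage_id//; exact/funext.
Qed.

HB.instance Definition _ :=
  Measure_isSigmaFinite.Build _ _ _ cons_measure cons_measure_sigma_finite.

End cons_measure.

(* [d]-fold product of the Lebesgue measure on the line *)
Fixpoint lebesgue_tuple (R : realType) (n : nat) :
    {sigma_finite_measure set (n.-tuple (measurableTypeR R)) -> \bar R} :=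
  match n with
  | 0 => \d_([tuple] : 0.-tuple (measurableTypeR R))
  | n'.+1 => cons_measure (lebesgue_tuple R n')
  end.

Section euclidean_space.
Context {R : realType} {d : nat}.
Implicit Types (A W : set 'rV[R]_d) (x : 'rV[R]_d).

(* Lebesgue measure, transported from ['rV[R]_d] to [d]-tuples, where the
   library's product sigma-algebra is available. *)
Definition vol A : R :=
  fine (lebesgue_tuple R d [set t | A (\row_i tnth t i)]).

(* The canonical norm on ['rV[R]_d] is the maximum norm. *)
Definition enorm x : R := Num.sqrt (\sum_i x ord0 i ^+ 2).

Definition closed_eball x (r : R) : set 'rV[R]_d := [set y | enorm (y - x) <= r].

Definition cube (a : R) : set 'rV[R]_d := [set x | forall i, `|x ord0 i| <= a].

Definition unit_cube : set 'rV[R]_d := [set x | forall i, 0 <= x ord0 i <= 1].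

Definition unit_cube_halfopen : set 'rV[R]_d := [set x | forall i, 0 <= x ord0 i < 1].

(* [W - x] *)
Definition translate W x : set 'rV[R]_d := [set y - x | y in W].

(* [0] when [W] contains no ball, since [sup set0 = 0]. *)
Definition inradius W : R :=
  sup [set r | 0 < r /\ exists2 x, W x & closed_eball x r `<=` W].

Definition convex_averaging_sequence (W : nat -> set 'rV[R]_d) : Prop :=
  [/\ forall k, W k `<=` W k.+1,
      forall k, convex_set (W k : set (convex_lmodType 'rV[R]_d)),
      forall k, compact (W k) &
      inradius (W k) @[k --> \oo] --> +oo].

(* The upper bound on the bandwidths is an asymptotic requirement: the first
   sets of the sequence may have volume zero. *)
Definition condition_wb (W : nat -> set 'rV[R]_d) (w : R -> R) (b : nat -> R) :
    Prop :=
  [/\ [/\ forall t, 0 <= w t, forall t, w (- t) = w t,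
          measurable_fun [set: R] w, w 0 = 1 & w t @[t --> 0] --> (1 : R)],
      exists m_w : R, forall t, w t <= m_w &
      exists r_w : R, [/\ 0 < r_w, forall t, r_w < `|t| -> w t = 0 &
        [/\ forall k, 0 < b k,
            \forall k \near \oo,
              b k <= inradius (W k) / (2 * d%:R * r_w * vol (W k) `^ d%:R^-1),
            b k @[k --> \oo] --> (0 : R),
            b k ^+ d * vol (W k) @[k --> \oo] --> +oo &
            b k `^ (3 / 2 * d%:R) * vol (W k) @[k --> \oo] --> (0 : R)]]].

End euclidean_space.

(* The points of a configuration are the pairs [(mpp_loc n om, mpp_mark n om)]
   with [n] in [mpp_index om], so that configurations with finitely many points
   are allowed and multiplicities are kept. *)
Record point_family (R : realType) (d : nat) (Omega M : Type) := PointFamily {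
  mpp_index : Omega -> set nat;
  mpp_loc : nat -> Omega -> 'rV[R]_d;
  mpp_mark : nat -> Omega -> M }.

Section marked_point_process.
Context {R : realType} {d : nat} {dO : measure_display} {Omega : measurableType dO}
  {M : topologicalType}.
Variable P : probability Omega R.
Implicit Types (X : point_family R d Omega M) (B : set 'rV[R]_d) (C : set M).
Local Notation configuration := (set ('rV[R]_d * M) -> \bar R).

Definition mpp_count X (om : Omega) : configuration := fun E =>
  \esum_(n in mpp_index X om) (\1_E (mpp_loc X n om, mpp_mark X n om))%:E.

Definition is_marked_point_process X : Prop :=
  (forall E, borel E -> measurable_fun [set: Omega] (mpp_count X ^~ E)) /\
  (forall om B, borel B -> bounded_set B -> (mpp_count X om (B `*` setT) < +oo)%E).

Definition simple_mpp X : Prop :=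
  {ae P, forall om, set_inj (mpp_index X om) (mpp_loc X ^~ om)}.

Definition shift_mpp (x : 'rV[R]_d) X : point_family R d Omega M :=
  PointFamily (mpp_index X) (fun n om => mpp_loc X n om - x) (mpp_mark X).

(* Laws of point processes are compared on the sigma-algebra generated by the
   evaluations at Borel sets. *)
Definition configuration_measurable : set (set configuration) :=
  <<s [set G | exists E U, [/\ borel E, measurable U &
                               G = [set mu : configuration | U (mu E)]]] >>.

Definition stationary X : Prop :=
  forall x G, configuration_measurable G ->
    P [set om | G (mpp_count (shift_mpp x X) om)] = P [set om | G (mpp_count X om)].

Definition intensity X : \bar R :=
  (\int[P]_om mpp_count X om (unit_cube_halfopen `*` setT))%E.

Definition palm_mark X C : R :=
  fine (\int[P]_om mpp_count X om (unit_cube_halfopen `*` C))%E / fine (intensity X).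

Definition sigma_mpp X B : set (set Omega) :=
  <<s [set A | exists E U, [/\ borel E, measurable U &
         A = [set om | U (mpp_count X om (E `&` (B `*` setT)))]]] >>.

Definition finite_partition (F : set (set Omega)) (m : nat)
    (A : 'I_m -> set Omega) : Prop :=
  [/\ forall i, F (A i), trivIset setT A & \bigcup_i A i = setT].

Definition beta_coef (F F' : set (set Omega)) : \bar R :=
  ereal_sup [set s | exists m n (A : 'I_m -> set Omega) (A' : 'I_n -> set Omega),
    [/\ finite_partition F A, finite_partition F' A' &
        s = (2^-1 * \sum_i \sum_j
          `|fine (P (A i `&` A' j)) - fine (P (A i)) * fine (P (A' j))|)%:E]].

Definition mixing_rate X (beta : R -> R) : Prop :=
  [/\ forall b, 2^-1 <= b -> 0 <= beta b,
      forall b c, 2^-1 <= b -> b <= c -> beta c <= beta b &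
      forall a b, 2^-1 <= a -> a <= b ->
        (beta_coef (sigma_mpp X (cube a)) (sigma_mpp X (~` cube (a + b)))
           <= (beta b)%:E)%E].

(* [\sum_(_ \in _)] is [0] on infinite supports; it is used here only with
   functions vanishing outside a bounded window, which contains finitely many
   points. *)
Definition sum_points X (om : Omega) (f : 'rV[R]_d * M -> R) : R :=
  \sum_(p \in mpp_index X om) f (mpp_loc X p om, mpp_mark X p om).

Definition sum_point_pairs X (om : Omega)
    (f : 'rV[R]_d * M -> 'rV[R]_d * M -> R) : R :=
  \sum_(pq \in [set pq : nat * nat | [/\ mpp_index X om pq.1,
                                        mpp_index X om pq.2 & pq.1 <> pq.2]])
    f (mpp_loc X pq.1 om, mpp_mark X pq.1 om) (mpp_loc X pq.2 om, mpp_mark X pq.2 om).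

Definition mark_empirical X (W : set 'rV[R]_d) C (om : Omega) : R :=
  (Num.sqrt (vol W))^-1 *
  sum_points X om (fun z => \1_W z.1 * (\1_C z.2 - palm_mark X C)).

Definition cov_estimator X (W : set 'rV[R]_d) (w : R -> R) (b : R) C C'
    (om : Omega) : R :=
  (vol W)^-1 * sum_points X om (fun z =>
    \1_W z.1 * (\1_(C `&` C') z.2 - palm_mark X C * palm_mark X C')) +
  sum_point_pairs X om (fun z z' =>
    \1_W z.1 * \1_W z'.1 * (\1_C z.2 - palm_mark X C) * (\1_C' z'.2 - palm_mark X C')
      / vol (translate W z.1 `&` translate W z'.1)
      * w (enorm (z'.1 - z.1) / (b * vol W `^ d%:R^-1))).

End marked_point_process.

(* Main.v *)
Require Import Defs.
From mathcomp Require Import finmap.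
From mathcomp Require Import all_boot all_order all_algebra.
From mathcomp Require Import all_classical all_reals all_analysis measurable_realfun.
From mathcomp Require Import lra ring zify.
Import Order.TTheory GRing.Theory Num.Theory.
Import numFieldNormedType.Exports.
Local Open Scope classical_set_scope.
Local Open Scope ring_scope.

(** Write [p] and [p'] for the Palm probabilities of [C] and [C'], and [phi = 1_C - p],
    [phi' = 1_C' - p'] for the centred marks. The identity [1_C 1_C' - p p' = phi phi' + p' phi + p
    phi'] turns the single sum of the estimator into the missing diagonal of its double sum plus a
    linear term ([cov_estimatorE]). So the estimator is a quadratic form in the centred marks, over
    all pairs of points of the window and with weight [w(|x - y| / s_k) / |(W_k - x) cap (W_k -
    y)|], where [s_k = b_k |W_k|^(1/d)], plus [|W_k|^(-1/2) (p' Y_k(C) + p Y_k(C'))]. The product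
    [Y_k(C) Y_k(C')] is a quadratic form of the same kind with constant weight [1 / |W_k|]. It
    remains to show that both forms have means with the same limit [sigma] ([quad_mean_cvg]), that
    the variance of the kernel form vanishes ([quad_variance]), and that the linear term vanishes in
    mean square, which holds because [E Y_k^2] converges and [|W_k|] tends to infinity.

    Space is cut into unit cells indexed by integer sites, and a quadratic form becomes a double sum
    of terms [U a b] over pairs of cells. If the two cells were independent, the mean of [U a b]
    would be zero, since [phi'] integrates to zero against every bounded function of the location:
    the signed measure [B |-> E sum_{x in B} phi'(x)] is translation invariant and vanishes on one
    cell ([mean_sum_eq0], [Rint_list_sum_eq0]). By mixing, the true mean decays with the distance of
    the cells ([pair_term_mean]), summably by hypothesis. In the limit the weights at bounded
    distance are [1 / |W_k|], and almost all cells of the convex window are far from its boundary,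
    its inradius being large ([vol_translate_cap], [inner_sites_cvg]). Dominated convergence gives
    [sigma = sum_v cell_cov v] ([mean_pairs_cvg]).

    For the variance, the covariance of [U a b] and [U a' b'] decays with the distance of the two
    pairs ([pair_term_cov]). The kernel only admits pairs of cells at distance at most [L], of order
    [s_k]. There are about [|W_k|] choices of [a], [L^d] of [b], [L^d] of [b'], and the sum over
    [a'] costs another [L^d]; the weights contribute [|W_k|^(-2)]. The result is of order
    [s_k^(3d) / |W_k| = (b_k^(3d/2) |W_k|)^2], which tends to zero.

    The mixing input is a covariance inequality for functions of two regions that need not be
    products. The beta coefficient, defined by finite partitions, controls the difference between
    the joint law and the product law on the whole sigma-algebra generated by rectangles
    ([beta_mixing_rectangles]). Truncation extends this to unbounded functions
    ([beta_mixing_expectation]). The functions at hand are dominated by products of four cell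
    counts; with moments of order [q = 4 + delta] such a product has a moment of order [q / 4],
    whence the exponent [1 - 4 / q = delta / (4 + delta)] ([list_mixing]). *)

Lemma cvg_sum_seq {R : realType} {I : Type} (s : seq I) (f : nat -> I -> R)
    (l : I -> R) : (forall i, f n i @[n --> \oo] --> l i) ->
  \sum_(i <- s) f n i @[n --> \oo] --> \sum_(i <- s) l i.
Proof.
move=> fl; elim: s => [|i s IH].
  by under eq_fun do rewrite big_nil; rewrite big_nil; exact: cvg_cst.
by under eq_fun do rewrite big_cons; rewrite big_cons; exact: cvgD.
Qed.

(** * Measurability of sums over random finite lists *)

Section random_list.
Import HBSimple.
Context {R : realType} {d1 d2 : measure_display}.

(** A random finite multiset seen through its counts: the order in which the points are listed
    carries no information, and no sigma-algebra on sequences enters. *)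
Definition random_list {T : measurableType d1} {Y : measurableType d2}
    (s : T -> seq Y) : Prop :=
  forall A, measurable A ->
    measurable_fun setT (fun t => \sum_(y <- s t) (\1_A y : R)).

Context {T : measurableType d1} {Y : measurableType d2}.
Variables (s : T -> seq Y) (ms : random_list s).

Lemma random_list_size : measurable_fun setT (fun t => (size (s t))%:R : R).
Proof.
apply: eq_measurable_fun (ms _ measurableT) => t _.
under eq_bigr do rewrite indicT.
by rewrite big_const_seq iter_addr addr0 count_predT.
Qed.

(** For a simple function the sum is a finite combination of counts. The general case is a pointwise
    limit, which passes through the sum because each list is finite. *)
Lemma random_list_sum (H : Y -> R) : measurable_fun setT H ->
  measurable_fun setT (fun t => \sum_(y <- s t) H y).
Proof.
move=> mH; have [g gH] := approximation_sfun measurableT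
  (iffRL (measurable_EFinP _ _) mH).
refine (@measurable_fun_cvg _ _ R setT (fun n t => \sum_(y <- s t) g n y) (fun t => \sum_(y <- s t) H y) _ _).
  move=> n; rewrite (_ : (fun t => _) = fun t =>
      \sum_(r <- fset_set (range (g n)))
        r * \sum_(y <- s t) (\1_(g n @^-1` [set r]) y)).
    apply: measurable_sum => r; apply: measurable_funM; first exact: measurable_cst.
    exact: ms.
  apply/funext => t.
  under [RHS]eq_bigr do rewrite mulr_sumr.
  rewrite exchange_big /=; apply: eq_bigr => y _.
  by rewrite fimfunE fsbig_finite.
move=> t _; apply: cvg_sum_seq => y.
have /fine_cvgP[_] := gH y I.
by apply: cvg_trans.
Qed.

End random_list.

Section random_list_pair.
Context {R : realType} {d1 d2 d3 : measure_display}.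
Context {T : measurableType d1} {Y : measurableType d2} {Y' : measurableType d3}.
Variables (s : T -> seq Y) (ms : random_list (R := R) s).
Variables (s' : T -> seq Y') (ms' : random_list (R := R) s').

(** A Dynkin class argument: over a rectangle the number of pairs is the product of two counts, and
    rectangles are stable under intersection and generate the product sigma-algebra. *)
Lemma random_list_allpairs :
  random_list (R := R) (fun t => [seq (y, y') | y <- s t, y' <- s' t]).
Proof.
move=> A; rewrite measurable_prod_measurableType => mA.
(* Complements are handled by subtracting from the total number of pairs, which is measurable as a
   product of sizes. *)
have N1 B : measurable_fun setT
    (fun t => \sum_(y <- [seq (y, y') | y <- s t, y' <- s' t]) (1 - \1_B y : R)) <->
  measurable_fun setT
    (fun t => \sum_(y <- [seq (y, y') | y <- s t, y' <- s' t]) (\1_B y : R)).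
  have -> : (fun t => \sum_(y <- [seq (y, y') | y <- s t, y' <- s' t]) (1 - \1_B y : R))
     = (fun t => (size (s t))%:R * (size (s' t))%:R -
       \sum_(y <- [seq (y, y') | y <- s t, y' <- s' t]) (\1_B y : R)).
    apply/funext => t; rewrite sumrB; congr (_ - _).
    by rewrite big_const_seq iter_addr addr0 count_predT size_allpairs natrM.
  have m2 : measurable_fun setT (fun t => (size (s t))%:R * (size (s' t))%:R : R).
    by apply: measurable_funM; exact: random_list_size.
  split=> h; last exact: measurable_funB.
  rewrite [X in measurable_fun _ X](_ : _ = fun t => (size (s t))%:R * (size (s' t))%:R -
      ((size (s t))%:R * (size (s' t))%:R -
       \sum_(y <- [seq (y, y') | y <- s t, y' <- s' t]) (\1_B y : R))).
    exact: measurable_funB.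
  by apply/funext => t; rewrite subKr.
move: A mA; apply: dynkin_induction => //=.
- exact: measurable_prod_measurableType.
- move=> _ _ [A mA [B mB <-]] [A' mA' [B' mB' <-]].
  exists (A `&` A'); first exact: measurableI.
  by exists (B `&` B'); [exact: measurableI|rewrite setXI].
- apply/N1; rewrite (_ : (fun t => _) = fun=> 0) //.
  by apply/funext => t; apply: big1 => y _; rewrite indicT subrr.
- move=> _ [A mA [B mB <-]] /=.
  rewrite (_ : (fun t => _) = fun t => (\sum_(y <- s t) \1_A y) *
      (\sum_(y <- s' t) \1_B y)).
    by apply: measurable_funM; [exact: ms|exact: ms'].
  apply/funext => t; rewrite big_allpairs mulr_suml; apply: eq_bigr => y _.
  by rewrite mulr_sumr; apply: eq_bigr => y' _; rewrite !indicE in_setX -natrM mulnb.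
- move=> S mS /N1; apply: eq_measurable_fun => t _.
  by apply: eq_bigr => y _; rewrite !indicE in_setC; case: (_ \in _); rewrite ?subrr ?subr0.
- move=> F mF tF hF.
  apply: (@measurable_fun_cvg _ _ _ setT (fun n t => \sum_(k <- iota 0 n)
    \sum_(y <- [seq (y, y') | y <- s t, y' <- s' t]) (\1_(F k) y : R))).
    by move=> n; apply: measurable_sum.
  move=> t _; under eq_fun do rewrite exchange_big.
  apply: cvg_sum_seq => y.
  have : (fun n => (\sum_(0 <= k < n) (\1_(F k) y)%:E)%E) @ \oo -->
     ((\1_(\bigcup_k F k) y)%:E : \bar R).
    rewrite indic_bigcup //; apply: is_cvg_ereal_nneg_natsum => n _.
    by rewrite lee_fin.
  under eq_fun do rewrite sumEFin.
  move/fine_cvgP => [_]; apply: cvg_trans.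
  by apply: near_eq_cvg; near=> n; rewrite /= /index_iota subn0.
Unshelve. all: by end_near.
Qed.

End random_list_pair.

(** * From the beta coefficient to a covariance inequality *)

Section algebra_approximation.
Context {d} {T : measurableType d} {R : realType}.
Variables (mu : {measure set T -> \bar R}) (mu_fin : (mu setT < +oo)%E).
Variables (G : set (set T)) (mG : G `<=` measurable) (G0 : G set0)
  (GC : forall A, G A -> G (~` A)) (GU : setU_closed G).

(** The sets that can be approximated in measure by members of the algebra [G] form a sigma-algebra:
    a countable union is approximated by a finite one, up to a remainder that vanishes by continuity
    from above of the finite measure [mu]. *)
Lemma g_sigma_algebra_approx (D : set T) : <<s G >> D ->
  forall e : R, 0 < e -> exists2 A, G A & (mu (D `+` A) < e%:E)%E.
Proof.
pose ap := [set D : set T | measurable D /\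
  forall e : R, 0 < e -> exists2 A, G A & (mu (D `+` A) < e%:E)%E].
suff sap : <<s G >> `<=` ap by move/sap => -[].
have mY (A B : set T) : measurable A -> measurable B -> measurable (A `+` B).
  by move=> mA mB; rewrite setY_def; apply: measurableU; exact: measurableD.
apply: smallest_sub; last first.
  move=> A GA; split; first exact: mG.
  by move=> e e0; exists A => //; rewrite setYK measure0 lte_fin.
have apU D1 D2 : ap D1 -> ap D2 -> ap (D1 `|` D2).
  move=> [mD1 h1] [mD2 h2]; split; first exact: measurableU.
  move=> e e0.
  have e20 : 0 < e / 2 by rewrite divr_gt0.
  have [A1 G1 m1] := h1 _ e20; have [A2 G2 m2] := h2 _ e20.
  exists (A1 `|` A2); first exact: GU.
  have mA1 := mG _ G1; have mA2 := mG _ G2.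
  apply: (@le_lt_trans _ _ (mu ((D1 `+` A1) `|` (D2 `+` A2)))).
    apply: le_measure; rewrite ?inE.
    - by apply: mY; exact: measurableU.
    - by apply: measurableU; exact: mY.
    - rewrite !setY_def => x /= [[[D1x|D2x] /not_orP[nA1 nA2]]|[[A1x|A2x] /not_orP[nD1 nD2]]].
      + by left; left.
      + by right; left.
      + by left; right.
      + by right; right.
  apply: (@le_lt_trans _ _ (mu (D1 `+` A1) + mu (D2 `+` A2))%E).
    by apply: measureU2; exact: mY.
  by rewrite (splitr e) EFinD; exact: lteD.
split.
- split; first exact: measurable0.
  by move=> e e0; exists set0 => //; rewrite setYK measure0 lte_fin.
- move=> D1 [mD1 h1]; rewrite setTD; split; first exact: measurableC.
  move=> e e0; have [A GA h] := h1 _ e0; exists (~` A); first exact: GC.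
  rewrite (_ : ~` D1 `+` ~` A = D1 `+` A) //.
  rewrite !setY_def; apply/seteqP; split=> x /= [[a1 a2]|[a1 a2]].
  + by right; split => //; apply: contrapT.
  + by left; split => //; apply: contrapT.
  + by right; split => // /(_ a1).
  + by left; split => // /(_ a1).
- move=> F apF.
  have mF k : measurable (F k) by have [] := apF k.
  have mUF : measurable (\bigcup_k F k) by exact: bigcupT_measurable.
  split => // e e0.
  pose H n := \bigcup_(k in `I_n) F k.
  have mH n : measurable (H n) by exact: bigcup_measurable.
  have apH n : ap (H n).
    elim: n => [|n IH].
      rewrite /H II0 bigcup_set0; split => // e' e'0.
      by exists set0 => //; rewrite setYK measure0 lte_fin.
    by rewrite /H IIS bigcup_setU bigcup_set1; exact: apU.
  have HF : \bigcup_n H n = \bigcup_k F k.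
    apply/seteqP; split=> x [n _]; first by move=> [k _ Fk]; exists k.
    by move=> Fx; exists n.+1 => //; exists n => /=.
  have finm (A : set T) : measurable A -> (mu A < +oo)%E.
    by move=> mA; apply: le_lt_trans mu_fin; apply: le_measure; rewrite ?inE.
  have : (mu \o (fun n => (\bigcup_k F k) `\` H n)) @ \oo -->
      mu (\bigcap_n ((\bigcup_k F k) `\` H n)).
    apply: nonincreasing_cvg_mu.
    - exact/finm/measurableD.
    - by move=> n; exact: measurableD.
    - by apply: bigcapT_measurable => n; exact: measurableD.
    - move=> m n mn; apply/subsetPset => x [Fx nH]; split => // -[k /= km Fk].
      by apply: nH; exists k => //=; exact: leq_trans mn.
  rewrite (_ : \bigcap_n _ = set0) ?measure0; last first.
    rewrite -subset0 => x h; have [[k _ Fk] _] := h 0%N I.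
    by have [_] := h k.+1 I; apply; exists k => /=.
  have e20 : 0 < e / 2 by rewrite divr_gt0.
  move=> /fine_cvgP[fin /cvgr_lt /(_ _ e20) c].
  have [n [fn cn]] := filter_ex (filterI fin c).
  have [A GA hA] := (apH n).2 _ e20.
  have mA := mG _ GA.
  exists A => //.
  apply: (@le_lt_trans _ _ (mu (((\bigcup_k F k) `\` H n) `|` (H n `+` A)))).
    apply: le_measure; rewrite ?inE.
    - exact: mY.
    - by apply: measurableU; [exact: measurableD|exact: mY].
    - rewrite !setY_def => x /= [[Fx nA]|[Ax nF]].
      + by have [Hx|Hx] := pselect (H n x); [right; left|left].
      + right; right; split => // -[k kn Fk]; apply: nF; exists k => //.
  apply: (@le_lt_trans _ _ (mu ((\bigcup_k F k) `\` H n) + mu (H n `+` A))%E).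
    by apply: measureU2; [exact: measurableD|exact: mY].
  rewrite (splitr e) EFinD; apply: lteD => //.
  by move: cn; rewrite -lte_fin fineK.
Qed.

End algebra_approximation.

Definition law {d d'} {T : measurableType d} {T' : measurableType d'} {R : realType}
    (P : probability T R) (f : T -> T') (mf : measurable_fun setT f) :
    probability T' R :=
  distribution P (mfun_Sub (mem_set mf) : {mfun T >-> T'}).

Lemma lawE {d d'} {T : measurableType d} {T' : measurableType d'} {R : realType}
    (P : probability T R) (f : T -> T') (mf : measurable_fun setT f) A :
  law P f mf A = P (f @^-1` A).
Proof. by []. Qed.

Section beta_mixing_sets.
Context {dO} {Omega : measurableType dO} {R : realType} (P : probability Omega R).
Variables (F F' : set (set Omega)).
Hypothesis (sF : sigma_algebra setT F) (sF' : sigma_algebra setT F').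
Hypothesis (mF : F `<=` measurable) (mF' : F' `<=` measurable).
Variables (beta : R) (hbeta : (beta_coef P F F' <= beta%:E)%E).

Definition rectangles : set (set (Omega * Omega)) :=
  [set A `*` A' | A in F & A' in F'].

Definition diag_pair (om : Omega) := (om, om).

Lemma measurable_diag_pair : measurable_fun setT diag_pair.
Proof. by apply: measurable_fun_pair. Qed.

(** Sets decided by one [F]-measurable and one [F']-measurable function with finitely many values.
    They are the finite unions of rectangles, in a form where complements negate the relation [S]
    and unions pair up the functions. *)
Let finite_valued (D : set (Omega * Omega)) :=
  exists (I I' : finType) (u : Omega -> I) (u' : Omega -> I') (S : I -> I' -> bool),
  [/\ forall i, F (u @^-1` [set i]), forall i, F' (u' @^-1` [set i]) &
    D = [set x | S (u x.1) (u' x.2)]].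

Let finite_valuedE I I' (u : Omega -> I) (u' : Omega -> I') (S : I -> I' -> bool) :
  [set x | S (u x.1) (u' x.2)] =
  \bigcup_(i in [set i : I * I' | S i.1 i.2])
     ((u @^-1` [set i.1]) `*` (u' @^-1` [set i.2])).
Proof.
apply/seteqP; split => [[x y] /= Sxy|[x y] [[i j] /= Sij [/= -> ->]]//].
by exists (u x, u' y).
Qed.

Let finite_valued_trivIset (I I' : finType) (u : Omega -> I) (u' : Omega -> I') 
   (D : set (I * I')) :
  trivIset D (fun i => (u @^-1` [set i.1]) `*` (u' @^-1` [set i.2])).
Proof.
move=> [i j] [i' j'] _ _ [[x y] [/= [ux uy] [ux' uy']]].
by rewrite -ux -uy -ux' -uy'.
Qed.


Let finite_valued_measurable D : finite_valued D -> measurable D.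
Proof.
move=> [I [I' [u [u' [S [Fu Fu' ->]]]]]]; rewrite (finite_valuedE I I' u u' S).
apply: fin_bigcup_measurable => [|[i j] _]; first exact: finite_finset.
by apply: measurableX; [exact/mF/Fu|exact/mF'/Fu'].
Qed.

Let fine_prod A A' : measurable A -> measurable A' ->
  fine ((P \x P)%E (A `*` A')) = fine (P A) * fine (P A').
Proof.
move=> mA mA'; rewrite product_measure1E // fineM //; exact: fin_num_measure.
Qed.

(** The level sets of [u] and [u'] are two finite partitions and the set is a disjoint union of some
    of their products. Extending the sum of absolute differences to all products gives at most twice
    the beta coefficient. *)
Let finite_valued_beta D : finite_valued D ->
  `|fine (P (diag_pair @^-1` D)) - fine ((P \x P)%E D)| <= 2 * beta.
Proof.
move=> [I [I' [u [u' [S [Fu Fu' ->]]]]]]; rewrite (finite_valuedE I I' u u' S).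
have mR (i : I * I') : measurable ((u @^-1` [set i.1]) `*` (u' @^-1` [set i.2])).
  by apply: measurableX; [exact/mF/Fu|exact/mF'/Fu'].
have fS : finite_set [set i : I * I' | S i.1 i.2] by exact: finite_finset.
have tS := @finite_valued_trivIset _ _ u u' [set i : I * I' | S i.1 i.2].
have E (Q : probability (Omega * Omega)%type R) :
  fine (Q (\bigcup_(i in [set i : I * I' | S i.1 i.2])
     ((u @^-1` [set i.1]) `*` (u' @^-1` [set i.2])))) =
  \sum_(i : I * I' | S i.1 i.2) fine (Q ((u @^-1` [set i.1]) `*` (u' @^-1` [set i.2]))).
  rewrite measure_fin_bigcup //.
  rewrite (fsbigE (enum [pred i : I * I' | S i.1 i.2])) ?enum_uniq //; last 2 first.
  - by move=> i /=; rewrite mem_enum.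
  - by move=> i Si; rewrite mem_enum inE Si.
  rewrite big_enum_cond /=.
  under eq_bigl do rewrite andb_idr ?inE//.
  by rewrite sum_fine // => i _; exact: fin_num_measure.
have -> : fine (P (diag_pair @^-1` \bigcup_(i in [set i : I * I' | S i.1 i.2])
     ((u @^-1` [set i.1]) `*` (u' @^-1` [set i.2])))) =
  \sum_(i : I * I' | S i.1 i.2) fine (P ((u @^-1` [set i.1]) `&` (u' @^-1` [set i.2]))).
  exact: (E (law P diag_pair measurable_diag_pair)).
rewrite E -sumrB.
apply: (@le_trans _ _ (\sum_(i : I * I') `|fine (P ((u @^-1` [set i.1]) `&` (u' @^-1` [set i.2])))
   - fine ((P \x P)%E ((u @^-1` [set i.1]) `*` (u' @^-1` [set i.2])))|)).
  apply: (le_trans (ler_norm_sum _ _ _)).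
  by rewrite [leRHS](bigID (fun i => S i.1 i.2)) /= lerDl sumr_ge0.
rewrite -lee_fin EFinM -lee_pdivrMl // (le_trans _ hbeta) // muleC.
apply: ereal_sup_ubound => /=.
exists #|I|, #|I'|, (fun k => u @^-1` [set enum_val k]), (fun k => u' @^-1` [set enum_val k]).
have part (J : finType) (v : Omega -> J) (G : set (set Omega)) :
  (forall i, G (v @^-1` [set i])) ->
  finite_partition G (fun k : 'I_#|J| => v @^-1` [set enum_val k]).
  move=> Gv; split => //.
    by move=> i j _ _ [x [/= -> /enum_val_inj]].
  apply/seteqP; split=> // x _; exists (enum_rank (v x)) => //=.
  by rewrite enum_rankK.
split; [exact: part|exact: part|].
rewrite muleC -EFinM; congr (_ * _)%:E.
rewrite -(pair_bigA _ (fun i j => `|fine (P ((u @^-1` [set i]) `&` (u' @^-1` [set j])))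
   - fine ((P \x P)%E ((u @^-1` [set i]) `*` (u' @^-1` [set j])))|)) /=.
rewrite (reindex _ (onW_bij _ (enum_val_bij I))) /=.
apply: eq_bigr => i _; rewrite (reindex _ (onW_bij _ (enum_val_bij I'))) /=.
apply: eq_bigr => j _; rewrite fine_prod //; [exact/mF/Fu|exact/mF'/Fu'].
Qed.

(** The image of [P] on the diagonal is the joint law, [P \x P] the law of two independent copies.
    Their difference is controlled on finite unions of rectangles, and such unions approximate every
    set of the generated sigma-algebra under both laws. *)
Lemma beta_mixing_rectangles D : <<s rectangles >> D ->
  `|fine (P (diag_pair @^-1` D)) - fine ((P \x P)%E D)| <= 2 * beta.
Proof.
move=> rD.
have F0 : F set0 by case: sF.
have F'0 : F' set0 by case: sF'.
have FC A : F A -> F (~` A) by move=> FA; rewrite -setTD; case: sF => _ + _; exact.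
have F'C A : F' A -> F' (~` A) by move=> FA; rewrite -setTD; case: sF' => _ + _; exact.
have FU A B : F A -> F B -> F (A `|` B).
  by move=> FA FB; rewrite -bigcup2E; case: sF => _ _; apply => -[|[|n]].
have F'U A B : F' A -> F' B -> F' (A `|` B).
  by move=> FA FB; rewrite -bigcup2E; case: sF' => _ _; apply => -[|[|n]].
have FI A B : F A -> F B -> F (A `&` B).
  by move=> FA FB; rewrite -(setCK (A `&` B)) setCI; apply/FC/FU; exact: FC.
have F'I A B : F' A -> F' B -> F' (A `&` B).
  by move=> FA FB; rewrite -(setCK (A `&` B)) setCI; apply/F'C/F'U; exact: F'C.
have Fb A (b : bool) : F A -> F ((fun x => x \in A) @^-1` [set b]).
  move=> FA; case: b.
    by rewrite (_ : _ @^-1` _ = A) //; apply/seteqP; split=> x /= h; [exact/set_mem|exact/mem_set].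
  rewrite (_ : _ @^-1` _ = ~` A); first exact: FC.
  by apply/seteqP; split=> x /= h; [move=> /mem_set; rewrite h|exact: memNset].
have F'b A (b : bool) : F' A -> F' ((fun x => x \in A) @^-1` [set b]).
  move=> FA; case: b.
    by rewrite (_ : _ @^-1` _ = A) //; apply/seteqP; split=> x /= h; [exact/set_mem|exact/mem_set].
  rewrite (_ : _ @^-1` _ = ~` A); first exact: F'C.
  by apply/seteqP; split=> x /= h; [move=> /mem_set; rewrite h|exact: memNset].
have fvR : rectangles `<=` finite_valued.
  move=> _ [A FA [A' FA' <-]].
  exists bool, bool, (fun x => x \in A), (fun x => x \in A'), andb; split.
  - by move=> b; exact: Fb.
  - by move=> b; exact: F'b.
  - apply/seteqP; split=> x /= => [[xA xA']|/andP[xA xA']].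
      by apply/andP; split; exact/mem_set.
    by split; exact/set_mem.
have fv0 : finite_valued set0.
  by apply: fvR; exists set0 => //; exists set0 => //; rewrite setX0.
have fvC D1 : finite_valued D1 -> finite_valued (~` D1).
  move=> [I [I' [u [u' [S [Fu Fu' ->]]]]]].
  exists I, I', u, u', (fun i j => ~~ S i j); split=> //.
  by apply/seteqP; split=> x /= /negP.
have fvU D1 D2 : finite_valued D1 -> finite_valued D2 -> finite_valued (D1 `|` D2).
  move=> [I [I' [u [u' [S [Fu Fu' ->]]]]]] [J [J' [v [v' [S' [Fv Fv' ->]]]]]].
  exists (I * J)%type, (I' * J')%type, (fun x => (u x, v x)), (fun x => (u' x, v' x)),
    (fun i j => S i.1 j.1 || S' i.2 j.2); split.
  - move=> [i j]; rewrite (_ : _ @^-1` _ = (u @^-1` [set i]) `&` (v @^-1` [set j])).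
      exact: FI.
    by apply/seteqP; split=> x /= [-> ->].
  - move=> [i j]; rewrite (_ : _ @^-1` _ = (u' @^-1` [set i]) `&` (v' @^-1` [set j])).
      exact: F'I.
    by apply/seteqP; split=> x /= [-> ->].
  - by apply/seteqP; split=> x /= /orP.
have mfv : finite_valued `<=` measurable by move=> ? /finite_valued_measurable.
have mD1 : <<s finite_valued >> `<=` measurable.
  by apply: smallest_sub => //; exact: sigma_algebra_measurable.
have gD : <<s finite_valued >> D by move: D rD; exact: sub_smallest2r.
have mD := mD1 _ gD.
pose Q1 := law P diag_pair measurable_diag_pair.
pose Q2 : probability (Omega * Omega)%type R := (P \x P)%E.
(* Approximation under the sum of the two laws yields a single approximant that is good for both. *)
have mu_fin : (measure_add Q1 Q2 setT < +oo)%E.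
  by rewrite /measure_add /msum /= !big_ord_recl big_ord0 /= !probability_setT ltry.
apply/ler_addgt0Pr => e e0.
have e20 : 0 < e / 2 by rewrite divr_gt0.
have [A fA] := g_sigma_algebra_approx _ mu_fin _ mfv fv0 fvC fvU _ gD _ e20.
have mA := mfv _ fA.
have mY (A1 B1 : set (Omega * Omega)) : measurable A1 -> measurable B1 -> measurable (A1 `+` B1).
  by move=> mA1 mB; rewrite setY_def; apply: measurableU; exact: measurableD.
move=> small; have {}small : (Q1 (D `+` A) + Q2 (D `+` A) < (e / 2)%:E)%E.
  by rewrite -measure_addE.
have diff (Q : probability (Omega * Omega)%type R) :
    `|fine (Q D) - fine (Q A)| <= fine (Q (D `+` A)).
  have fQ B : measurable B -> Q B \is a fin_num by move=> mB; exact: fin_num_measure.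
  have le1 B1 B2 : measurable B1 -> measurable B2 -> fine (Q B1) - fine (Q B2) <= fine (Q (B1 `+` B2)).
    move=> mB1 mB2; rewrite lerBlDl -fineD ?fQ //; last exact: mY.
    rewrite fine_le ?fin_numD ?fQ //; last 2 first.
      exact: mY.
    apply: (@le_trans _ _ (Q (B2 `|` (B1 `+` B2)))).
      apply: le_measure; rewrite ?inE //.
        by apply: measurableU => //; exact: mY.
      by move=> x B1x; have [B2x|B2x] := pselect (B2 x); [left|right; left].
    by apply: measureU2 => //; exact: mY.
  by rewrite ler_norml le1 // andbT lerNl opprB setYC le1.
have := diff Q1; have := diff Q2; have := finite_valued_beta _ fA.
rewrite -[P (diag_pair @^-1` D)]/(Q1 D) -[P (diag_pair @^-1` A)]/(Q1 A).
rewrite -/Q2 => h0 h2 h1.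
have f1 : Q1 (D `+` A) \is a fin_num by apply: fin_num_measure; exact: mY.
have f2 : Q2 (D `+` A) \is a fin_num by apply: fin_num_measure; exact: mY.
move: small; rewrite -(fineK f1) -(fineK f2) -EFinD lte_fin => small.
have -> : fine (Q1 D) - fine (Q2 D) = (fine (Q1 A) - fine (Q2 A)) +
  ((fine (Q1 D) - fine (Q1 A)) - (fine (Q2 D) - fine (Q2 A))) by ring.
apply: (le_trans (ler_normD _ _)); apply: lerD => //.
apply: (le_trans (ler_normB _ _)).
have := lerD h1 h2; lra.
Qed.

End beta_mixing_sets.

Section real_integral.
Context {d} {T : measurableType d} {R : realType} (mu : probability T R).
Implicit Types f g : T -> R.

Definition integrableR f := mu.-integrable setT (EFin \o f).

Lemma integrableR_measurable f : integrableR f -> measurable_fun setT f.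
Proof. by move/measurable_int/measurable_EFinP. Qed.

Lemma integrableR_le f g : measurable_fun setT f -> (forall x, `|f x| <= g x) ->
  integrableR g -> integrableR f.
Proof.
move=> mf fg; apply: le_integrable => //; first exact/measurable_EFinP.
by move=> x _; rewrite /= lee_fin (le_trans (fg x)) // ler_norm.
Qed.

Lemma integrableR_cst c : integrableR (fun=> c).
Proof. exact: finite_measure_integrable_cst. Qed.

Lemma integrableRD f g : integrableR f -> integrableR g ->
  integrableR (fun x => f x + g x).
Proof. by move=> hf hg; have := integrableD measurableT hf hg. Qed.

Lemma integrableRZ c f : integrableR f -> integrableR (fun x => c * f x).
Proof. by move=> hf; have := integrableZl measurableT c hf. Qed.

Lemma integrableRN f : integrableR f -> integrableR (fun x => - f x).
Proof. by move=> hf; under eq_fun do rewrite -mulN1r; exact: integrableRZ. Qed.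

Lemma integrableRB f g : integrableR f -> integrableR g ->
  integrableR (fun x => f x - g x).
Proof. by move=> hf hg; apply: integrableRD => //; exact: integrableRN. Qed.

Lemma integrableR_sum I (s : seq I) (f : I -> T -> R) :
  (forall i, integrableR (f i)) -> integrableR (fun x => \sum_(i <- s) f i x).
Proof.
move=> hf; elim: s => [|i s IH].
  by under eq_fun do rewrite big_nil; exact: integrableR_cst.
by under eq_fun do rewrite big_cons; exact: integrableRD.
Qed.

Lemma RintD f g : integrableR f -> integrableR g ->
  \int[mu]_x (f x + g x) = \int[mu]_x f x + \int[mu]_x g x.
Proof. by move=> hf hg; exact: RintegralD. Qed.

Lemma RintB f g : integrableR f -> integrableR g ->
  \int[mu]_x (f x - g x) = \int[mu]_x f x - \int[mu]_x g x.
Proof. by move=> hf hg; exact: RintegralB. Qed.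

Lemma RintZ c f : integrableR f -> \int[mu]_x (c * f x) = c * \int[mu]_x f x.
Proof. by move=> hf; exact: RintegralZl. Qed.

Lemma Rint_cst c : \int[mu]_x (c : R) = c.
Proof. by rewrite /Rintegral integral_cst //= probability_setT mule1. Qed.

Lemma Rint_sum I (s : seq I) (f : I -> T -> R) :
  (forall i, integrableR (f i)) ->
  \int[mu]_x (\sum_(i <- s) f i x) = \sum_(i <- s) \int[mu]_x f i x.
Proof.
move=> hf; elim: s => [|i s IH].
  by under eq_Rintegral do rewrite big_nil; rewrite big_nil Rint_cst.
under eq_Rintegral do rewrite big_cons.
by rewrite big_cons RintD ?IH //; exact: integrableR_sum.
Qed.

Lemma Rint_le f g : integrableR f -> integrableR g -> (forall x, f x <= g x) ->
  \int[mu]_x f x <= \int[mu]_x g x.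
Proof. by move=> hf hg fg; apply: le_Rintegral. Qed.

Lemma Rint_ge0 f : (forall x, 0 <= f x) -> 0 <= \int[mu]_x f x.
Proof. by move=> f0; apply: Rintegral_ge0. Qed.

Lemma Rint_norm_le f g : measurable_fun setT f -> integrableR g ->
  (forall x, `|f x| <= g x) -> `|\int[mu]_x f x| <= \int[mu]_x g x.
Proof.
move=> mf hg fg; have hf := integrableR_le _ _ mf fg hg.
apply: (le_trans (le_normr_Rintegral measurableT hf)).
apply: Rint_le => //; apply: (integrableR_le _ g) => //.
  by apply: measurableT_comp => //; exact: normr_measurable.
by move=> x; rewrite normr_id.
Qed.

Lemma Rint_indic A : measurable A -> \int[mu]_x (\1_A x : R) = fine (mu A).
Proof. by move=> mA; rewrite /Rintegral integral_indic // setIT. Qed.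

Lemma integrableR_indic A : measurable A -> integrableR (\1_A).
Proof.
move=> mA; apply: (integrableR_le _ (fun=> 1)); last exact: integrableR_cst.
  exact: measurable_indic.
by move=> x; rewrite indicE ger0_norm //; case: (_ \in _).
Qed.

End real_integral.

(** A discrete layer-cake formula: for [eta > 0], the sum is [x] rounded down to a multiple of [eta]
    and capped at [K * eta]. *)
Lemma layer_sum {R : realType} (eta x : R) (K : nat) : 0 <= eta -> 0 <= x ->
  let S := \sum_(k < K) eta * (k.+1%:R * eta <= x)%R%:R in
  [/\ S <= x, K%:R * eta <= x -> S = K%:R * eta & Num.min x (K%:R * eta) <= S + eta].
Proof.
move=> eta0 x0; elim: K => [|K [h1 h2 h3]] /=.
  by rewrite big_ord0 mul0r; split => //; rewrite add0r ge_min eta0 orbT.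
rewrite big_ord_recr /=.
have KS : K.+1%:R * eta = K%:R * eta + eta by rewrite -natr1 mulrDl mul1r.
case: (leP (K.+1%:R * eta) x) => [le|gt].
  have SE : \sum_(k < K) eta * (k.+1%:R * eta <= x)%R%:R = K%:R * eta.
    by apply: h2; move: le; rewrite KS; lra.
  by rewrite mulr1 SE -KS; split => //; lra.
rewrite mulr0 addr0; split => //.
case: (leP (K%:R * eta) x) h3 => [le|gt'] //.
by move=> _; rewrite h2 // -KS; exact: ltW.
Qed.

Section total_variation_moment.
Context {d} {T : measurableType d} {R : realType} (Q1 Q2 : probability T R).
Variables (G : set (set T)) (mG : G `<=` measurable).
Variables (B : R) (B0 : 0 <= B).
Hypothesis QB : forall D, G D -> `|fine (Q1 D) - fine (Q2 D)| <= B.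
Variables (q A : R) (q1 : 1 < q) (g : T -> R).
Hypothesis (ig1 : integrableR Q1 g) (gA1 : \int[Q1]_x g x <= A).

(** Truncation at level [t]. Below [t], the function is a superposition of level sets, on each of
    which the two laws differ by at most [B]. Above [t], [f <= t ^ (1 - q) * f ^ q], whose integral
    is controlled by [A]. *)
Let half (f : T -> R) (t : R) : 0 < t ->
  (forall x, 0 <= f x) -> (forall r, G [set x | r <= f x]) ->
  integrableR Q1 f -> integrableR Q2 f -> (forall x, f x `^ q <= g x) ->
  \int[Q1]_x f x - \int[Q2]_x f x <= B * t + A * t `^ (1 - q).
Proof.
move=> t0 f0 Gf if1 if2 fg.
apply/ler_addgt0Pr => e e0.
pose K := (Num.truncn (t / e)).+1.
pose eta := t / K%:R.
have K0 : 0 < K%:R :> R by [].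
have eta0 : 0 < eta by rewrite divr_gt0.
have etae : eta <= e.
  by rewrite ler_pdivrMr // mulrC -ler_pdivrMr // ltW // truncnS_gt.
have Keta : K%:R * eta = t by rewrite mulrC divfK // gt_eqF.
pose h x := \sum_(k < K) eta * (\1_[set y | k.+1%:R * eta <= f y] x : R).
have hE x : h x = \sum_(k < K) eta * (k.+1%:R * eta <= f x)%R%:R.
  by apply: eq_bigr => k _; rewrite indicE mem_setE.
have mS r : measurable [set x | r <= f x] by exact: mG.
have ih Q : integrableR Q h.
  by apply: integrableR_sum => k; apply: integrableRZ; exact: integrableR_indic.
have Ih (Q : probability T R) : \int[Q]_x h x = \sum_(k < K) eta * fine (Q [set y | k.+1%:R * eta <= f y]).
  transitivity (\sum_(k < K) \int[Q]_x (eta * (\1_[set y | k.+1%:R * eta <= f y] x : R))).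
    apply: (Rint_sum Q _ (index_enum 'I_K)
      (fun k x => eta * (\1_[set y | k.+1%:R * eta <= f y] x))) => k.
    by apply: integrableRZ; exact: integrableR_indic.
  by apply: eq_bigr => k _; rewrite RintZ ?Rint_indic //; exact: integrableR_indic.
have hB : \int[Q1]_x h x - \int[Q2]_x h x <= B * t.
  rewrite !Ih -sumrB -Keta.
  have -> : B * (K%:R * eta) = \sum_(k < K) eta * B.
    by rewrite sumr_const card_ord -mulr_natl; ring.
  apply: ler_sum => k _; rewrite -mulrBr ler_pM2l //.
  by apply: le_trans (QB _ (Gf _)); exact: ler_norm.
have fle x : f x <= (h x + eta) + t `^ (1 - q) * g x.
  have [_ _] := layer_sum eta (f x) K (ltW eta0) (f0 x).
  rewrite -hE Keta => hm.
  have tg : 0 <= t `^ (1 - q) * g x.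
    by rewrite mulr_ge0 ?powR_ge0 // (le_trans _ (fg x)) // powR_ge0.
  case: (leP (f x) t) => [ft|tf].
    by rewrite -[leLHS]addr0 lerD //; move: hm; rewrite min_l.
  apply: (@le_trans _ _ (t `^ (1 - q) * g x)).
    apply: (@le_trans _ _ (t `^ (1 - q) * f x `^ q)); last first.
      by rewrite ler_pM2l ?powR_gt0.
    have fx0 : 0 < f x by exact: lt_trans t0 tf.
    rewrite -[leLHS]powRr1 // -[X in f x `^ X](subrK q) powRD; last first.
      by rewrite (gt_eqF fx0) implybT.
    rewrite ler_pM2r ?powR_gt0 // -(opprB q) !powRN lef_pV2 ?posrE ?powR_gt0 //.
    by apply: ge0_ler_powR; rewrite ?nnegrE ?(ltW t0) ?(ltW fx0) ?(ltW tf) // subr_ge0 ltW.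
  rewrite lerDr addr_ge0 ?(ltW eta0) // hE sumr_ge0 // => k _.
  by rewrite mulr_ge0 // ltW.
have hle x : h x <= f x.
  by have [+ _ _] := layer_sum eta (f x) K (ltW eta0) (f0 x); rewrite -hE.
have I1 : \int[Q1]_x f x <= \int[Q1]_x h x + eta + t `^ (1 - q) * A.
  have i1 : integrableR Q1 (fun x => h x + eta).
    by apply: integrableRD => //; exact: integrableR_cst.
  have i2 : integrableR Q1 (fun x => t `^ (1 - q) * g x) by exact: integrableRZ.
  apply: (le_trans (Rint_le _ _ _ if1 (integrableRD _ _ _ i1 i2) fle)).
  rewrite RintD // RintD ?Rint_cst ?RintZ //; last exact: integrableR_cst.
  by rewrite lerD2l ler_wpM2l ?powR_ge0.
have I2 := Rint_le _ _ _ (ih Q2) if2 hle.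
have := mulrC A (t `^ (1 - q)); lra.
Qed.

(** The level [t = B ^ (- 1 / q)] makes both terms of the truncation bound multiples of
    [B ^ (1 - 1 / q)]. *)
Lemma ge0_total_variation_moment (f : T -> R) :
  (forall x, 0 <= f x) -> (forall r, G [set x | r <= f x]) ->
  integrableR Q1 f -> integrableR Q2 f -> (forall x, f x `^ q <= g x) ->
  \int[Q1]_x f x - \int[Q2]_x f x <= (1 + A) * B `^ (1 - q^-1).
Proof.
move=> f0 Gf if1 if2 fg.
have q0 : 0 < q := lt_trans ltr01 q1.
have th0 : 0 < 1 - q^-1 by rewrite subr_gt0 invf_lt1.
have A0 : 0 <= A.
  by apply: le_trans gA1; apply: Rint_ge0 => x; apply: le_trans (fg x); exact: powR_ge0.
have key B' : 0 < B' -> B <= B' ->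
   \int[Q1]_x f x - \int[Q2]_x f x <= (1 + A) * B' `^ (1 - q^-1).
  move=> B'0 BB'; have t0 : 0 < B' `^ (- q^-1) by rewrite powR_gt0.
  apply: (le_trans (half f _ t0 f0 Gf if1 if2 fg)).
  rewrite mulrDl mul1r lerD //.
    rewrite [leRHS]powRD ?gt_eqF ?implybT // powRr1 ?(ltW B'0) //.
    by rewrite ler_pM2r.
  rewrite ler_wpM2l // -powRrM.
  by rewrite mulNr mulrBr mulr1 mulVf ?gt_eqF // opprB.
(* For [B = 0] that level does not exist, but every [B' > 0] is an admissible bound. If the
   difference [D] of the integrals were positive, the [B'] chosen below would bound it by
   [D / 2]. *)
have [B00|Bn0] := eqVneq B 0; last by apply: key => //; rewrite lt_neqAle eq_sym Bn0.
rewrite B00 powR0 ?gt_eqF // mulr0 leNgt; apply/negP => D0.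
set D := (_ - _) in key D0.
pose c := D / (2 * (1 + A)).
have c0 : 0 < c by rewrite divr_gt0 // mulr_gt0 //; lra.
have := key (c `^ (1 - q^-1)^-1).
rewrite -powRrM mulVf ?gt_eqF // powRr1 ?(ltW c0) // powR_gt0 // B00 powR_ge0.
move=> /(_ isT isT).
have A1 : 1 + A != 0 by rewrite gt_eqF // ltr_pwDl.
have -> : (1 + A) * c = D / 2 by rewrite /c; field; rewrite A1.
move: D0; lra.
Qed.

End total_variation_moment.

Section total_variation_moment_signed.
Context {d} {T : measurableType d} {R : realType} (Q1 Q2 : probability T R).
Variables (G : set (set T)) (mG : G `<=` measurable) (GT : G setT).
Variables (B : R) (B0 : 0 <= B).
Hypothesis QB : forall D, G D -> `|fine (Q1 D) - fine (Q2 D)| <= B.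
Variables (q A : R) (q1 : 1 < q) (g : T -> R).
Hypothesis (ig1 : integrableR Q1 g) (ig2 : integrableR Q2 g).
Hypothesis (gA1 : \int[Q1]_x g x <= A) (gA2 : \int[Q2]_x g x <= A).

(** Positive and negative parts are treated separately, and the two laws exchange roles for the
    lower estimates. The constant 4 is not sharp. *)
Lemma total_variation_moment (f : T -> R) :
  (forall r, G [set x | r <= f x]) -> (forall r, G [set x | f x <= r]) ->
  integrableR Q1 f -> integrableR Q2 f -> (forall x, `|f x| `^ q <= g x) ->
  `|\int[Q1]_x f x - \int[Q2]_x f x| <= 4 * ((1 + A) * B `^ (1 - q^-1)).
Proof.
move=> Gf1 Gf2 if1 if2 fg.
have q0 : 0 < q := lt_trans ltr01 q1.
pose fp x := Num.max (f x) 0.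
pose fn x := Num.max (- f x) 0.
have fpn x : f x = fp x - fn x.
  by rewrite /fp /fn; case: (leP 0 (f x)) => h; case: (leP 0 (- f x)) => h'; lra.
have fpn' x : `|f x| = fp x + fn x.
  rewrite /fp /fn; case: (ler0P (f x)) => h; case: (leP 0 (f x)) => h1;
    case: (leP 0 (- f x)) => h2; lra.
have fp0 x : 0 <= fp x by rewrite le_max lexx orbT.
have fn0 x : 0 <= fn x by rewrite le_max lexx orbT.
have mf : measurable_fun setT f by exact: integrableR_measurable if1.
have iabs (Q : probability T R) : integrableR Q f -> integrableR Q (fun x => `|f x|).
  by move=> iQ; have := integrable_norm iQ.
have ifp (Q : probability T R) : integrableR Q f -> integrableR Q fp.
  move=> iQ; apply: (integrableR_le _ _ (fun x => `|f x|)); last exact: iabs.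
    by apply: measurable_maxr.
  by move=> x; rewrite ger0_norm // fpn' lerDl.
have ifn (Q : probability T R) : integrableR Q f -> integrableR Q fn.
  move=> iQ; apply: (integrableR_le _ _ (fun x => `|f x|)); last exact: iabs.
    by apply: measurable_maxr => //; exact: measurableT_comp.
  by move=> x; rewrite ger0_norm // fpn' lerDr.
have Gfp r : G [set x | r <= fp x].
  case: (leP r 0) => r0.
    rewrite (_ : [set _ | _] = setT) //; apply/seteqP; split=> // x _ /=.
    exact: le_trans (fp0 x).
  rewrite (_ : [set _ | _] = [set x | r <= f x]) //.
  by apply/seteqP; split=> x /=; rewrite /fp le_max leNgt (leNgt r 0) r0 orbF -leNgt.
have Gfn r : G [set x | r <= fn x].
  case: (leP r 0) => r0.
    rewrite (_ : [set _ | _] = setT) //; apply/seteqP; split=> // x _ /=.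
    exact: le_trans (fn0 x).
  rewrite (_ : [set _ | _] = [set x | f x <= - r]) //.
  by apply/seteqP; split=> x /=; rewrite /fn le_max lerNr (leNgt r 0) r0 orbF.
have pw (u : T -> R) : (forall x, 0 <= u x) -> (forall x, u x <= `|f x|) -> forall x, u x `^ q <= g x.
  move=> u0 uf x; apply: le_trans (fg x).
  by apply: ge0_ler_powR; rewrite ?nnegrE ?uf // ltW.
have fpf x : fp x <= `|f x| by rewrite fpn' lerDl.
have fnf x : fn x <= `|f x| by rewrite fpn' lerDr.
have QB' D : G D -> `|fine (Q2 D) - fine (Q1 D)| <= B.
  by move=> GD; rewrite distrC; exact: QB.
have k1 := ge0_total_variation_moment Q1 Q2 G mG B B0 QB q A q1 g ig1 gA1.
have k2 := ge0_total_variation_moment Q2 Q1 G mG B B0 QB' q A q1 g ig2 gA2.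
have := k1 fp fp0 Gfp (ifp _ if1) (ifp _ if2) (pw _ fp0 fpf).
have := k1 fn fn0 Gfn (ifn _ if1) (ifn _ if2) (pw _ fn0 fnf).
have := k2 fp fp0 Gfp (ifp _ if2) (ifp _ if1) (pw _ fp0 fpf).
have := k2 fn fn0 Gfn (ifn _ if2) (ifn _ if1) (pw _ fn0 fnf).
have E (Q : probability T R) : integrableR Q f ->
    \int[Q]_x f x = \int[Q]_x fp x - \int[Q]_x fn x.
  by move=> iQ; under eq_Rintegral do rewrite fpn; rewrite RintB //; [exact: ifp|exact: ifn].
rewrite (E Q1 if1) (E Q2 if2) => h1 h2 h3 h4.
by rewrite ler_norml; apply/andP; split; lra.
Qed.

End total_variation_moment_signed.

Section law_integral.
Context {d d'} {T : measurableType d} {T' : measurableType d'} {R : realType}.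
Variables (P : probability T R) (phi : T -> T') (mphi : measurable_fun setT phi).
Variables (f : T' -> R) (mf : measurable_fun setT f).

Lemma integrableR_law : integrableR P (f \o phi) -> integrableR (law P phi mphi) f.
Proof.
by move=> h; apply: (integrable_pushforward mphi) => //; exact/measurable_EFinP.
Qed.

Lemma Rint_law : integrableR P (f \o phi) ->
  \int[law P phi mphi]_x f x = \int[P]_x f (phi x).
Proof.
move=> h; rewrite /Rintegral; congr fine.
rewrite (integral_pushforward mphi) //; exact/measurable_EFinP.
Qed.

End law_integral.

Lemma ler1_norm_powR {R : realType} (q x : R) : 1 <= q -> `|x| <= 1 + `|x| `^ q.
Proof.
move=> q1; case: (leP `|x| 1) => h; first by rewrite (le_trans h) // lerDl powR_ge0.
by rewrite (le_trans (le1r_powR (ltW h) q1)) // lerDr.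
Qed.

Section beta_mixing_expectation.
Context {dO} {Omega : measurableType dO} {R : realType} (P : probability Omega R).
Variables (F F' : set (set Omega)).
Hypothesis (sF : sigma_algebra setT F) (sF' : sigma_algebra setT F').
Hypothesis (mF : F `<=` measurable) (mF' : F' `<=` measurable).
Variables (beta : R) (beta0 : 0 <= beta) (hbeta : (beta_coef P F F' <= beta%:E)%E).
Variables (q A : R) (q1 : 1 < q) (g : Omega * Omega -> R).
Hypothesis (mg : measurable_fun setT g).
Hypothesis (ig1 : integrableR P (fun om => g (om, om)))
  (gA1 : \int[P]_om g (om, om) <= A).
Hypothesis (ig2 : integrableR (P \x P)%E g) (gA2 : \int[(P \x P)%E]_x g x <= A).

Lemma measurable_rectangles : <<s rectangles F F' >> `<=` measurable.
Proof.
apply: smallest_sub; first exact: sigma_algebra_measurable.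
by move=> _ [A0 FA [B FB <-]]; apply: measurableX; [exact: mF|exact: mF'].
Qed.

(** The function [f] is any function of the two copies, not only a product of a function of each.
    This is what beta-mixing provides, and it is applied to weights that couple the positions of two
    points. *)
Lemma beta_mixing_expectation (f : Omega * Omega -> R) :
  measurable_fun (setT : set (g_sigma_algebraType (rectangles F F'))) f ->
  (forall x, `|f x| `^ q <= g x) ->
  `|\int[P]_om f (om, om) - \int[(P \x P)%E]_x f x| <=
    4 * ((1 + A) * (2 * beta) `^ (1 - q^-1)).
Proof.
move=> Ff fg.
have mf : measurable_fun setT f.
  move=> _ Y mY; rewrite setTI; apply: measurable_rectangles.
  by have := Ff measurableT _ mY; rewrite setTI.
have fg1 x : `|f x| <= 1 + g x.
  by rewrite (le_trans (ler1_norm_powR q _ (ltW q1))) // lerD2l.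
have if1 : integrableR P (fun om => f (om, om)).
  apply: (integrableR_le _ _ (fun om => 1 + g (om, om))) => //.
    by apply: (measurableT_comp mf); exact: measurable_diag_pair.
  by apply: integrableRD => //; exact: integrableR_cst.
have if2 : integrableR (P \x P)%E f.
  apply: (integrableR_le _ _ (fun x => 1 + g x)) => //.
  by apply: integrableRD => //; exact: integrableR_cst.
have := total_variation_moment (law P diag_pair measurable_diag_pair) (P \x P)%E
  <<s rectangles F F' >> measurable_rectangles _ (2 * beta) _ _ q A q1 g _ _ _ _ f _ _ _ _ fg.
rewrite !Rint_law //; apply => //.
- exact: (@measurableT _ (g_sigma_algebraType (rectangles F F'))).

- by rewrite mulr_ge0.
- by move=> D GD; exact: (beta_mixing_rectangles P F F' sF sF' mF mF' beta hbeta D GD).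
- exact: integrableR_law.
- move=> r; have := Ff measurableT `[r, +oo[%classic (measurable_itv _).
  by rewrite setTI; congr (<<s _ >> _); apply/seteqP; split=> x /=; rewrite in_itv /= andbT.
- move=> r; have := Ff measurableT `]-oo, r]%classic (measurable_itv _).
  by rewrite setTI; congr (<<s _ >> _); apply/seteqP; split=> x /=; rewrite in_itv.
- exact: integrableR_law.
Qed.

End beta_mixing_expectation.

(** * Borel sets, coordinates and the points in a window *)

Section sigma_algebra_measurability.
Context {Z : Type} (S : set (set Z)) (sS : sigma_algebra setT S).

(** Measurability for a domain that carries a set of sets instead of a measurable structure; it is
    used with the Borel sets of locations, of marks and of their product. *)
Definition smeas {d} {Y : measurableType d} (f : Z -> Y) :=
  forall A, measurable A -> S (f @^-1` A).

Lemma sigma_setC A : S A -> S (~` A).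
Proof. by move=> SA; rewrite -setTD; case: sS => _ + _; exact. Qed.

Lemma sigma_setU A B : S A -> S B -> S (A `|` B).
Proof. by move=> SA SB; rewrite -bigcup2E; case: sS => S0 _; apply => -[|[|n]]. Qed.

Lemma sigma_setI A B : S A -> S B -> S (A `&` B).
Proof.
move=> SA SB; rewrite -(setCK (A `&` B)) setCI.
by apply: sigma_setC; apply: sigma_setU; exact: sigma_setC.
Qed.

Lemma sigma_setT : S setT.
Proof. by rewrite -setC0; apply: sigma_setC; case: sS. Qed.

Lemma smeas_generated {d} {Y : measurableType d} (G : set (set Y)) (f : Z -> Y) :
  @measurable _ Y = <<s G >> -> (forall B, G B -> S (f @^-1` B)) -> smeas f.
Proof.
move=> mG GS A; rewrite mG; move: A.
apply: (@smallest_sub _ _ _ [set A | S (f @^-1` A)]) => //; split => /=.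
- by rewrite preimage_set0; case: sS.
- by move=> A; rewrite setTD preimage_setC; exact: sigma_setC.
- by move=> F SF; rewrite preimage_bigcup; case: sS => _ _; exact.
Qed.

Lemma smeas_comp {d d'} {Y : measurableType d} {Y' : measurableType d'}
  (f : Z -> Y) (g : Y -> Y') : measurable_fun setT g -> smeas f -> smeas (g \o f).
Proof.
by move=> mg mf A mA; rewrite comp_preimage; apply: mf; rewrite -[_ @^-1` _]setTI; exact: mg.
Qed.

Lemma smeas_pair {d d'} {Y : measurableType d} {Y' : measurableType d'}
  (f : Z -> Y) (g : Z -> Y') : smeas f -> smeas g -> smeas (fun z => (f z, g z)).
Proof.
move=> mf mg; apply: (smeas_generated _ _ (measurable_prod_measurableType _ _)).
move=> _ [A mA [B mB <-]].
by apply: (sigma_setI (f @^-1` A) (g @^-1` B)); [exact: mf|exact: mg].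
Qed.

Lemma smeas_tuple {d} {Y : measurableType d} n (f : Z -> n.-tuple Y) :
  (forall i, smeas (fun z => tnth (f z) i)) -> smeas f.
Proof.
move=> mf; pose G : set (set (n.-tuple Y)) := \big[setU/set0]_(i < n)
  preimage_set_system setT (fun t : n.-tuple Y => tnth t i) measurable.
have mG : @measurable _ (n.-tuple Y) = <<s G >> by [].
apply: (smeas_generated _ _ mG) => B.
rewrite /G -bigcup_seq => -[i _ [A mA <-]].
by rewrite setTI; exact: mf.
Qed.

Lemma smeas_bool (f : Z -> bool) : S [set z | f z] -> smeas f.
Proof.
move=> Sf A _; have -> : f @^-1` A =
   ([set z | f z] `&` (if true \in A then setT else set0)) `|`
   (~` [set z | f z] `&` (if false \in A then setT else set0)).
  apply/seteqP; split=> z /=.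
    move=> Afz; case fz: (f z); [left|right]; split=> //.
      by rewrite ifT // inE -fz.
    by rewrite ifT // inE -fz.
  by move=> [[fz]|[/negP/negbTE fz]]; case: ifP => // + _; rewrite inE fz.
have S0 : S set0 by case: sS.
apply: sigma_setU; apply: sigma_setI => //; try exact: sigma_setC.
  by case: ifP => _ //; exact: sigma_setT.
by case: ifP => _ //; exact: sigma_setT.
Qed.

Lemma smeas_real {R : realType} (f : Z -> measurableTypeR R) :
  (forall r : R, S [set z | r < f z]) -> smeas f.
Proof.
move=> Sf; apply: (smeas_generated _ _ (RGenOInfty.measurableE R)) => _ [r ->].
rewrite (_ : _ @^-1` _ = [set z | r < f z]) //.
by apply/seteqP; split=> z /=; rewrite in_itv /= andbT.
Qed.

End sigma_algebra_measurability.

Lemma sigma_algebra_borel (T : topologicalType) : sigma_algebra setT (@borel T).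
Proof. exact: smallest_sigma_algebra. Qed.

Lemma open_borel (T : topologicalType) (A : set T) : open A -> borel A.
Proof. exact: sub_sigma_algebra. Qed.

Lemma borel_preimage (T T' : topologicalType) (f : T -> T') (B : set T') :
  continuous f -> borel B -> borel (f @^-1` B).
Proof.
move=> /continuousP cf; move: B.
apply: (@smallest_sub _ _ _ [set B | borel (f @^-1` B)]).
  split => /=.
  - by rewrite preimage_set0; case: (sigma_algebra_borel T).
  - by move=> A; rewrite setTD preimage_setC; exact: (sigma_setC _ (sigma_algebra_borel T)).
  - by move=> F SF; rewrite preimage_bigcup; case: (sigma_algebra_borel T) => _ _; exact.
by move=> B oB /=; apply: open_borel; exact: cf.
Qed.

Section euclidean_tuple.
Context {R : realType} {d : nat}.
Local Notation E := (d.-tuple (measurableTypeR R)).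

Definition tuple_of_row (x : 'rV[R]_d) : E := [tuple x ord0 i | i < d].
Definition row_of_tuple (t : E) : 'rV[R]_d := \row_i tnth t i.

Lemma tuple_of_rowK : cancel tuple_of_row row_of_tuple.
Proof. by move=> x; apply/rowP => i; rewrite mxE tnth_mktuple. Qed.

Lemma row_of_tupleK : cancel row_of_tuple tuple_of_row.
Proof. by move=> t; apply: eq_from_tnth => i; rewrite tnth_mktuple mxE. Qed.

Lemma smeas_tuple_of_row : smeas (@borel _) tuple_of_row.
Proof.
apply: smeas_tuple; first exact: sigma_algebra_borel.
move=> i; apply: smeas_real; first exact: sigma_algebra_borel.
move=> r; apply: open_borel.
have -> : [set z | r < tnth (tuple_of_row z) i] =
    (fun z : 'rV[R]_d => z ord0 i) @^-1` [set x | r < x].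
  by apply/seteqP; split=> z /=; rewrite tnth_mktuple.
apply: open_comp; last exact: open_gt.
by move=> z _; exact: coord_continuous.
Qed.

(** An open set for the maximum norm is the union of the countably many boxes with rational corners
    that it contains. *)
Lemma measurable_open_tuple (U : set 'rV[R]_d) : open U ->
  measurable [set t : E | U (row_of_tuple t)].
Proof.
move=> oU.
pose box (q : {ffun 'I_d -> rat * rat}) : set E :=
  [set t | forall i, ratr (q i).1 < tnth t i < ratr (q i).2].
pose good (q : {ffun 'I_d -> rat * rat}) : set E :=
  if `[< box q `<=` [set t | U (row_of_tuple t)] >] then box q else set0.
have -> : [set t : E | U (row_of_tuple t)] = \bigcup_q good q.
  apply/seteqP; split => [t /= Ut|t [q _]]; last first.
    by rewrite /good; case: asboolP => // sub /sub.
  have := oU; rewrite openE => /(_ _ Ut) /nbhs_ballP[e /= e0 eU].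
  have near i : exists q : rat * rat, [/\ ratr q.1 < tnth t i, tnth t i < ratr q.2,
      tnth t i - e < ratr q.1 & ratr q.2 < tnth t i + e].
    have [|q1] := @rat_in_itvoo R (tnth t i - e) (tnth t i); first by lra.
    have [|q2] := @rat_in_itvoo R (tnth t i) (tnth t i + e); first by lra.
    by rewrite !in_itv /= => /andP[a b] /andP[a' b']; exists (q1, q2).
  have [q hq] := choice near.
  exists [ffun i => q i] => //; rewrite /good; case: asboolP => [_|].
    by move=> i; rewrite ffunE; have [-> ->] := hq i.
  case=> t' /= bt'; apply: eU; split => // i j; rewrite !mxE /ball /=.
  have := bt' j; rewrite ffunE => /andP[a b]; have [a1 a2 a3 a4] := hq j.
  by rewrite ltr_norml; apply/andP; split; lra.
apply: countable_bigcupT_measurable; first exact: countableP.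
move=> q; rewrite /good; case: asboolP => _ //.
rewrite (_ : box q = \bigcap_(i in [set: 'I_d])
   ((fun t : E => tnth t i) @^-1` [set` `]ratr (q i).1, ratr (q i).2[])); last first.
  apply/seteqP; split=> t h i; first by move=> _ /=; rewrite in_itv; exact: h.
  by have := h i I; rewrite /= in_itv.
apply: fin_bigcap_measurable => // i _.
rewrite -[X in measurable X]setTI; apply: measurable_tnth => //.
Qed.

Lemma measurable_closed_tuple (W : set 'rV[R]_d) : closed W ->
  measurable [set t : E | W (row_of_tuple t)].
Proof.
move=> cW; rewrite -[X in measurable X]setCK; apply: measurableC.
by apply: (measurable_open_tuple (~` W)); exact: closed_openC.
Qed.

End euclidean_tuple.

Section stationary_integrals.
Context {R : realType} {d : nat} {dO : measure_display} {Omega : measurableType dO}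
  {M : topologicalType} (P : probability Omega R).
Variable X : point_family R d Omega M.
Hypothesis X_mpp : is_marked_point_process X.
Hypothesis X_stationary : stationary P X.
Local Notation Z := ('rV[R]_d * M)%type.
Local Notation configuration := (set Z -> \bar R).

Definition conf_generators : set (set configuration) :=
  [set G | exists E U, [/\ borel E, measurable U & G = [set mu : configuration | U (mu E)]]].

Local Notation conf := (g_sigma_algebraType conf_generators).

Lemma mpp_count_shift x om (G : set Z) :
  mpp_count (shift_mpp x X) om G = mpp_count X om ((fun z => (z.1 - x, z.2)) @^-1` G).
Proof. by []. Qed.

Lemma borel_shift x (G : set Z) : borel G ->
  borel ((fun z : Z => (z.1 - x, z.2)) @^-1` G).
Proof.
have cf : continuous (fun z : Z => (z.1 - x, z.2)).
  move=> [a m].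
  have h1 : z.1 - x @[z --> (a, m)] --> (a - x).
    by apply: cvgB; [exact: cvg_fst|exact: cvg_cst].
  have h2 : z.2 @[z --> (a, m)] --> m by exact: cvg_snd.
  exact: (cvg_pair h1 h2).
exact: borel_preimage.
Qed.

Lemma measurable_evaluation (G : set Z) : borel G ->
  measurable_fun setT (fun mu : conf => mu G).
Proof. by move=> bG _ U mU; rewrite setTI; apply: sub_sigma_algebra; exists G, U. Qed.

Lemma measurable_shifted_count x :
  measurable_fun setT (fun om => mpp_count (shift_mpp x X) om : conf).
Proof.
apply: (@measurability _ _ Omega conf setT _ conf_generators) => // _ [_ [G [U [bG mU ->]]] <-].
rewrite setTI.
have /(_ measurableT _ mU) := X_mpp.1 _ (borel_shift x _ bG).
by rewrite setTI.
Qed.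

Lemma measurable_count : measurable_fun setT (fun om => mpp_count X om : conf).
Proof.
apply: (@measurability _ _ Omega conf setT _ conf_generators) => // _ [_ [G [U [bG mU ->]]] <-].
have /(_ measurableT _ mU) := X_mpp.1 _ bG.
by rewrite !setTI.
Qed.

(** The counting measure and its shift have the same law on the sigma-algebra generated by
    evaluations, hence every functional measurable for it has the same integral under both. *)
Lemma stationary_integral x (f : conf -> R) : measurable_fun setT f ->
  integrableR P (fun om => f (mpp_count X om)) ->
  integrableR P (fun om => f (mpp_count (shift_mpp x X) om)) /\
  \int[P]_om f (mpp_count (shift_mpp x X) om) = \int[P]_om f (mpp_count X om).
Proof.
move=> mf intf.
pose k0 : Omega -> conf := fun om => mpp_count X om.
pose kx : Omega -> conf := fun om => mpp_count (shift_mpp x X) om.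
have lawE A : measurable A -> law P kx (measurable_shifted_count x) A = law P k0 measurable_count A.
  by move=> mA; exact: X_stationary.
have mfx : measurable_fun setT (f \o kx) by apply: measurableT_comp => //; exact: measurable_shifted_count.
have intx : integrableR P (f \o kx).
  apply/integrableP; split; first exact/measurable_EFinP.
  have mabs : measurable_fun setT (fun y => `|(f y)%:E|%E).
    by apply: measurableT_comp => //; exact/measurable_EFinP.
  rewrite -[ltLHS](@ge0_integral_pushforward _ _ _ _ _ _ (measurable_shifted_count x) P setT (fun y => `|(f y)%:E|%E)) //.
  rewrite -[ltLHS](_ : \int[law P kx (measurable_shifted_count x)]_y `|(f y)%:E| = _)%E //.
  rewrite (eq_measure_integral (law P k0 measurable_count)); last by move=> A mA _; exact: lawE.
  rewrite [ltLHS](@ge0_integral_pushforward _ _ _ _ _ _ measurable_count P setT (fun y => `|(f y)%:E|%E)) //.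
  by have /integrableP[] := intf.
split => //.
rewrite -(Rint_law P kx (measurable_shifted_count x) f mf) //.
rewrite -(Rint_law P k0 measurable_count f mf) //.
rewrite /Rintegral; congr fine.
by apply: eq_measure_integral => A mA _; exact: lawE.
Qed.

End stationary_integrals.

Lemma row_norm_le {R : realType} {d : nat} (x : 'rV[R]_d) (r : R) : 0 <= r ->
  (forall i, `|x ord0 i| <= r) -> `|x| <= r.
Proof.
move=> r0 h; rewrite [leLHS]mx_normrE; apply: bigmax_le => // -[i j] _ /=.
by rewrite (ord1 i).
Qed.

Lemma row_coord_le {R : realType} {d : nat} (x : 'rV[R]_d) i : `|x ord0 i| <= `|x|.
Proof.
rewrite [leRHS]mx_normrE.
exact: (le_bigmax _ (fun ij : 'I_1 * 'I_d => `|x ij.1 ij.2|) (ord0, i)).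
Qed.

Section located_points.
Context {R : realType} {d : nat} {dO : measure_display} {Omega : measurableType dO}
  {M : topologicalType}.
Variable X : point_family R d Omega M.
Hypothesis X_mpp : is_marked_point_process X.
Variables (C C' : set M) (bC : borel C) (bC' : borel C').
Local Notation Z := ('rV[R]_d * M)%type.
Local Notation E := (d.-tuple (measurableTypeR R)).
Local Notation Y := (E * (bool * bool))%type.

(** Only the membership of a mark in [C] and in [C'] matters, so a mark is reduced to two booleans
    and the points live in a fixed product of measurable spaces. *)
Definition encode (z : Z) : Y := (tuple_of_row z.1, (`[< C z.2 >], `[< C' z.2 >])).

Lemma borel_fst (B : set 'rV[R]_d) : borel B -> borel ((fun z : Z => z.1) @^-1` B).
Proof. by apply: borel_preimage => -[a m]; exact: cvg_fst. Qed.

Lemma borel_snd (B : set M) : borel B -> borel ((fun z : Z => z.2) @^-1` B).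
Proof. by apply: borel_preimage => -[a m]; exact: cvg_snd. Qed.

Lemma smeas_encode : smeas (@borel Z) encode.
Proof.
have sZ := sigma_algebra_borel Z.
apply: (smeas_pair _ sZ); last apply: (smeas_pair _ sZ).
- move=> A mA; apply: (borel_fst (tuple_of_row @^-1` A)).
  exact: smeas_tuple_of_row.
- apply: (smeas_bool _ sZ); rewrite (_ : [set _ | _] = (fun z : Z => z.2) @^-1` C).
    exact: borel_snd.
  by apply/seteqP; split=> z /= /asboolP.
- apply: (smeas_bool _ sZ); rewrite (_ : [set _ | _] = (fun z : Z => z.2) @^-1` C').
    exact: borel_snd.
  by apply/seteqP; split=> z /= /asboolP.
Qed.

Definition bounded_tuples (B : set E) := exists r : R, forall t, B t -> forall i, `|tnth t i| <= r.

Definition indices_in (B : set E) (om : Omega) : set nat :=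
  [set n | mpp_index X om n /\ B (tuple_of_row (mpp_loc X n om))].

Definition points_in (B : set E) (om : Omega) : seq Y :=
  [seq encode (mpp_loc X n om, mpp_mark X n om) | n <- fset_set (indices_in B om)].

Section window.
Variables (B : set E) (mB : measurable B) (bB : bounded_tuples B).

Lemma borel_window : borel [set x : 'rV[R]_d | B (tuple_of_row x)].
Proof. exact: smeas_tuple_of_row. Qed.

(** Infinitely many indices in a bounded window would force the count, bounded below by every finite
    partial sum of ones, to be infinite. *)
Lemma indices_in_finite om : finite_set (indices_in B om).
Proof.
have bdd : bounded_set [set x : 'rV[R]_d | B (tuple_of_row x)].
  have [r hr] := bB; exists `|r|; split; first exact: num_real.
  move=> s rs x /hr h; apply: (row_norm_le _ _ _ _); first by rewrite (le_trans _ (ltW rs)).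
  move=> i; have := h i; rewrite tnth_mktuple => /le_trans; apply.
  by rewrite (le_trans (ler_norm _)) // ltW.
have := X_mpp.2 om _ borel_window bdd.
rewrite ltey; apply: contra_neqP => /infinite_set_fset inf.
apply/eqyP => r r0.
have [F FI Fn] := inf (Num.truncn r).+1.
apply: esum_ge; exists [set` F].
  by split; [exact: finite_fset|move=> n /FI []].
rewrite (eq_fsbigr (fun=> 1%:E)); last first.
  move=> n; rewrite inE => /FI [_ Bn].
  by rewrite indicE mem_set.
rewrite fsbig_finite //= set_fsetK sumEFin lee_fin big_const_seq iter_addr addr0 count_predT.
apply: (@le_trans _ _ (Num.truncn r).+1%:R); first by rewrite ltW // truncnS_gt.
by rewrite ler_nat.
Qed.

Lemma mpp_count_points_in om (A : set Y) :
  mpp_count X om (encode @^-1` A `&` ([set x | B (tuple_of_row x)] `*` setT)) =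
  (\sum_(y <- points_in B om) (\1_A y))%:E.
Proof.
pose J := [set n | B (tuple_of_row (mpp_loc X n om))].
pose a n : \bar R := (\1_A (encode (mpp_loc X n om, mpp_mark X n om)))%:E.
transitivity (\esum_(n in mpp_index X om `&` J) a n).
  rewrite esum_mkcondr; apply: eq_esum => n _.
  rewrite /a !indicE in_setI; case: ifPn => nJ.
    rewrite [X in _ && X](_ : _ = true) ?andbT //.
    by apply/mem_set; split => //=; exact: set_mem nJ.
  rewrite [X in _ && X](_ : _ = false) ?andbF //.
  by apply: memNset => -[h _]; move/negP: nJ; apply; exact: mem_set.
have fin : finite_set (mpp_index X om `&` J) := indices_in_finite om.
rewrite esum_fset //; last by move=> n _; rewrite /a lee_fin.
by rewrite /a fsbig_finite //= sumEFin /points_in big_map.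
Qed.

Lemma borel_encode_window (A : set Y) : measurable A ->
  borel (encode @^-1` A `&` ([set x | B (tuple_of_row x)] `*` setT)).
Proof.
move=> mA; apply: (sigma_setI _ (sigma_algebra_borel _)); first exact: smeas_encode.
rewrite (_ : _ `*` _ = (fun z : Z => z.1) @^-1` [set x | B (tuple_of_row x)]).
  exact: borel_fst borel_window.
by apply/seteqP; split => z //= [].
Qed.

Lemma random_list_points_in : random_list (R := R) (points_in B).
Proof.
move=> A mA; apply/measurable_EFinP.
apply: (eq_measurable_fun (fun om => mpp_count X om
  (encode @^-1` A `&` ([set x | B (tuple_of_row x)] `*` setT)))).
  by move=> om _; exact: mpp_count_points_in.
by apply: X_mpp.1; exact: borel_encode_window.
Qed.

Lemma points_in_window om y : y \in points_in B om -> B y.1.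
Proof.
move=> /mapP[n]; rewrite in_fset_set; last exact: indices_in_finite.
by rewrite inE => -[_ Bn] ->.
Qed.

End window.

Lemma sum_points_in_sub (B B' : set E) (f : Y -> R) om :
  measurable B -> measurable B' -> bounded_tuples B' -> B `<=` B' ->
  \sum_(y <- points_in B om) f y = \sum_(y <- points_in B' om) \1_B y.1 * f y.
Proof.
move=> mB mB' bB' BB'.
have bB : bounded_tuples B by have [r h] := bB'; exists r => t /BB' /h.
have fB := indices_in_finite B mB bB om.
have fB' := indices_in_finite B' mB' bB' om.
rewrite !big_map.
rewrite [RHS](eq_bigr (fun n => if tuple_of_row (mpp_loc X n om) \in B then
  f (encode (mpp_loc X n om, mpp_mark X n om)) else 0)); last first.
  by move=> n _ /=; rewrite indicE; case: ifP => _; rewrite ?mul1r ?mul0r.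
rewrite -[RHS]big_mkcond -[RHS]big_filter /=; apply: perm_big; apply: uniq_perm.
- exact: fset_uniq.
- by rewrite filter_uniq //; exact: fset_uniq.
- move=> n; rewrite mem_filter !in_fset_set //.
  apply/idP/andP => [/set_mem[In Bn]|[/set_mem Bn /set_mem[In _]]].
    by split; apply/mem_set => //; split => //; exact: BB'.
  by apply/mem_set; split.
Qed.

End located_points.

(** * Mixing around an arbitrary centre *)

Section shifted_mixing.
Context {R : realType} {d : nat} {dO : measure_display} {Omega : measurableType dO}
  {M : topologicalType} (P : probability Omega R).
Variable X : point_family R d Omega M.
Hypothesis X_mpp : is_marked_point_process X.
Hypothesis X_stationary : stationary P X.
Local Notation Z := ('rV[R]_d * M)%type.
Local Notation configuration := (set Z -> \bar R).

(** Events of the process on [K] are preimages of these sets of configurations. Unlike an event of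
    [Omega], such a set can be evaluated at the process and at its shift, which is how stationarity
    is used. *)
Let conf_in (K : set 'rV[R]_d) : set (set configuration) :=
  <<s [set G | exists E U, [/\ borel E, measurable U &
        G = [set mu : configuration | U (mu (E `&` (K `*` setT)))]]] >>.

Let sigma_conf_in K : sigma_algebra setT (conf_in K).
Proof. exact: smallest_sigma_algebra. Qed.

Lemma sigma_algebra_sigma_mpp (X' : point_family R d Omega M) K :
  sigma_algebra setT (sigma_mpp X' K).
Proof. exact: smallest_sigma_algebra. Qed.

Let conf_in_measurable K : borel K -> conf_in K `<=` configuration_measurable.
Proof.
move=> bK; apply: smallest_sub; first exact: smallest_sigma_algebra.
move=> _ [A [U [bA mU ->]]]; apply: sub_sigma_algebra.
exists (A `&` (K `*` setT)), U; split => //.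
apply: (sigma_setI _ (sigma_algebra_borel _)) => //.
rewrite (_ : _ `*` _ = (fun z : Z => z.1) @^-1` K); first exact: borel_fst.
by apply/seteqP; split => z //= [].
Qed.

Let sigma_mpp_preimage (X' : point_family R d Omega M) K G : conf_in K G ->
  sigma_mpp X' K [set om | G (mpp_count X' om)].
Proof.
move: G; have [s0 sC sU] := sigma_algebra_sigma_mpp X' K.
apply: (@smallest_sub _ _ _ [set G | sigma_mpp X' K [set om | G (mpp_count X' om)]]).
  split => //=.
  - by move=> A mA; exact: (sC _ mA).
  - by move=> F mF; exact: (sU _ mF).
move=> _ [A [U [bA mU ->]]] /=; apply: sub_sigma_algebra; by exists A, U.
Qed.

Let sigma_mpp_inv (X' : point_family R d Omega M) K A : sigma_mpp X' K A ->
  exists2 G, conf_in K G & A = [set om | G (mpp_count X' om)].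
Proof.
move: A; have [s0 sC sU] := sigma_conf_in K.
apply: (@smallest_sub _ _ _ [set A | exists2 G, conf_in K G & A = [set om | G (mpp_count X' om)]]).
  split => /=.
  - by exists set0.
  - by move=> A [G mG ->]; exists (setT `\` G); [exact: sC|rewrite !setTD].
  - move=> F hF.
    have h i : exists G, conf_in K G /\ F i = [set om | G (mpp_count X' om)].
      by have [G] := hF i; exists G.
    have [G hG] := choice h.
    exists (\bigcup_i G i); first by apply: sU => i; have [] := hG i.
    by apply/seteqP; split => om [i _]; have [_ FG] := hG i; rewrite ?FG => h1; exists i => //; rewrite FG.
move=> _ [A [U [bA mU ->]]] /=.
exists [set mu | U (mu (A `&` (K `*` setT)))] => //.
by apply: sub_sigma_algebra; exists A, U.
Qed.

Lemma sigma_mpp_measurable x K : borel K -> sigma_mpp (shift_mpp x X) K `<=` measurable.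
Proof.
move=> bK A /sigma_mpp_inv[G cG ->].
have := measurable_shifted_count X X_mpp x measurableT G.
by rewrite setTI; apply; exact: conf_in_measurable cG.
Qed.

(** The sets of configurations behind a partition of [Omega] need not be disjoint, nor cover, away
    from the configurations that the shifted process attains. Making them successively disjoint and
    adding the remainder as one more piece gives a partition for the unshifted process as well. *)
Let partition_lift x K m (A : 'I_m -> set Omega) : borel K ->
  finite_partition (sigma_mpp (shift_mpp x X) K) A ->
  exists H : 'I_m.+1 -> set configuration,
   [/\ forall i, conf_in K (H i),
       finite_partition (sigma_mpp X K) (fun i => [set om | H i (mpp_count X om)]) &
       forall i : 'I_m, A i = [set om | H (widen_ord (leqnSn m) i) (mpp_count (shift_mpp x X) om)]].
Proof.
move=> bK [FA tA UA].
have hA i : exists G, conf_in K G /\ A i = [set om | G (mpp_count (shift_mpp x X) om)].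
  by have [G] := sigma_mpp_inv _ _ _ (FA i); exists G.
have [G hG] := choice hA.
have [c0 cC cU] := sigma_conf_in K.
(* The default [setT] at the index [m] makes the last piece of the disjoint sequence the complement
   of all the others. *)
pose G' (n : nat) := if insub n is Some i then G i else setT.
have cG' n : conf_in K (G' n).
  rewrite /G'; case: insubP => [i _ _|_]; first by have [] := hG i.
  exact: (sigma_setT _ (sigma_conf_in K)).
have cH n : conf_in K (seqDU G' n).
  rewrite /seqDU setDE; apply: (sigma_setI _ (sigma_conf_in K)) => //.
  apply: (sigma_setC _ (sigma_conf_in K)).
  elim: n => [|n IH]; first by rewrite big_ord0.
  by rewrite big_ord_recr; exact: (sigma_setU _ (sigma_conf_in K)).
exists (fun i => seqDU G' i); split => //.
- split.
  + by move=> i; exact: sigma_mpp_preimage.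
  + move=> i j _ _ [om [hi hj]]; apply: val_inj.
    by apply: (trivIset_seqDU G') => //; exists (mpp_count X om).
  + apply/seteqP; split=> // om _.
    have : (\big[setU/set0]_(n < m.+1) seqDU G' n) (mpp_count X om).
      rewrite -bigsetU_seqDU -bigcup_mkord; exists m; first exact: ltnSn.
      by rewrite /G' insubF // ltnn.
    by rewrite -bigcup_mkord => -[n /= nm h]; exists (Ordinal nm).
- move=> i /=; have [_ Ai] := hG i.
  have G'i : G' i = G i by rewrite /G' valK.
  apply/seteqP; split=> om /=.
    move=> Aom; split; first by move: Aom; rewrite Ai G'i.
    rewrite -bigcup_mkord => -[k /= ki].
    have km : (k < m)%N by exact: ltn_trans (ltn_ord i).
    have -> : G' k = G (Ordinal km) by rewrite /G' insubT.
    have [_ Ak] := hG (Ordinal km) => Gk.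
    have : Ordinal km = i.
      by apply: tA => //; exists om; split => //; rewrite Ak.
    by move=> ik; move: ki; rewrite -ik ltnn.
  by move=> [+ _]; rewrite G'i Ai.
Qed.

(** By stationarity, the lifted pieces have the same probabilities under the process and under its
    shift; the terms of the two additional pieces are nonnegative. *)
Lemma beta_coef_shift x K K' : borel K -> borel K' ->
  (beta_coef P (sigma_mpp (shift_mpp x X) K) (sigma_mpp (shift_mpp x X) K') <=
   beta_coef P (sigma_mpp X K) (sigma_mpp X K'))%E.
Proof.
move=> bK bK'; apply: ge_ereal_sup => _ [m [n [A [A' [pA pA' ->]]]]].
have [H [cH pH AH]] := partition_lift _ _ _ _ bK pA.
have [H' [cH' pH' AH']] := partition_lift _ _ _ _ bK' pA'.
pose a i j := `|fine (P ([set om | H i (mpp_count X om)] `&` [set om | H' j (mpp_count X om)])) -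
  fine (P [set om | H i (mpp_count X om)]) * fine (P [set om | H' j (mpp_count X om)])|.
apply: (@le_trans _ _ (2^-1 * \sum_i \sum_j a i j)%:E); last first.
  apply: ereal_sup_ubound; exists m.+1, n.+1, (fun i => [set om | H i (mpp_count X om)]),
    (fun j => [set om | H' j (mpp_count X om)]); split => //.
rewrite lee_fin ler_wpM2l // [leRHS]big_ord_recr /= -[leLHS]addr0 lerD ?sumr_ge0 //.
apply: ler_sum => i _; rewrite [leRHS]big_ord_recr /= -[leLHS]addr0 lerD //.
apply: ler_sum => j _; rewrite /a AH AH'.
have st G : configuration_measurable G ->
   P [set om | G (mpp_count (shift_mpp x X) om)] = P [set om | G (mpp_count X om)].
  exact: X_stationary.
have mH := conf_in_measurable _ bK _ (cH (widen_ord (leqnSn m) i)).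
have mH' := conf_in_measurable _ bK' _ (cH' (widen_ord (leqnSn n) j)).
rewrite (st _ mH) (st _ mH').
rewrite [X in fine (P X) - _](_ : _ = [set om | (H (widen_ord (leqnSn m) i) `&`
   H' (widen_ord (leqnSn n) j)) (mpp_count (shift_mpp x X) om)]) //.
rewrite st //.
exact: (sigma_setI _ (smallest_sigma_algebra _ _)).
- by rewrite /a.
- by move=> j _; rewrite /a.
Qed.

End shifted_mixing.

(** * Lattice sites, shells and the series of mixing rates *)

Section lattice.
Context {d : nat}.
Local Notation site := {ffun 'I_d -> int}.
Implicit Types a v : site.

Definition site_norm a : nat := \max_(i < d) `|a i|%N.

Lemma site_norm_le a n : (site_norm a <= n)%N = [forall i, (`|a i| <= n)%N].
Proof.
apply/bigmax_leqP/forallP => h i //; exact: h.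
Qed.

Lemma site_normD a v : (site_norm (a + v)%R <= site_norm a + site_norm v)%N.
Proof.
rewrite site_norm_le; apply/forallP => i; rewrite ffunE.
have h1 : (`|a i| <= site_norm a)%N by exact: (leq_bigmax (F := fun i => `|a i|%N)).
have h2 : (`|v i| <= site_norm v)%N by exact: (leq_bigmax (F := fun i => `|v i|%N)).
have tri (x y : int) : (`|(x + y)%R| <= `|x| + `|y|)%N by lia.
by apply: (leq_trans (tri _ _)); exact: leq_add.
Qed.

Lemma site_normN a : site_norm (- a)%R = site_norm a.
Proof. by rewrite /site_norm; apply: eq_bigr => i _; rewrite ffunE abszN. Qed.

Lemma site_normB a v : site_norm (a - v)%R = site_norm (v - a)%R.
Proof. by rewrite -site_normN opprB. Qed.

Definition box (n : nat) : seq site :=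
  [seq [ffun i => (val (f i))%:Z - n%:Z] | f : {ffun 'I_d -> 'I_(2 * n).+1} <- enum {ffun 'I_d -> 'I_(2 * n).+1}].

Lemma box_uniq n : uniq (box n).
Proof.
rewrite map_inj_uniq ?enum_uniq // => f g /ffunP h; apply/ffunP => i.
by apply: val_inj; have := h i; rewrite !ffunE => /addIr [].
Qed.

Lemma size_box n : size (box n) = ((2 * n).+1 ^ d)%N.
Proof. by rewrite size_map -cardE card_ffun !card_ord. Qed.

Lemma mem_box n a : (a \in box n) = (site_norm a <= n)%N.
Proof.
rewrite site_norm_le; apply/mapP/forallP => [[f _ ->] i|h].
  have aux (x : nat) : (x < (2 * n).+1)%N -> (`|(x%:Z - n%:Z)%R| <= n)%N by lia.
  by rewrite ffunE; apply: aux; exact: ltn_ord.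
have aux1 (x : int) : (`|x| <= n)%N -> (`|(x + n%:Z)%R| < (2 * n).+1)%N by lia.
have aux2 (x : int) : (`|x| <= n)%N -> x = `|(x + n%:Z)%R|%N%:Z - n%:Z by lia.
exists [ffun i => Ordinal (aux1 _ (h i))]; first by rewrite mem_enum.
by apply/ffunP => i; rewrite !ffunE /=; exact: aux2.
Qed.

End lattice.

Lemma ler_sum_subseq {R : realDomainType} {I : eqType} (s t : seq I) (F : I -> R) :
  uniq s -> {subset s <= t} -> (forall i, i \in t -> 0 <= F i) ->
  \sum_(i <- s) F i <= \sum_(i <- t) F i.
Proof.
elim: s t => [|i s IH] t /=.
  by move=> _ _ F0; rewrite big_nil big_seq sumr_ge0.
move=> /andP[nis us] st F0.
have it : i \in t by apply: st; rewrite mem_head.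
rewrite big_cons (perm_big _ (perm_to_rem it)) big_cons lerD2l.
apply: IH => // [j js|j /mem_rem]; last exact: F0.
have : j \in t by apply: st; rewrite in_cons js orbT.
rewrite (perm_mem (perm_to_rem it)) in_cons => /predU1P[ji|//].
by move: nis; rewrite -ji js.
Qed.

(** The elementary bound [x^(k+1) - y^(k+1) <= (k+1) (x - y) x^k] with [x - y = 2], followed by
    [2(n+1) + 1 <= 3(n+1)]. *)
Lemma shell_card_le (d n : nat) :
  ((2 * n.+1).+1 ^ d.+1 - (2 * n).+1 ^ d.+1 <= 2 * d.+1 * 3 ^ d * n.+1 ^ d)%N.
Proof.
have H (k : nat) : ((2 * n.+1).+1 ^ k.+1 <= (2 * n).+1 ^ k.+1 + 2 * k.+1 * (2 * n.+1).+1 ^ k)%N.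
  elim: k => [|k IH]; first by rewrite !expn1 expn0; lia.
  rewrite expnS [((2 * n).+1 ^ k.+2)%N]expnS.
  have := expnS (2 * n.+1).+1 k; nia.
apply: (@leq_trans (2 * d.+1 * (2 * n.+1).+1 ^ d)); first by have := H d; lia.
rewrite -[leqRHS]mulnA -expnMn leq_mul //; have [->|d0] := posnP d; rewrite ?expn0 // leq_exp2r //; lia.
Qed.

Section shell_sum.
Context {R : realFieldType} {d : nat}.
Local Notation site := {ffun 'I_d.+1 -> int}.

(** Summation by shells of constant norm: in dimension [d.+1] the shell of radius [n >= 1] has at
    most a constant times [n ^ d] sites. *)
Lemma box_sum_le (h : nat -> R) (N : nat) : (forall n, 0 <= h n) ->
  \sum_(v <- @box d.+1 N) h (site_norm v) <=
  h 0%N + (2 * d.+1 * 3 ^ d)%:R * \sum_(1 <= n < N.+1) n%:R ^+ d * h n.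
Proof.
move=> h0.
have sub n : {subset @box d.+1 n <= box n.+1}.
  by move=> v; rewrite !mem_box => /leqW.
elim: N => [|N IH].
  rewrite big_geq // mulr0 addr0.
  have : (size (@box d.+1 0) <= 1)%N by rewrite size_box muln0 exp1n.
  have b0 v : v \in @box d.+1 0 -> site_norm v = 0%N.
    by rewrite mem_box leqn0 => /eqP.
  case: (box 0) b0 => [|v [|//]] b0 _; first by rewrite big_nil.
  by rewrite big_seq1 b0 ?mem_head.
have -> : \sum_(v <- @box d.+1 N.+1) h (site_norm v) =
    \sum_(v <- @box d.+1 N) h (site_norm v) +
    \sum_(v <- box N.+1 | v \notin @box d.+1 N) h N.+1.
  rewrite (bigID (fun v => v \in @box d.+1 N)) /=; congr (_ + _).
    rewrite -big_filter; apply: perm_big; apply: uniq_perm.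
    - by rewrite filter_uniq // box_uniq.
    - exact: box_uniq.
    - by move=> v; rewrite mem_filter andb_idr //; exact: sub.
  rewrite big_seq_cond [RHS]big_seq_cond; apply: eq_bigr => v.
  rewrite !mem_box -ltnNge => /andP[v1 v2]; congr (h _).
  by apply/eqP; rewrite eqn_leq v1.
rewrite big_nat_recr //= mulrDr addrA; apply: lerD => //.
have cE : (count (fun v => v \notin @box d.+1 N) (box N.+1) =
    (2 * N.+1).+1 ^ d.+1 - (2 * N).+1 ^ d.+1)%N.
  rewrite -(size_box (d := d.+1) N.+1) -(size_box (d := d.+1) N).
  rewrite -(count_predC (fun v => v \in box N) (box N.+1)).
  rewrite [X in (X + _)%N](_ : _ = size (@box d.+1 N)) ?addKn //.
  rewrite -size_filter; apply: perm_size; apply: uniq_perm.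
  - by rewrite filter_uniq // box_uniq.
  - exact: box_uniq.
  - by move=> v; rewrite mem_filter andb_idr //; exact: sub.
rewrite big_const_seq iter_addr addr0 cE -[leLHS]mulr_natl mulrA ler_wpM2r //.
by rewrite -natrX -natrM ler_nat; exact: shell_card_le.
Qed.

End shell_sum.

(** Comparison with the integral. For [r] in [[m, m+1[] with [m >= 1], monotonicity of [beta] and
    [m + 1 <= 2 m] give [r ^ d * beta r ^ th >= 2 ^ (-d) * (m+1) ^ d * beta (m+1) ^ th]. The first
    term of the series is added separately. *)
Lemma beta_series_bounded (R : realType) (d : nat) (beta : R -> R) (th : R) :
  0 < th ->
  (forall b, 2^-1 <= b -> 0 <= beta b) ->
  (forall b c, 2^-1 <= b -> b <= c -> beta c <= beta b) ->
  (\int[@lebesgue_measure R]_(r in `[1%R, +oo[) (r ^+ d * beta r `^ th)%R%:E < +oo)%E ->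
  exists2 S : R, 0 <= S &
    forall N, \sum_(1 <= n < N) n%:R ^+ d * beta n%:R `^ th <= S.
Proof.
move=> th0 b0 bd fin.
(* Freezing [beta] below 1 makes it monotone on the whole line, hence measurable, without changing
   the integral. *)
pose be r := beta (Num.max 1 r).
have be0 r : 0 <= be r by apply: b0; rewrite le_max; apply/orP; left; lra.
have bed : nonincreasing_fun be.
  move=> x y xy; apply: bd; first by rewrite le_max; apply/orP; left; lra.
  by rewrite ge_max !le_max lexx xy orbT.
have bE r : 1 <= r -> beta r = be r by move=> r1; rewrite /be max_r.
pose f r := r ^+ d * be r `^ th.
have mf : measurable_fun setT f.
  apply: measurable_funM; first exact: measurable_funX.
  apply: (@measurableT_comp _ _ _ _ _ _ (fun x => x `^ th)); first exact: measurable_powR.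
  exact: nonincreasing_measurable.
have Ifin : (\int[@lebesgue_measure R]_(r in `[1%R, +oo[) (f r)%:E < +oo)%E.
  apply: le_lt_trans fin; rewrite le_eqVlt; apply/orP; left; apply/eqP.
  by apply: eq_integral => r; rewrite inE /= in_itv /= andbT => /bE ->.
set I := (\int[@lebesgue_measure R]_(r in `[1%R, +oo[) (f r)%:E)%E in Ifin.
have f0 r : 1 <= r -> 0 <= f r.
  by move=> r1; rewrite mulr_ge0 ?powR_ge0 // exprn_ge0 // (le_trans ler01).
have I0 : (0 <= I)%E.
  by apply: integral_ge0 => r /=; rewrite in_itv /= andbT => /f0; rewrite lee_fin.
have Ifn : I \is a fin_num by rewrite ge0_fin_numE.
pose c n : R := n%:R ^+ d * beta n%:R `^ th.
have c0 n : (1 <= n)%N -> 0 <= c n.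
  by move=> n1; rewrite mulr_ge0 ?powR_ge0 // exprn_ge0.
have S0 : 0 <= c 1%N + 2 ^+ d * fine I.
  by rewrite addr_ge0 ?c0 // mulr_ge0 ?fine_ge0 // exprn_ge0.
exists (c 1%N + 2 ^+ d * fine I) => // N.
have key : (\sum_(n <- iota 1 N) (c n.+1 / 2 ^+ d)%:E <= I)%E.
  pose A (n : nat) : set R := `[n%:R, n.+1%:R[%classic.
  have mA n : measurable (A n) by exact: measurable_itv.
  pose g n (r : R) : \bar R := ((c n.+1 / 2 ^+ d) * \1_(A n) r)%:E.
  have g0 n r : (0 <= g n r)%E.
    by rewrite lee_fin mulr_ge0 // divr_ge0 ?c0 // exprn_ge0.
  have mg n : measurable_fun (`[1%R, +oo[%classic : set R) (g n).
    apply/measurable_EFinP; apply: measurable_funM; first exact: measurable_cst.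
    exact: measurable_indic.
  have -> : (\sum_(n <- iota 1 N) (c n.+1 / 2 ^+ d)%:E =
      \int[@lebesgue_measure R]_(r in `[1%R, +oo[) \sum_(n <- iota 1 N) g n r)%E.
    rewrite ge0_integral_sum //.
    rewrite big_seq [RHS]big_seq; apply: eq_bigr => n; rewrite mem_iota => /andP[n1 _].
    rewrite /g; under eq_integral do rewrite EFinM.
    rewrite ge0_integralZl //; last 2 first.
    - by apply/measurable_EFinP; apply: measurable_indic; exact: mA.
    - by rewrite lee_fin divr_ge0 ?c0 // exprn_ge0.
    rewrite integral_indic //; last exact: mA.
    rewrite (_ : _ `&` _ = A n); last first.
      apply/seteqP; split=> r; first by case.
      rewrite /A /= !in_itv /= andbT => /andP[h h2]; rewrite h h2; split => //.
      by rewrite (le_trans _ h) // ler1n.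
    have h1 : @lebesgue_measure R (A n) = 1%E.
      rewrite /A lebesgue_measure_itv /= lte_fin ltr_nat ltnSn -EFinD.
      by rewrite -natr1 addrAC subrr add0r.
    transitivity ((c n.+1 / 2 ^+ d)%:E * @lebesgue_measure R (A n))%E => //.
    by rewrite h1 mule1.
  apply: ge0_le_integral => //.
  - by move=> r _; apply: sume_ge0.
  - exact: emeasurable_sum.
  - by apply/measurable_EFinP; exact: measurable_funTS.
  - move=> r; rewrite /= in_itv /= andbT => r1.
    have r0 : 0 <= r by lra.
    pose m := Num.truncn r.
    have /andP[mr rm] := truncn_itv r0.
    have m1 : (1 <= m)%N by rewrite truncn_ge_nat.
    have gE n : g n r = if n == m then (c m.+1 / 2 ^+ d)%:E else 0%E.
      rewrite /g indicE; case: eqP => [->|nm].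
        by rewrite mem_set ?mulr1 // /A /= in_itv /= mr rm.
      rewrite memNset ?mulr0 // /A /= in_itv /= => /andP[h1 h2]; apply: nm.
      apply/eqP; rewrite eqn_leq -ltnS -[X in _ && X]ltnS -(ltr_nat R n) -(ltr_nat R m).
      by rewrite (le_lt_trans h1 rm) (le_lt_trans mr h2).
    have cm : c m.+1 / 2 ^+ d <= f r.
      rewrite ler_pdivrMr ?exprn_gt0 // /c /f mulrAC.
      rewrite -exprMn; apply: ler_pM; rewrite ?exprn_ge0 ?powR_ge0 //.
        apply: lerXn2r; rewrite ?nnegrE ?mulr_ge0 //.
        apply: (@le_trans _ _ (m%:R * 2)); last by rewrite ler_pM2r.
        by rewrite -natrM ler_nat muln2 -addnn -addn1 leq_add2l.
      have m11 : 1 <= m.+1%:R :> R by rewrite ler1n.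
      rewrite bE //; apply: ge0_ler_powR; rewrite ?nnegrE ?(ltW th0) //.
      by apply: bed; exact: ltW.
    case mN : (m \in iota 1 N).
      rewrite (bigD1_seq m) ?iota_uniq //= big1 ?adde0; last by move=> n /negbTE nm; rewrite gE nm.
      by rewrite gE eqxx lee_fin.
    rewrite big_seq big1 ?lee_fin ?f0 // => n nN; rewrite gE.
    by case: eqP => // nm; move: nN; rewrite nm mN.
move: key; rewrite sumEFin -(fineK Ifn) lee_fin -mulr_suml ler_pdivrMr ?exprn_gt0 // => key.
case: N key => [|[|N]] key.
- by rewrite big_geq.
- by rewrite big_geq.
rewrite big_ltn //; apply: lerD => //.
have key' : \sum_(n <- iota 1 N) c n.+1 <= fine I * 2 ^+ d.
  apply: le_trans key.
  have -> : iota 1 N.+2 = iota 1 N ++ iota (1 + N) 2 by rewrite -iotaD addn2.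
  by rewrite big_cat /= lerDl sumr_ge0 // => n _; exact: c0.
by rewrite [leRHS]mulrC; apply: le_trans key'; rewrite big_add1 /= /index_iota subSS subn0.
Qed.

(** * Unit cells and mixing between them *)

Section cells.
Context {R : realType} {d : nat}.
Local Notation E := (d.-tuple (measurableTypeR R)).
Local Notation site := {ffun 'I_d -> int}.

Definition cell (a : site) : set E :=
  [set t | forall i, (a i)%:~R <= tnth t i < (a i)%:~R + 1].

Lemma measurable_cell a : measurable (cell a).
Proof.
rewrite (_ : cell a = \bigcap_(i in [set: 'I_d])
   ((fun t : E => tnth t i) @^-1` [set` `[(a i)%:~R, (a i)%:~R + 1[])); last first.
  apply/seteqP; split=> t h i; first by move=> _ /=; rewrite in_itv; exact: h.
  by have := h i I; rewrite /= in_itv.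
apply: fin_bigcap_measurable => // i _.
by rewrite -[X in measurable X]setTI; apply: measurable_tnth.
Qed.

Lemma int_abs_le (x : int) : `|x%:~R| = (`|x|%N)%:R :> R.
Proof. by rewrite -intr_norm -natr_absz. Qed.

Lemma site_coord_le (a : site) i : `|(a i)%:~R| <= (site_norm a)%:R :> R.
Proof.
by rewrite int_abs_le ler_nat; exact: (leq_bigmax (F := fun i => `|a i|%N)).
Qed.

Lemma bounded_cell a : bounded_tuples (cell a).
Proof.
exists ((site_norm a)%:R + 1) => t ht i; have /andP[h1 h2] := ht i.
have := site_coord_le a i; rewrite ler_norml => /andP[h3 h4].
by rewrite ler_norml; apply/andP; split; lra.
Qed.

Definition site_of (t : E) : site := [ffun i => Num.floor (tnth t i)].

Lemma cell_site_of t : cell (site_of t) t.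
Proof.
move=> i; rewrite ffunE.
have := floor_itv (tnth t i) => /andP[h1 h2].
by rewrite h1 /= (_ : _ + 1 = (Num.floor (tnth t i) + 1)%:~R) // intrD.
Qed.

Lemma cell_inj a t : cell a t -> a = site_of t.
Proof.
move=> h; apply/ffunP => i; rewrite ffunE; apply/esym/floor_def.
by have := h i; rewrite intrD.
Qed.

Definition cell_center (a : site) : 'rV[R]_d := \row_i ((a i)%:~R + 2^-1).

Lemma cell_near (a a' : site) (L : nat) t : (site_norm (a' - a)%R <= L)%N -> cell a' t ->
  cube (L%:R + 2^-1) (row_of_tuple t - cell_center a).
Proof.
move=> h ht i; rewrite !mxE; have := ht i => /andP[h1 h2].
have := site_coord_le (a' - a) i; rewrite ffunE /= ffunE intrD mulrNz.
have : (site_norm (a' - a)%R)%:R <= L%:R :> R by rewrite ler_nat.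
move=> hL; rewrite !ler_norml => /andP[h3 h4]; apply/andP; split; lra.
Qed.

(** The margin 2 keeps the half-open cell [c] strictly outside the closed cube; with margin 1 a face
    of the cell could lie on its boundary. *)
Lemma cell_far (a c : site) (L n : nat) t : (n + L + 2 <= site_norm (c - a)%R)%N -> cell c t ->
  ~ cube (L%:R + 2^-1 + n%:R) (row_of_tuple t - cell_center a).
Proof.
move=> h ht hc.
have : (site_norm (c - a)%R <= n + L + 1)%N.
  rewrite site_norm_le; apply/forallP => i.
  have := hc i; rewrite !mxE; have := ht i => /andP[h1 h2].
  rewrite ler_norml => /andP[h3 h4].
  have aux (x : int) (k : nat) : x < k.+1%:Z -> - k.+1%:Z < x -> (`|x| <= k)%N by lia.
  rewrite !ffunE; apply: aux; rewrite -(ltr_int R).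
    by rewrite intrD mulrNz -pmulrn -natr1 !natrD; lra.
  by rewrite mulrNz intrD mulrNz -pmulrn -natr1 !natrD; lra.
by move=> h'; move: (leq_trans h h'); rewrite -addnA -[in X in (_ <= X)%N]addnA leq_add2l leq_add2l.
Qed.

End cells.

Section cell_points.
Context {R : realType} {d : nat} {dO : measure_display} {Omega : measurableType dO}
  {M : topologicalType} (P : probability Omega R).
Variable X : point_family R d Omega M.
Hypothesis X_mpp : is_marked_point_process X.
Hypothesis X_stationary : stationary P X.
Variables (C C' : set M) (bC : borel C) (bC' : borel C').
Local Notation Z := ('rV[R]_d * M)%type.
Local Notation E := (d.-tuple (measurableTypeR R)).
Local Notation Y := (E * (bool * bool))%type.
Local Notation site := {ffun 'I_d -> int}.

Lemma borel_cube a : borel (cube a : set 'rV[R]_d).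
Proof.
rewrite (_ : cube a = (tuple_of_row @^-1` [set t : E | forall i, `|tnth t i| <= a])).
  apply: smeas_tuple_of_row.
  rewrite (_ : [set _ | _] = \bigcap_(i in [set: 'I_d])
     ((fun t : E => tnth t i) @^-1` [set x | `|x| <= a])); last first.
    by apply/seteqP; split=> t h i; [move=> _; exact: h|exact: (h i I)].
  apply: fin_bigcap_measurable => // i _.
  rewrite -[X in measurable X]setTI; apply: measurable_tnth => //.
  rewrite (_ : [set x | `|x| <= a] = `[-a, a]%classic); first exact: measurable_itv.
  by apply/seteqP; split=> x /=; rewrite in_itv /= ler_norml.
by apply/seteqP; split=> x h i; have := h i; rewrite tnth_mktuple.
Qed.

Lemma sigma_mpp_points_in x K (B : set E) (A : set Y) (U : set R) :
  measurable B -> bounded_tuples B -> (forall t, B t -> K (row_of_tuple t - x)) ->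
  measurable A -> measurable U ->
  sigma_mpp (shift_mpp x X) K
    [set om | U (\sum_(y <- points_in X C C' B om) \1_A y)].
Proof.
move=> mB bB BK mA mU; apply: sub_sigma_algebra.
pose G : set Z := encode C C' @^-1` A `&` ([set x | B (tuple_of_row x)] `*` setT).
pose G' : set Z := (fun z => (z.1 - (- x), z.2)) @^-1` G.
exists G', (fine @^-1` U); split.
- by apply: borel_shift; exact: borel_encode_window.
- by rewrite -[X in measurable X]setTI; exact: fine_measurable.
- have GE : (fun z : Z => (z.1 - x, z.2)) @^-1` (G' `&` (K `*` setT)) = G.
    apply/seteqP; split => -[y m] /=; rewrite /G' /G /= opprK subrK; first by case.
    by move=> [h1 [h2 _]]; split => //; split => //; have := BK _ h2; rewrite tuple_of_rowK.
  have countE om : mpp_count (shift_mpp x X) om (G' `&` (K `*` setT)) =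
      (\sum_(y <- points_in X C C' B om) \1_A y)%:E.
    by rewrite mpp_count_shift GE mpp_count_points_in.
  by apply/seteqP; split => om /=; rewrite countE.
Qed.

Lemma random_list_rectangles1 (F F' : set (set Omega)) (s : Omega -> seq Y) :
  sigma_algebra setT F' ->
  (forall A U, measurable A -> measurable U -> F [set om | U (\sum_(y <- s om) (\1_A y : R))]) ->
  random_list (R := R) (T := g_sigma_algebraType (rectangles F F')) (s \o fst).
Proof.
move=> sF' h A mA _ U mU; rewrite setTI; apply: sub_sigma_algebra.
exists [set om | U (\sum_(y <- s om) (\1_A y : R))]; first exact: h.
exists setT; first exact: (sigma_setT _ sF').
by apply/seteqP; split=> x //= [].
Qed.

Lemma random_list_rectangles2 (F F' : set (set Omega)) (s : Omega -> seq Y) :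
  sigma_algebra setT F ->
  (forall A U, measurable A -> measurable U -> F' [set om | U (\sum_(y <- s om) (\1_A y : R))]) ->
  random_list (R := R) (T := g_sigma_algebraType (rectangles F F')) (s \o snd).
Proof.
move=> sF h A mA _ U mU; rewrite setTI; apply: sub_sigma_algebra.
exists setT; first exact: (sigma_setT _ sF).
exists [set om | U (\sum_(y <- s om) (\1_A y : R))]; first exact: h.
by apply/seteqP; split=> x //= [].
Qed.

Definition cell_points (a : site) := points_in X C C' (cell a).

(** Seen from the centre of the cell [a], the cells within distance [L] lie in the cube of half-side
    [L + 1/2], and those at distance at least [n + L + 2] lie outside the cube enlarged by [n]. The
    assumption [L < n] gives [L + 1/2 <= n], the range in which the mixing rate applies. The first
    coordinate of [Omega * Omega] carries the near cells, the second the far ones. *)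
Lemma cell_points_mixing beta (a : site) (L n : nat) : mixing_rate P X beta -> (L < n)%N ->
  exists F F' : set (set Omega),
  [/\ [/\ sigma_algebra setT F, sigma_algebra setT F', F `<=` measurable & F' `<=` measurable],
      (beta_coef P F F' <= (beta n%:R)%:E)%E,
      forall a', (site_norm (a' - a)%R <= L)%N ->
        random_list (R := R) (T := g_sigma_algebraType (rectangles F F')) (cell_points a' \o fst) &
      forall c, (n + L + 2 <= site_norm (c - a)%R)%N ->
        random_list (R := R) (T := g_sigma_algebraType (rectangles F F')) (cell_points c \o snd)].
Proof.
move=> [b0 bd bmix] Ln.
pose K : set 'rV[R]_d := cube (L%:R + 2^-1).
pose K' : set 'rV[R]_d := ~` cube (L%:R + 2^-1 + n%:R).
have bK : borel K by exact: borel_cube.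
have bK' : borel K'.
  by apply: (sigma_setC _ (sigma_algebra_borel _)); exact: borel_cube.
exists (sigma_mpp (shift_mpp (cell_center a) X) K), (sigma_mpp (shift_mpp (cell_center a) X) K').
have s1 := sigma_algebra_sigma_mpp (shift_mpp (cell_center a) X) K.
have s2 := sigma_algebra_sigma_mpp (shift_mpp (cell_center a) X) K'.
split.
- by split => //; exact: sigma_mpp_measurable.
- apply: (le_trans (beta_coef_shift P X X_stationary _ _ _ bK bK')).
  apply: bmix; first by rewrite lerDr.
  have : L.+1%:R <= n%:R :> R by rewrite ler_nat.
  by rewrite -natr1; lra.
- move=> a' aL; apply: random_list_rectangles1 => // A U mA mU.
  apply: sigma_mpp_points_in => //; [exact: measurable_cell|exact: bounded_cell|].
  by move=> t; exact: cell_near.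
- move=> c cL; apply: random_list_rectangles2 => // A U mA mU.
  apply: sigma_mpp_points_in => //; [exact: measurable_cell|exact: bounded_cell|].
  by move=> t; exact: cell_far.
Qed.

Lemma random_list_cell_points a : random_list (R := R) (cell_points a).
Proof.
by apply: random_list_points_in => //; [exact: measurable_cell|exact: bounded_cell].
Qed.

End cell_points.

(** * Product integrals, decomposition into cells and moments of cell counts *)

Section real_fubini.
Context {d1 d2} {T1 : measurableType d1} {T2 : measurableType d2} {R : realType}.
Variables (P1 : probability T1 R) (P2 : probability T2 R).
Variables (F : T1 * T2 -> R) (iF : integrableR (P1 \x P2)%E F).

Lemma Rint_fubini1 : (forall x, integrableR P2 (fun y => F (x, y))) ->
  \int[(P1 \x P2)%E]_z F z = \int[P1]_x \int[P2]_y F (x, y).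
Proof.
move=> iy; rewrite /Rintegral; congr fine.
rewrite -(integral12_prod_meas1 iF); apply: eq_integral => x _.
by rewrite /fubini_F /= fineK //; exact: (integrable_fin_num measurableT (iy x)).
Qed.

Lemma Rint_fubini2 : (forall y, integrableR P1 (fun x => F (x, y))) ->
  \int[(P1 \x P2)%E]_z F z = \int[P2]_y \int[P1]_x F (x, y).
Proof.
move=> iy; rewrite /Rintegral; congr fine.
rewrite -(integral21_prod_meas1 iF); apply: eq_integral => x _.
by rewrite /fubini_G /= fineK //; exact: (integrable_fin_num measurableT (iy x)).
Qed.

End real_fubini.

Lemma integrableR_prod {d1 d2} {T1 : measurableType d1} {T2 : measurableType d2}
  {R : realType} (P1 : probability T1 R) (P2 : probability T2 R) (f : T1 -> R) (g : T2 -> R) :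
  (forall x, 0 <= f x) -> (forall y, 0 <= g y) ->
  integrableR P1 f -> integrableR P2 g ->
  integrableR (P1 \x P2)%E (fun z => f z.1 * g z.2) /\
  \int[(P1 \x P2)%E]_z (f z.1 * g z.2) = \int[P1]_x f x * \int[P2]_y g y.
Proof.
move=> f0 g0 if_ ig.
have mf := integrableR_measurable _ _ if_.
have mg := integrableR_measurable _ _ ig.
have mfg : measurable_fun setT (fun z : T1 * T2 => f z.1 * g z.2).
  by apply: measurable_funM; [exact: measurableT_comp|exact: measurableT_comp].
have gfin : (\int[P2]_y (g y)%:E)%E \is a fin_num by exact: (integrable_fin_num measurableT ig).
have ffin : (\int[P1]_y (f y)%:E)%E \is a fin_num by exact: (integrable_fin_num measurableT if_).
have E : (\int[(P1 \x P2)]_z (f z.1 * g z.2)%:E)%E =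
   (\int[P1]_x (f x)%:E * \int[P2]_y (g y)%:E)%E.
  rewrite fubini_tonelli1 /=; last 2 first.
  - exact/measurable_EFinP.
  - by move=> x; rewrite lee_fin mulr_ge0.
  rewrite /fubini_F /=.
  have inner x : (\int[P2]_y (f x * g y)%:E = (f x)%:E * \int[P2]_y (g y)%:E)%E.
    under eq_integral do rewrite EFinM.
    by apply: ge0_integralZl => //; [exact/measurable_EFinP|move=> y _; rewrite lee_fin|rewrite lee_fin].
  under eq_integral do rewrite inner.
  rewrite -(fineK gfin); apply: ge0_integralZr => //.
  - exact/measurable_EFinP.
  - by move=> x _; rewrite lee_fin.
  - by rewrite lee_fin Rintegral_ge0.
split.
  apply/integrableP; split; first exact/measurable_EFinP.
  under eq_integral => x _ do rewrite /= ger0_norm ?mulr_ge0 //.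
  by rewrite E -(fineK gfin) -(fineK ffin) -EFinM ltry.
by rewrite /Rintegral E fineM.
Qed.

Section cell_decomposition.
Context {R : realType} {d : nat} {dO : measure_display} {Omega : measurableType dO}
  {M : topologicalType}.
Variable X : point_family R d Omega M.
Hypothesis X_mpp : is_marked_point_process X.
Variables (C C' : set M).
Local Notation E := (d.-tuple (measurableTypeR R)).
Local Notation Y := (E * (bool * bool))%type.
Local Notation site := {ffun 'I_d -> int}.

Definition box_region (n : nat) : set E := [set t | site_of t \in box n].

Lemma box_regionE n : box_region n = \bigcup_(a in [set` box n]) cell a.
Proof.
apply/seteqP; split=> [t ht|t [a /= an /cell_inj ae]]; last by rewrite /box_region /= -ae.
by exists (site_of t) => //; exact: cell_site_of.
Qed.

Lemma measurable_box_region n : measurable (box_region n).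
Proof.
rewrite box_regionE; apply: fin_bigcup_measurable; first exact: finite_seq.
by move=> a _; exact: measurable_cell.
Qed.

Lemma bounded_box_region n : bounded_tuples (box_region n).
Proof.
exists (n%:R + 1) => t; rewrite /box_region /= mem_box => ht i.
have /andP[h1 h2] := cell_site_of t i.
have := site_coord_le (R := R) (site_of t) i.
have : (site_norm (site_of t))%:R <= n%:R :> R by rewrite ler_nat.
by rewrite !ler_norml => h /andP[h3 h4]; apply/andP; split; lra.
Qed.

Lemma bounded_box_regionP (B : set E) : bounded_tuples B -> exists n, B `<=` box_region n.
Proof.
move=> [r hr]; exists (Num.truncn `|r|).+2 => t Bt.
rewrite /box_region /= mem_box site_norm_le; apply/forallP => i.
rewrite -(ler_nat R) -int_abs_le.
have /andP[h1 h2] := cell_site_of t i.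
have := hr _ Bt i; rewrite ler_norml => /andP[h3 h4].
have h5 := truncnS_gt `|r|; have h6 := ler_norm r.
rewrite -[_.+2%:R]natr1 ler_norml; apply/andP; split; lra.
Qed.

Lemma sum_points_in_cells (B : set E) n (f : Y -> R) om : measurable B -> B `<=` box_region n ->
  \sum_(y <- points_in X C C' B om) f y =
  \sum_(a <- box n) \sum_(y <- cell_points X C C' a om) \1_B y.1 * f y.
Proof.
move=> mB Bn.
have mb := measurable_box_region n.
have bb := bounded_box_region n.
have cb a : a \in box n -> cell a `<=` box_region n.
  by move=> an; rewrite box_regionE => t at_; exists a.
rewrite (sum_points_in_sub _ X_mpp _ _ _ _ _ _ mB mb bb Bn).
rewrite [RHS](eq_big_seq (fun a => \sum_(y <- points_in X C C' (box_region n) om)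
    \1_(cell a) y.1 * (\1_B y.1 * f y))); last first.
  move=> a an; rewrite (sum_points_in_sub _ X_mpp _ _ _ _ _ _ (measurable_cell a) mb bb) //.
  exact: cb.
rewrite exchange_big /= big_seq [RHS]big_seq; apply: eq_bigr => y yn.
have yb : box_region n y.1.
  exact: (points_in_window _ X_mpp _ _ _ mb bb) yn.
rewrite (bigD1_seq (site_of y.1)) ?box_uniq //= big1 ?addr0.
  by rewrite [X in _ = X * _]indicE mem_set ?mul1r //; exact: cell_site_of.
move=> a na; rewrite indicE memNset ?mul0r // => /cell_inj ae.
by rewrite ae eqxx in na.
Qed.

End cell_decomposition.

Section shifted_counts.
Context {R : realType} {d : nat} {dO : measure_display} {Omega : measurableType dO}
  {M : topologicalType} (P : probability Omega R).
Variable X : point_family R d Omega M.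
Hypothesis X_mpp : is_marked_point_process X.
Hypothesis X_stationary : stationary P X.
Variables (C C' : set M) (bC : borel C) (bC' : borel C').
Local Notation Z := ('rV[R]_d * M)%type.
Local Notation E := (d.-tuple (measurableTypeR R)).
Local Notation Y := (E * (bool * bool))%type.
Local Notation site := {ffun 'I_d -> int}.
Local Notation points := (points_in X C C').
Local Notation cpoints := (cell_points X C C').

Definition shift_tuple (x : 'rV[R]_d) (t : E) : E := tuple_of_row (row_of_tuple t - x).

Lemma tnth_shift_tuple x t i : tnth (shift_tuple x t) i = tnth t i - x ord0 i.
Proof. by rewrite tnth_mktuple !mxE. Qed.

Lemma measurable_shift_tuple x : measurable_fun setT (shift_tuple x).
Proof.
apply/measurable_fun_tnthP => i; rewrite (_ : _ \o _ = fun t : E => tnth t i - x ord0 i).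
  by apply: measurable_funB => //; exact: measurable_tnth.
by apply/funext => t; rewrite /= tnth_shift_tuple.
Qed.

Lemma measurable_shift_preimage x (B : set E) : measurable B ->
  measurable (shift_tuple x @^-1` B).
Proof. by move=> mB; rewrite -[X in measurable X]setTI; exact: measurable_shift_tuple. Qed.

Lemma bounded_shift_preimage x (B : set E) : bounded_tuples B ->
  bounded_tuples (shift_tuple x @^-1` B).
Proof.
move=> [r hr]; exists (r + `|x|) => t /= Bt i.
have := hr _ Bt i; rewrite tnth_shift_tuple => h.
have h2 := row_coord_le x i.
by rewrite -[tnth t i](subrK (x ord0 i)) (le_trans (ler_normD _ _)) // lerD.
Qed.

Lemma mpp_count_shift_points x (B : set E) (g : bool * bool -> bool) om :
  measurable B -> bounded_tuples B ->
  mpp_count (shift_mpp x X) om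
    (encode C C' @^-1` [set y | g y.2] `&` ([set z | B (tuple_of_row z)] `*` setT)) =
  (\sum_(y <- points (shift_tuple x @^-1` B) om) (g y.2)%:R)%:E.
Proof.
move=> mB bB; rewrite mpp_count_shift.
rewrite [X in mpp_count _ _ X](_ : _ = encode C C' @^-1` [set y | g y.2] `&`
   ([set z | (shift_tuple x @^-1` B) (tuple_of_row z)] `*` setT)); last first.
  by apply/seteqP; split=> -[z m] /=; rewrite /shift_tuple tuple_of_rowK => h; exact: h.
rewrite mpp_count_points_in //; last first.
- exact: bounded_shift_preimage.
- exact: measurable_shift_preimage.
congr EFin; apply: eq_bigr => y _; rewrite indicE; congr (_ %:R); congr nat_of_bool.
by apply/idP/idP => [/set_mem|h]; [|exact/mem_set].
Qed.

Lemma mpp_count_points (B : set E) (g : bool * bool -> bool) om :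
  measurable B -> bounded_tuples B ->
  mpp_count X om
    (encode C C' @^-1` [set y | g y.2] `&` ([set z | B (tuple_of_row z)] `*` setT)) =
  (\sum_(y <- points B om) (g y.2)%:R)%:E.
Proof.
move=> mB bB; rewrite mpp_count_points_in //.
congr EFin; apply: eq_bigr => y _; rewrite indicE; congr (_ %:R); congr nat_of_bool.
by apply/idP/idP => [/set_mem|h]; [|exact/mem_set].
Qed.

Lemma measurable_mark_set (g : bool * bool -> bool) : measurable [set y : Y | g y.2].
Proof.
rewrite (_ : [set _ | _] = setT `*` [set c | g c]); last first.
  by apply/seteqP; split=> y //= [].
apply: measurableX => //.
rewrite (_ : [set c | g c] = \bigcup_(c in [set c | g c]) ([set c.1] `*` [set c.2])).
  apply: fin_bigcup_measurable => [|[c1 c2] _]; first exact: finite_finset.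
  exact: measurableX.
by apply/seteqP; split=> [[c1 c2] gc|[c1 c2] [[c3 c4] /= g34 [/= -> ->]]//]; exists (c1, c2).
Qed.

End shifted_counts.

Section moments.
Context {R : realType} {d : nat} {dO : measure_display} {Omega : measurableType dO}
  {M : topologicalType} (P : probability Omega R).
Variable X : point_family R d Omega M.
Hypothesis X_mpp : is_marked_point_process X.
Hypothesis X_stationary : stationary P X.
Variables (C C' : set M) (bC : borel C) (bC' : borel C').
Variables (q : R) (q0 : 0 < q).
Hypothesis X_moment :
  (\int[P]_om (mpp_count X om (unit_cube `*` setT) `^ q) < +oo)%E.
Local Notation Z := ('rV[R]_d * M)%type.
Local Notation E := (d.-tuple (measurableTypeR R)).
Local Notation Y := (E * (bool * bool))%type.
Local Notation site := {ffun 'I_d -> int}.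
Local Notation points := (points_in X C C').
Local Notation cpoints := (cell_points X C C').

Definition site_row (a : site) : 'rV[R]_d := \row_i (a i)%:~R.

Lemma cell_shift a m : cell (a + m) = shift_tuple (site_row a) @^-1` (cell (R := R) m).
Proof.
apply/seteqP; split=> t h i; have := h i; rewrite tnth_shift_tuple mxE !ffunE intrD;
  by move=> /andP[h1 h2]; apply/andP; split; lra.
Qed.

Let N (a : site) om : R := (size (cpoints a om))%:R.

Let NE a om : N a om = \sum_(y <- cpoints a om) 1.
Proof. by rewrite big_const_seq iter_addr addr0 count_predT. Qed.

Let moment0 : integrableR P (fun om => N 0 om `^ q).
Proof.
pose B : set E := [set t | forall i, 0 <= tnth t i <= 1].
have mB : measurable B.
  rewrite (_ : B = \bigcap_(i in [set: 'I_d]) ((fun t : E => tnth t i) @^-1` [set` `[0, 1]])).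
    apply: fin_bigcap_measurable => // i _.
    by rewrite -[X in measurable X]setTI; apply: measurable_tnth.
  apply/seteqP; split=> t h i; first by move=> _ /=; rewrite in_itv; exact: h.
  by have := h i I; rewrite /= in_itv.
have bB : bounded_tuples B.
  exists 1 => t ht i; have /andP[h1 h2] := ht i; rewrite ler_norml; apply/andP; split; lra.
have cB : cell 0 `<=` B.
  by move=> t h i; have := h i; rewrite !ffunE => /andP[h1 h2]; apply/andP; split; lra.
have cE om : mpp_count X om (unit_cube `*` setT) = (size (points B om))%:R%:E.
  have := mpp_count_points X X_mpp C C' B (fun=> true) om mB bB.
  rewrite /= big_const_seq iter_addr addr0 count_predT => <-; congr (mpp_count _ _ _).
  apply/seteqP; split => -[z m] /=.
    by move=> [h _]; split => //; split => // i; rewrite tnth_mktuple; exact: h.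
  by move=> [_ [h _]]; split => // i; have := h i; rewrite tnth_mktuple.
have mpow (f : Omega -> R) : measurable_fun setT f -> measurable_fun setT (fun om => f om `^ q).
  by move=> mf; apply: (@measurableT_comp _ _ _ _ _ _ (fun x => x `^ q)) => //; exact: measurable_powR.
apply: (integrableR_le _ _ (fun om => (size (points B om))%:R `^ q)).
- by apply: mpow; apply: random_list_size; apply: random_list_points_in => //;
    [exact: measurable_cell|exact: bounded_cell].
- move=> om; rewrite ger0_norm; last exact: powR_ge0.
  apply: ge0_ler_powR; rewrite ?nnegrE ?(ltW q0) ?ler0n // NE.
  rewrite (sum_points_in_sub _ X_mpp _ _ _ _ _ _ (measurable_cell 0) mB bB cB).
  rewrite -[leRHS]mulr1 mulr_natl -[X in _ *+ X]count_predT -[leRHS]addr0 -iter_addr -big_const_seq.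
  by apply: ler_sum => y _; rewrite mulr1 indicE; case: (_ \in _).
- apply/integrableP; split.
    by apply/measurable_EFinP/mpow/random_list_size; exact: random_list_points_in.
  move: X_moment; congr (_ < _)%E; apply: eq_integral => om _.
  by rewrite cE poweR_EFin /= ger0_norm ?powR_ge0.
Qed.

(** Every cell is a translate of the cell at the origin, which is contained in the closed unit cube
    of the moment assumption. *)
Lemma cell_moment : exists2 m : R, 0 <= m & forall a,
  integrableR P (fun om => N a om `^ q) /\ \int[P]_om (N a om `^ q) = m.
Proof.
exists (\int[P]_om (N 0 om `^ q)); first by apply: Rint_ge0 => om; exact: powR_ge0.
move=> a.
pose G : set Z := encode C C' @^-1` [set y | xpredT y.2] `&`
     ([set z | cell 0 (tuple_of_row z)] `*` setT).
pose f (mu : set Z -> \bar R) : R := fine (mu G) `^ q.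
have mf : measurable_fun (setT : set (g_sigma_algebraType (conf_generators (d := d) (M := M)))) f.
  apply: (@measurableT_comp _ _ _ _ _ _ (fun x => x `^ q)); first exact: measurable_powR.
  apply: (@measurableT_comp _ _ _ _ _ _ fine); first exact: fine_measurable.
  apply: measurable_evaluation.
  exact: (borel_encode_window C C' bC bC' (cell 0) (measurable_cell 0) _ (measurable_mark_set (fun=> true))).
have f0 om : f (mpp_count X om) = N 0 om `^ q.
  rewrite /f /G (mpp_count_points X X_mpp C C' (cell 0) (fun=> true) om) ?NE //.
    exact: measurable_cell.
  exact: bounded_cell.
have fx om : f (mpp_count (shift_mpp (site_row a) X) om) = N a om `^ q.
  rewrite /f /G (mpp_count_shift_points X X_mpp C C' _ (cell 0) (fun=> true) om); last 2 first.
  - exact: measurable_cell.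
  - exact: bounded_cell.
  by rewrite -cell_shift addr0 NE.
have E0 : (fun om => f (mpp_count X om)) = (fun om => N 0 om `^ q) := funext f0.
have Ea : (fun om => f (mpp_count (shift_mpp (site_row a) X) om)) = (fun om => N a om `^ q) := funext fx.
have i0 : integrableR P (fun om => f (mpp_count X om)) by rewrite E0; exact: moment0.
have [ia ea] := stationary_integral P X X_mpp X_stationary (site_row a) f mf i0.
split; first by rewrite -Ea; exact: ia.
move: ea; rewrite Ea E0; exact.
Qed.

End moments.

(** Each factor is at most the maximum, and the fourth power of the maximum raised to [q / 4] is its
    power [q]. This is how moments of order [q > 4] of single counts control a moment of order
    larger than one of a product of four. *)
Lemma prod4_powR_le {R : realType} (x y z t q : R) :
  0 <= x -> 0 <= y -> 0 <= z -> 0 <= t -> 0 <= q ->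
  (x * y * z * t) `^ (q / 4) <= x `^ q + y `^ q + z `^ q + t `^ q.
Proof.
move=> x0 y0 z0 t0 q0.
pose mx := Num.max (Num.max x y) (Num.max z t).
have [xm ym zm tm] : [/\ x <= mx, y <= mx, z <= mx & t <= mx].
  by split; rewrite !le_max lexx ?orbT.
have m0 : 0 <= mx by exact: le_trans xm.
have pm : x * y * z * t <= mx `^ 4.
  rewrite -[4]/(4%:R) powR_mulrn // !exprS expr0 mulr1 !mulrA.
  by apply: ler_pM => //; rewrite ?mulr_ge0 //; apply: ler_pM => //; rewrite ?mulr_ge0 //; exact: ler_pM.
apply: (@le_trans _ _ (mx `^ q)).
  have -> : mx `^ q = (mx `^ 4) `^ (q / 4) by rewrite -powRrM mulrC divfK.
  by apply: ge0_ler_powR; rewrite ?nnegrE ?mulr_ge0 ?divr_ge0 ?powR_ge0 //.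
have a1 := powR_ge0 x q; have a2 := powR_ge0 y q; have a3 := powR_ge0 z q; have a4 := powR_ge0 t q.
by rewrite /mx !maxEle; repeat case: ifP => _; lra.
Qed.

Lemma prod4_le {R : realType} (n1 n2 n3 n4 : nat) (q : R) : 4 <= q ->
  n1%:R * n2%:R * n3%:R * n4%:R <= n1%:R `^ q + n2%:R `^ q + n3%:R `^ q + n4%:R `^ q :> R.
Proof.
move=> q4.
have h (n : nat) : n%:R `^ 4 <= n%:R `^ q :> R.
  case: n => [|n]; last by apply: ler_powR => //; rewrite ler1n.
  by rewrite !powR0 // gt_eqF // (lt_le_trans _ q4).
have := prod4_powR_le (n1%:R : R) n2%:R n3%:R n4%:R 4; rewrite !ler0n divff // powRr1 ?mulr_ge0 //.
move=> /(_ isT isT isT isT isT) /le_trans; apply.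
by do !apply: lerD.
Qed.

Section list_moments.
Context {R : realType} {dO dY : measure_display} {Omega : measurableType dO}
  {Y : measurableType dY} {I : Type} (P : probability Omega R).
Variables (s : I -> Omega -> seq Y) (rs : forall a, random_list (R := R) (s a)).
Variables (q m : R) (q4 : 4 < q).
Hypothesis mom : forall a, integrableR P (fun om => (size (s a om))%:R `^ q) /\
  \int[P]_om (size (s a om))%:R `^ q = m.
Local Notation N a om := ((size (s a om))%:R : R).

Let q0 : 0 < q. Proof. exact: lt_trans q4. Qed.

Lemma moment_ge0 (a : I) : 0 <= m.
Proof. by have [_ <-] := mom a; apply: Rint_ge0 => om; exact: powR_ge0. Qed.

Lemma measurable_size a : measurable_fun setT (fun om => N a om).
Proof. exact: random_list_size. Qed.

Let mpow a : measurable_fun setT (fun om => N a om `^ q).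
Proof. by have [/integrableR_measurable] := mom a. Qed.

Let sum4 a b c e : integrableR P (fun om => N a om `^ q + N b om `^ q + N c om `^ q + N e om `^ q) /\
  \int[P]_om (N a om `^ q + N b om `^ q + N c om `^ q + N e om `^ q) = 4 * m.
Proof.
have [ia ea] := mom a; have [ib eb] := mom b; have [ic ec] := mom c; have [ie ee] := mom e.
have iab := integrableRD _ _ _ ia ib; have iabc := integrableRD _ _ _ iab ic.
by split; [exact: integrableRD|rewrite !RintD // ea eb ec ee; ring].
Qed.

Lemma integrable_size4 a b c e : integrableR P (fun om => N a om * N b om * N c om * N e om) /\
  \int[P]_om (N a om * N b om * N c om * N e om) <= 4 * m.
Proof.
have [i4 e4] := sum4 a b c e.
have h om : N a om * N b om * N c om * N e om <=
   N a om `^ q + N b om `^ q + N c om `^ q + N e om `^ q by exact: prod4_le (ltW q4).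
have i : integrableR P (fun om => N a om * N b om * N c om * N e om).
  apply: integrableR_le i4; first by do !apply: measurable_funM; exact: measurable_size.
  by move=> om; rewrite ger0_norm // !mulr_ge0.
by split => //; rewrite -e4; exact: Rint_le.
Qed.

Lemma size2_le a b om : N a om * N b om <= N a om * N b om * N a om * N b om.
Proof. by rewrite -!natrM ler_nat; case: (size (s a om)) (size (s b om)) => [|x] [|y] //; nia. Qed.

Lemma integrable_size2 a b : integrableR P (fun om => N a om * N b om) /\
  \int[P]_om (N a om * N b om) <= 4 * m.
Proof.
have [i4 e4] := integrable_size4 a b a b.
have i : integrableR P (fun om => N a om * N b om).
  apply: integrableR_le i4; first by apply: measurable_funM; exact: measurable_size.
  by move=> om; rewrite ger0_norm ?mulr_ge0 // size2_le.
by split => //; apply: le_trans e4; apply: Rint_le => // om; exact: size2_le.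
Qed.

Lemma integrable_size a : integrableR P (fun om => N a om).
Proof.
apply: integrableR_le (integrable_size2 a a).1; first exact: measurable_size.
by move=> om; rewrite ger0_norm // -natrM ler_nat; case: (size _) => // n; rewrite leq_pmulr.
Qed.

Variable beta : R.
Variables (F F' : set (set Omega)).
Hypothesis (sF : sigma_algebra setT F) (sF' : sigma_algebra setT F').
Hypothesis (mF : F `<=` measurable) (mF' : F' `<=` measurable).
Hypothesis (beta0 : 0 <= beta) (hbeta : (beta_coef P F F' <= beta%:E)%E).

(** The covariance inequality with moment exponent [q / 4]: the power [q / 4] of the dominating
    product has integral at most [4 m] under the joint law and under the product law alike. *)
Lemma list_mixing (a b c e : I) (f : Omega * Omega -> R) :
  measurable_fun (setT : set (g_sigma_algebraType (rectangles F F'))) f ->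
  (forall x, `|f x| <= N a x.1 * N b x.1 * N c x.2 * N e x.2) ->
  `|\int[P]_om f (om, om) - \int[(P \x P)%E]_x f x| <=
    4 * ((1 + 4 * m) * (2 * beta) `^ (1 - 4 / q)).
Proof.
move=> mf fN.
pose g (x : Omega * Omega) := N a x.1 `^ q + N b x.1 `^ q + N c x.2 `^ q + N e x.2 `^ q.
have m1 i : integrableR (P \x P)%E (fun x => N i x.1 `^ q) /\
    \int[(P \x P)%E]_x (N i x.1 `^ q) = m.
  have [im em] := mom i.
  have [||i1 e1] := integrableR_prod P P _ (fun=> 1) _ _ im (integrableR_cst P 1) => //.
  rewrite em Rint_cst mulr1 in e1; split.
    by under eq_fun do rewrite -[_ `^ _]mulr1.
  by rewrite -[RHS]e1; apply: eq_Rintegral => x _; rewrite mulr1.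
have m2 i : integrableR (P \x P)%E (fun x => N i x.2 `^ q) /\
    \int[(P \x P)%E]_x (N i x.2 `^ q) = m.
  have [im em] := mom i.
  have [||i1 e1] := integrableR_prod P P (fun=> 1) _ _ _ (integrableR_cst P 1) im => //.
  rewrite em Rint_cst mul1r in e1; split.
    by under eq_fun do rewrite -[_ `^ _]mul1r.
  by rewrite -[RHS]e1; apply: eq_Rintegral => x _; rewrite mul1r.
have [ia ea] := m1 a; have [ib eb] := m1 b; have [ic ec] := m2 c; have [ie ee] := m2 e.
have iab := integrableRD _ _ _ ia ib; have iabc := integrableRD _ _ _ iab ic.
have ig := integrableRD _ _ _ iabc ie.
have q41 : 1 < q / 4 by rewrite ltr_pdivlMr // mul1r.
have -> : 1 - 4 / q = 1 - (q / 4)^-1 by rewrite invf_div.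
have [i4 e4] := sum4 a b c e.
apply: (beta_mixing_expectation P F F' sF sF' mF mF' beta beta0 hbeta (q / 4) (4 * m) q41 g) => //.
- exact: integrableR_measurable ig.
- by rewrite -e4.
- rewrite /g (RintD _ _ _ iabc ie) (RintD _ _ _ iab ic) (RintD _ _ _ ia ib) ea eb ec ee.
  by rewrite le_eqVlt; apply/orP; left; apply/eqP; ring.
- move=> x; apply: le_trans (prod4_powR_le _ _ _ _ _ _ _ _ _ (ltW q0)) => //.
  by apply: ge0_ler_powR; rewrite ?nnegrE ?mulr_ge0 // ?divr_ge0 // ltW.
Qed.

End list_moments.

(** * Mean measures, and the vanishing of centred mark sums *)

Lemma norm_sum_le_size {R : realDomainType} {I : Type} (s : seq I) (f : I -> R) (c : R) :
  (forall i, `|f i| <= c) -> `|\sum_(i <- s) f i| <= c * (size s)%:R.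
Proof.
move=> fc; apply: (le_trans (ler_norm_sum _ _ _)).
apply: (@le_trans _ _ (\sum_(i <- s) c)); first exact: ler_sum.
by rewrite big_const_seq iter_addr addr0 count_predT mulr_natr.
Qed.

Section list_sum_integrals.
Context {R : realType} {dO dY : measure_display} {Omega : measurableType dO}
  {Y : measurableType dY} (P : probability Omega R).
Variables (s : Omega -> seq Y) (rs : random_list (R := R) s).
Hypothesis is_ : integrableR P (fun om => (size (s om))%:R).

Lemma integrable_list_sum (f : Y -> R) (c : R) : measurable_fun setT f ->
  (forall y, `|f y| <= c) -> integrableR P (fun om => \sum_(y <- s om) f y).
Proof.
move=> mf fc; apply: (integrableR_le _ _ (fun om => c * (size (s om))%:R)).
- exact: random_list_sum.
- by move=> om; exact: norm_sum_le_size.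
- exact: integrableRZ.
Qed.

(** Indicators extend to bounded functions by uniform approximation with layer sums: the error is at
    most the mesh times [c] times the mean number of points, for every mesh. *)
Lemma Rint_list_sum_eq0 {dE} {E : measurableType dE} (pos : Y -> E) (phi : Y -> R) (c : R) :
  measurable_fun setT pos -> measurable_fun setT phi -> (forall y, `|phi y| <= c) ->
  (forall A, measurable A -> \int[P]_om (\sum_(y <- s om) \1_A (pos y) * phi y) = 0) ->
  forall (u : E -> R) (b : R), measurable_fun setT u -> (forall t, `|u t| <= b) ->
  \int[P]_om (\sum_(y <- s om) u (pos y) * phi y) = 0.
Proof.
move=> mpos mphi phic H u b mu ub.
have [y0|] := pselect (exists y : Y, True); last first.
  move=> nY; rewrite -[RHS](Rint_cst P 0); apply: eq_Rintegral => om _.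
  by case: (s om) => [|y ?]; [rewrite big_nil|exfalso; apply: nY; exists y].
have c0 : 0 <= c by have [y _] := y0; exact: le_trans (phic y).
have b0 : 0 <= b by have [y _] := y0; exact: le_trans (ub (pos y)).
pose EN := \int[P]_om (size (s om))%:R.
have EN0 : 0 <= EN by apply: Rint_ge0.
set J := (X in X = 0).
have key (K : nat) : (0 < K)%N -> `|J| <= 2 * (b + 1) * c * EN / K%:R.
  (* The function [u + b] is nonnegative and stays below the cap [K * eta], so its layer sum is
     within [eta] of it. *)
  move=> K0; pose eta := 2 * (b + 1) / K%:R.
  have eta0 : 0 <= eta by rewrite divr_ge0 // mulr_ge0 // addr_ge0.
  have Keta : K%:R * eta = 2 * (b + 1) by rewrite mulrC divfK // pnatr_eq0 -lt0n.
  pose A (k : nat) := [set t | k.+1%:R * eta <= u t + b].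
  have mA k : measurable (A k).
    have mub : measurable_fun setT (fun t => u t + b) by exact: measurable_funD.
    have := mub measurableT `[k.+1%:R * eta, +oo[%classic (measurable_itv _).
    by rewrite setTI; congr measurable; apply/seteqP; split=> t /=; rewrite in_itv /= andbT.
  pose S t := \sum_(k < K) eta * (\1_(A k) t : R).
  have SE t : S t = \sum_(k < K) eta * (k.+1%:R * eta <= u t + b)%R%:R.
    by apply: eq_bigr => k _; rewrite indicE mem_setE.
  have mS : measurable_fun setT S.
    by apply: measurable_sum => k; apply: measurable_funM => //; exact: measurable_indic.
  have Seta t : `|u t + b - S t| <= eta.
    have := ub t; rewrite ler_norml => /andP[u1 u2].
    have ub0 : 0 <= u t + b by lra.
    have [h1 _] := layer_sum eta (u t + b) K eta0 ub0.
    rewrite -SE in h1 *; rewrite Keta min_l; last by lra.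
    by move=> h3; rewrite ger0_norm ?subr_ge0 //; lra.
  have meas1 (v : E -> R) : measurable_fun setT v -> measurable_fun setT (fun y => v (pos y) * phi y).
    by move=> mv; apply: measurable_funM => //; exact: measurableT_comp.
  have bnd (v : E -> R) (r : R) y : (forall t, `|v t| <= r) -> `|v (pos y) * phi y| <= r * c.
    by move=> vr; rewrite normrM ler_pM.
  have mv1 : measurable_fun setT (fun t => u t + b - S t).
    by apply: measurable_funB => //; exact: measurable_funD.
  have i1 : integrableR P (fun om => \sum_(y <- s om) (u (pos y) + b - S (pos y)) * phi y).
    apply: (integrable_list_sum _ (eta * c)); first exact: (meas1 _ mv1).
    by move=> y; exact: (bnd _ _ y Seta).
  have ind1 k t : `|\1_(A k) t : R| <= 1 by rewrite indicE ger0_norm //; case: (_ \in _).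
  have i2 k : integrableR P (fun om => \sum_(y <- s om) \1_(A k) (pos y) * phi y).
    apply: (integrable_list_sum _ (1 * c)); first by apply: meas1; exact: measurable_indic.
    by move=> y; exact: (bnd _ _ y (ind1 k)).
  have one1 t : `|(1 : R)| <= 1 by rewrite normr1.
  have i3 := integrable_list_sum _ c mphi phic.
  have i3' : integrableR P (fun om => - b * \sum_(y <- s om) phi y) by exact: integrableRZ.
  have i2' : integrableR P (fun om => \sum_(k < K) eta * \sum_(y <- s om) \1_(A k) (pos y) * phi y).
    by apply: integrableR_sum => k; exact: integrableRZ (i2 k).
  have z3 : \int[P]_om (\sum_(y <- s om) phi y) = 0.
    rewrite -[RHS](H setT measurableT); apply: eq_Rintegral => om _.
    by apply: eq_bigr => y _; rewrite indicT mul1r.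
  have -> : J = \int[P]_om (\sum_(y <- s om) (u (pos y) + b - S (pos y)) * phi y).
    transitivity (\int[P]_om ((\sum_(y <- s om) (u (pos y) + b - S (pos y)) * phi y +
       \sum_(k < K) eta * \sum_(y <- s om) \1_(A k) (pos y) * phi y) +
        - b * \sum_(y <- s om) phi y)).
      apply: eq_Rintegral => om _.
      under [X in _ = _ + X + _]eq_bigr do rewrite mulr_sumr.
      rewrite exchange_big mulr_sumr -!big_split /=; apply: eq_bigr => y _.
      have -> : \sum_(k < K) eta * (\1_(A k) (pos y) * phi y) = S (pos y) * phi y.
        by rewrite /S mulr_suml; apply: eq_bigr => k _; rewrite mulrA.
      ring.
    have i12 := integrableRD _ _ _ i1 i2'.
    rewrite (RintD _ _ _ i12 i3') (RintD _ _ _ i1 i2') (RintZ _ _ _ i3) z3 mulr0 addr0.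
    rewrite (Rint_sum P _ (index_enum 'I_K)
      (fun k om => eta * \sum_(y <- s om) \1_(A k) (pos y) * phi y)); last first.
      by move=> k; exact: integrableRZ (i2 k).
    rewrite big1 ?addr0 // => k _; rewrite (RintZ _ _ _ (i2 k)) H ?mulr0 //; exact: mA.
  have -> : 2 * (b + 1) * c * EN / K%:R = eta * c * EN by rewrite /eta; ring.
  rewrite /EN -RintZ //.
  apply: (Rint_norm_le P _ _ (integrableR_measurable _ _ i1) (integrableRZ _ _ _ is_)).
  by move=> om; apply: norm_sum_le_size => y; exact: (bnd (fun t => u t + b - S t) eta y Seta).
apply/eqP; rewrite -normr_eq0 eq_le normr_ge0 andbT leNgt; apply/negP => J0.
set D := 2 * (b + 1) * c * EN in key.
have D0 : 0 <= D by rewrite /D !mulr_ge0 // addr_ge0.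
have := key (Num.truncn (D / `|J|)).+1 isT.
rewrite ler_pdivlMr // mulrC -ler_pdivlMr // leNgt.
by rewrite truncnS_gt.
Qed.

End list_sum_integrals.

Section pair_sum_integrals.
Context {R : realType} {dO dY dY' : measure_display} {Omega : measurableType dO}
  {Y : measurableType dY} {Y' : measurableType dY'} (P : probability Omega R).
Variables (s : Omega -> seq Y) (rs : random_list (R := R) s).
Variables (s' : Omega -> seq Y') (rs' : random_list (R := R) s').
Hypothesis is_ : integrableR P (fun om => (size (s om))%:R).
Hypothesis is'_ : integrableR P (fun om => (size (s' om))%:R).
Variables (h : Y * Y' -> R) (c : R) (mh : measurable_fun setT h) (hc : forall z, `|h z| <= c).

Let F (x : Omega * Omega) := \sum_(y <- s x.1) \sum_(y' <- s' x.2) h (y, y').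

Lemma norm_pair_sum_le x : `|F x| <= c * ((size (s x.1))%:R * (size (s' x.2))%:R).
Proof.
rewrite /F -big_allpairs (le_trans (norm_sum_le_size _ _ _ hc)) //.
by rewrite size_allpairs natrM.
Qed.

Lemma measurable_pair_sum : measurable_fun setT F.
Proof.
have r1 : random_list (R := R) (s \o fst : Omega * Omega -> seq Y).
  by move=> A mA; exact: (measurableT_comp (rs A mA)).
have r2 : random_list (R := R) (s' \o snd : Omega * Omega -> seq Y').
  by move=> A mA; exact: (measurableT_comp (rs' A mA)).
have := random_list_sum _ (random_list_allpairs _ r1 _ r2) h mh.
by apply: eq_measurable_fun => x _; rewrite big_allpairs.
Qed.

Lemma integrable_pair_sum : integrableR (P \x P)%E F.
Proof.
have [i2 _] := integrableR_prod P P _ _ (fun=> ler0n _ _) (fun=> ler0n _ _) is_ is'_.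
apply: (integrableR_le _ _ _ measurable_pair_sum norm_pair_sum_le).
exact: integrableRZ.
Qed.

Lemma Rint_pair_sum1 : \int[(P \x P)%E]_x F x =
  \int[P]_om \sum_(y <- s om) \int[P]_om' \sum_(y' <- s' om') h (y, y').
Proof.
have ih y : integrableR P (fun om' => \sum_(y' <- s' om') h (y, y')).
  by apply: (integrable_list_sum _ _ rs' is'_ _ c) => //; exact: measurableT_comp.
rewrite Rint_fubini1; [|exact: integrable_pair_sum|by move=> x; exact: (integrableR_sum P _ (s x) (fun y om' => \sum_(y' <- s' om') h (y, y')))].
apply: eq_Rintegral => om _.
exact: (Rint_sum P _ (s om) (fun y om' => \sum_(y' <- s' om') h (y, y'))).
Qed.

Lemma Rint_pair_sum2 : \int[(P \x P)%E]_x F x =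
  \int[P]_om' \sum_(y' <- s' om') \int[P]_om \sum_(y <- s om) h (y, y').
Proof.
have ih y' : integrableR P (fun om => \sum_(y <- s om) h (y, y')).
  by apply: (integrable_list_sum _ _ rs is_ _ c) => //; exact: measurableT_comp.
have FE om' om : F (om, om') = \sum_(y' <- s' om') \sum_(y <- s om) h (y, y').
  by rewrite /F exchange_big.
rewrite Rint_fubini2; [|exact: integrable_pair_sum|]; last first.
  by move=> x; under eq_fun do rewrite FE; exact: integrableR_sum.
apply: eq_Rintegral => om' _; under eq_Rintegral do rewrite FE.
by rewrite Rint_sum.
Qed.

End pair_sum_integrals.

Lemma unit_opp_le {R : realDomainType} (x : R) : (0 : int)%:~R <= - x < (0 : int)%:~R + 1 -> `|x| <= 1.
Proof. by rewrite mulr0z add0r => /andP[a1 a2]; rewrite ler_norml; apply/andP; split; lra. Qed.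

Lemma unit_sub_le {R : realDomainType} (t y r : R) : (0 : int)%:~R <= - (t - y) < (0 : int)%:~R + 1 ->
  `|y| <= r -> `|t| <= r + 1.
Proof.
rewrite mulr0z add0r => /andP[a1 a2]; rewrite !ler_norml => /andP[a3 a4].
by apply/andP; split; lra.
Qed.

Lemma unit_add_le {R : realDomainType} (t y r : R) : (0 : int)%:~R <= y < (0 : int)%:~R + 1 ->
  `|t + y| <= r -> `|t| <= r + 1.
Proof.
rewrite mulr0z add0r => /andP[a1 a2]; rewrite !ler_norml => /andP[a3 a4].
by apply/andP; split; lra.
Qed.

Section mean_measure.
Context {R : realType} {d : nat} {dO : measure_display} {Omega : measurableType dO}
  {M : topologicalType} (P : probability Omega R).
Variable X : point_family R d Omega M.
Hypothesis X_mpp : is_marked_point_process X.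
Hypothesis X_stationary : stationary P X.
Variables (C C' : set M) (bC : borel C) (bC' : borel C').
Variables (q : R) (q4 : 4 < q).
Hypothesis X_moment :
  (\int[P]_om (mpp_count X om (unit_cube `*` setT) `^ q) < +oo)%E.
Local Notation Z := ('rV[R]_d * M)%type.
Local Notation E := (d.-tuple (measurableTypeR R)).
Local Notation Y := (E * (bool * bool))%type.
Local Notation site := {ffun 'I_d -> int}.
Local Notation points := (points_in X C C').
Local Notation cpoints := (cell_points X C C').

Let q0 : 0 < q. Proof. exact: lt_trans q4. Qed.

Lemma integrable_cell_size a : integrableR P (fun om => (size (cpoints a om))%:R).
Proof.
have [m m0 hm] := cell_moment P X X_mpp X_stationary C C' bC bC' q q0 X_moment.
exact: (integrable_size P cpoints (random_list_cell_points X X_mpp C C' bC bC') q m q4 hm a).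
Qed.

Lemma integrable_points_size (B : set E) : measurable B -> bounded_tuples B ->
  integrableR P (fun om => (size (points B om))%:R).
Proof.
move=> mB bB; have [n Bn] := bounded_box_regionP _ bB.
apply: (integrableR_le _ _ (fun om => \sum_(a <- box n) (size (cpoints a om))%:R)).
- by apply: random_list_size; exact: random_list_points_in.
- move=> om; rewrite ger0_norm //.
  have := sum_points_in_cells X X_mpp C C' B n (fun=> 1) om mB Bn.
  rewrite big_const_seq iter_addr addr0 count_predT => ->.
  apply: ler_sum => a _.
  rewrite -[leRHS]mulr1 mulr_natl -[X in _ *+ X]count_predT -[leRHS]addr0 -iter_addr -big_const_seq.
  by apply: ler_sum => y _; rewrite mulr1 indicE; case: (_ \in _).
- by apply: integrableR_sum => a; exact: integrable_cell_size.
Qed.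

Definition centered (g : bool * bool -> bool) (p : R) (y : Y) : R := (g y.2)%:R - p.

Lemma measurable_centered g p : measurable_fun setT (centered g p).
Proof.
have mi : measurable_fun setT (\1_[set y : Y | g y.2] : Y -> R).
  by apply: measurable_indic; exact: measurable_mark_set.
rewrite (_ : centered g p = fun y => \1_[set y : Y | g y.2] y - p).
  exact: measurable_funB.
by apply/funext => y; rewrite indicE mem_setE.
Qed.

Lemma centered_le g p y : `|centered g p y| <= 1 + `|p|.
Proof.
rewrite /centered (le_trans (ler_normB _ _)) // lerD2r.
by case: (g _); rewrite ?normr1 ?normr0.
Qed.

(** As a function of [B], a signed measure that stationarity makes translation invariant. For [g]
    constantly true and [p = 0] it is the intensity measure. *)
Definition mean_sum (g : bool * bool -> bool) (p : R) (B : set E) : R :=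
  \int[P]_om \sum_(y <- points B om) centered g p y.

Lemma integrable_mean_sum (g : bool * bool -> bool) (p : R) (B : set E) : measurable B -> bounded_tuples B ->
  integrableR P (fun om => \sum_(y <- points B om) centered g p y).
Proof.
move=> mB bB; apply: (integrable_list_sum P _ _ _ _ (1 + `|p|)).
- exact: random_list_points_in.
- exact: integrable_points_size.
- exact: measurable_centered.
- exact: centered_le.
Qed.

Let count_conf (g : bool * bool -> bool) (B : set E) : set Z :=
  encode C C' @^-1` [set y | g y.2] `&` ([set z | B (tuple_of_row z)] `*` setT).

Let measurable_count_conf (g : bool * bool -> bool) (B : set E) : measurable B ->
  measurable_fun (setT : set (g_sigma_algebraType (conf_generators (d := d) (M := M))))
    (fun mu => fine (mu (count_conf g B)) : R).
Proof.
move=> mB; apply: (@measurableT_comp _ _ _ _ _ _ fine); first exact: fine_measurable.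
apply: measurable_evaluation.
exact: (borel_encode_window C C' bC bC' B mB _ (measurable_mark_set g)).
Qed.

Let centered_count (g : bool * bool -> bool) (p : R) (B : set E) om :
  \sum_(y <- points B om) (g y.2)%:R - p * \sum_(y <- points B om) 1 =
  \sum_(y <- points B om) centered g p y.
Proof. by rewrite mulr_sumr -sumrB; apply: eq_bigr => y _; rewrite mulr1. Qed.

Let stat_fun (g : bool * bool -> bool) (p : R) (B : set E) (mu : set Z -> \bar R) : R :=
  fine (mu (count_conf g B)) - p * fine (mu (count_conf (fun=> true) B)).

Let measurable_stat_fun (g : bool * bool -> bool) (p : R) (B : set E) : measurable B ->
  measurable_fun (setT : set (g_sigma_algebraType (conf_generators (d := d) (M := M))))
    (stat_fun g p B).
Proof.
move=> mB; apply: measurable_funB; first exact: measurable_count_conf.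
by apply: measurable_funM => //; exact: measurable_count_conf.
Qed.

Let stat_fun0 (g : bool * bool -> bool) (p : R) (B : set E) om : measurable B -> bounded_tuples B ->
  stat_fun g p B (mpp_count X om) = \sum_(y <- points B om) centered g p y.
Proof.
move=> mB bB; rewrite /stat_fun /count_conf (mpp_count_points X X_mpp C C' B g om mB bB).
by rewrite (mpp_count_points X X_mpp C C' B (fun=> true) om mB bB) /= centered_count.
Qed.

Let stat_funx x (g : bool * bool -> bool) (p : R) (B : set E) om : measurable B -> bounded_tuples B ->
  stat_fun g p B (mpp_count (shift_mpp x X) om) =
  \sum_(y <- points (shift_tuple x @^-1` B) om) centered g p y.
Proof.
move=> mB bB; rewrite /stat_fun /count_conf.
rewrite (mpp_count_shift_points X X_mpp C C' x B g om mB bB).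
by rewrite (mpp_count_shift_points X X_mpp C C' x B (fun=> true) om mB bB) /= centered_count.
Qed.

Lemma mean_sum_shift x (g : bool * bool -> bool) (p : R) (B : set E) : measurable B -> bounded_tuples B ->
  mean_sum g p (shift_tuple x @^-1` B) = mean_sum g p B.
Proof.
move=> mB bB.
have [|_ e] := stationary_integral P X X_mpp X_stationary x _ (measurable_stat_fun g p B mB).
  under eq_fun do rewrite stat_fun0 //; exact: integrable_mean_sum.
rewrite /mean_sum; transitivity (\int[P]_om stat_fun g p B (mpp_count (shift_mpp x X) om)).
  by apply: eq_Rintegral => om _; rewrite stat_funx.
by rewrite e; apply: eq_Rintegral => om _; rewrite stat_fun0.
Qed.

Lemma pair_sum_shift (g : bool * bool -> bool) (p : R) (g' : bool * bool -> bool) (p' : R) (a m : site) :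
  \int[P]_om ((\sum_(y <- cpoints a om) centered g p y) *
              (\sum_(y <- cpoints (a + m) om) centered g' p' y)) =
  \int[P]_om ((\sum_(y <- cpoints 0 om) centered g p y) *
              (\sum_(y <- cpoints m om) centered g' p' y)).
Proof.
pose f mu := stat_fun g p (cell 0) mu * stat_fun g' p' (cell m) mu.
have mc b := measurable_cell (R := R) (d := d) b.
have bc b := bounded_cell (R := R) (d := d) b.
have mf : measurable_fun (setT : set (g_sigma_algebraType (conf_generators (d := d) (M := M)))) f.
  by apply: measurable_funM; exact: measurable_stat_fun.
have f0 om : f (mpp_count X om) = (\sum_(y <- cpoints 0 om) centered g p y) *
              (\sum_(y <- cpoints m om) centered g' p' y).
  by rewrite /f !stat_fun0.
have fx om : f (mpp_count (shift_mpp (site_row a) X) om) =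
   (\sum_(y <- cpoints a om) centered g p y) * (\sum_(y <- cpoints (a + m) om) centered g' p' y).
  by rewrite /f !stat_funx // -!cell_shift addr0.
have [|_ e] := stationary_integral P X X_mpp X_stationary (site_row a) f mf.
  have [m0 m00 hm] := cell_moment P X X_mpp X_stationary C C' bC bC' q q0 X_moment.
  have [i2 _] := integrable_size2 P cpoints (random_list_cell_points X X_mpp C C' bC bC') q m0 q4 hm 0 m.
  apply: (integrableR_le _ _ (fun om => (1 + `|p|) * (1 + `|p'|) *
      ((size (cpoints 0 om))%:R * (size (cpoints m om))%:R))).
  - exact: (measurableT_comp mf (measurable_count X X_mpp)).
  - move=> om; rewrite f0 normrM mulrACA; apply: ler_pM => //;
    by apply: norm_sum_le_size => y; exact: centered_le.
  - exact: integrableRZ.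
transitivity (\int[P]_om f (mpp_count (shift_mpp (site_row a) X) om)).
  by apply: eq_Rintegral => om _; rewrite fx.
by rewrite e; apply: eq_Rintegral => om _; rewrite f0.
Qed.

(* Two translation invariant set functions are proportional: evaluate the
   double sum of [1_D (x' - x)] over [x] and [x' \in B] in both orders, [D] being
   a unit cell. *)
Lemma mean_sum_eq0 (g : bool * bool -> bool) (p : R) (B : set E) :
  0 < mean_sum (fun=> true) 0 (cell 0) -> mean_sum g p (cell 0) = 0 ->
  measurable B -> bounded_tuples B -> mean_sum g p B = 0.
Proof.
move=> L0 V0 mB bB.
pose D := cell (R := R) (0 : site).
have mD : measurable D := measurable_cell 0.
have bD : bounded_tuples D := bounded_cell 0.
pose subt (t t' : E) := shift_tuple (row_of_tuple t') t.
pose oppt (t : E) : E := tuple_of_row (- row_of_tuple t).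
have subtE t t' i : tnth (subt t t') i = tnth t i - tnth t' i.
  by rewrite tnth_shift_tuple mxE.
have opptE t i : tnth (oppt t) i = - tnth t i by rewrite tnth_mktuple !mxE.
have moppt : measurable_fun setT oppt.
  apply/measurable_fun_tnthP => i; rewrite (_ : _ \o _ = fun t : E => - tnth t i).
    by apply: measurableT_comp => //; exact: measurable_tnth.
  by apply/funext => t; rewrite /= opptE.
have msubt (dT : measure_display) (T : measurableType dT) (f f' : T -> E) :
    measurable_fun setT f -> measurable_fun setT f' -> measurable_fun setT (fun x => subt (f x) (f' x)).
  move=> mf mf'; apply/measurable_fun_tnthP => i.
  rewrite (_ : _ \o _ = fun x => tnth (f x) i - tnth (f' x) i).
    apply: measurable_funB; [exact: (measurableT_comp (measurable_tnth i) mf)|].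
    exact: (measurableT_comp (measurable_tnth i) mf').
  by apply/funext => t; rewrite /= subtE.
have mpre (dT : measure_display) (T : measurableType dT) (f : T -> E) (A : set E) :
   measurable_fun setT f -> measurable A -> measurable_fun setT (fun x => \1_A (f x) : R).
  by move=> mf mA; apply: (measurableT_comp _ mf); exact: measurable_indic.
have ind1 (A : set E) t : `|\1_A t : R| <= 1 by rewrite indicE ger0_norm //; case: (_ \in _).
(* The points [x] and [x'] are taken from two independent copies of the process, so that the double
   sum may be integrated in either order. *)
have key (A : set E) : measurable A -> bounded_tuples A ->
   mean_sum g p [set t | D (oppt t)] * mean_sum (fun=> true) 0 A =
   mean_sum g p A * mean_sum (fun=> true) 0 D.
  move=> mA [r hr].
  (* This cube contains every [x] for which [x' - x] lies in [D] for some [x'] in [A], and every [x]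
     for which [x' + x] lies in [A] for some [x'] in [D]; restricting to it makes all sums finite
     without losing a term. *)
  pose W : set E := [set t | forall i, `|tnth t i| <= r + 1].
  have bW : bounded_tuples W by exists (r + 1) => t.
  have mW : measurable W.
    rewrite (_ : W = \bigcap_(i in [set: 'I_d]) ((fun t : E => tnth t i) @^-1` [set x | `|x| <= r + 1])).
      apply: fin_bigcap_measurable => // i _.
      rewrite -[X in measurable X]setTI; apply: measurable_tnth => //.
      rewrite (_ : [set x | `|x| <= r + 1] = `[-(r + 1), r + 1]%classic); first exact: measurable_itv.
      by apply/seteqP; split=> x /=; rewrite in_itv /= ler_norml.
    by apply/seteqP; split=> t h i; [move=> _; exact: h|exact: (h i I)].
  have bA : bounded_tuples A by exists r.
  have rl B' (mB' : measurable B') bB' := random_list_points_in X X_mpp C C' bC bC' B' mB' bB'.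
  have iW := integrable_points_size _ mW bW.
  have iA := integrable_points_size _ mA bA.
  have iD := integrable_points_size _ mD bD.
  pose c := 1 + `|p|.
  have mfst : measurable_fun setT (fun z : Y * Y => z.1.1) by exact: (measurableT_comp measurable_fst measurable_fst).
  have msnd : measurable_fun setT (fun z : Y * Y => z.2.1) by exact: (measurableT_comp measurable_fst measurable_snd).
  have mphi : measurable_fun setT (fun z : Y * Y => centered g p z.1).
    exact: (measurableT_comp (measurable_centered g p) measurable_fst).
  pose h1 (z : Y * Y) : R := \1_D (subt z.2.1 z.1.1) * centered g p z.1.
  pose addt (t t' : E) := subt t (oppt t').
  have addtE t t' i : tnth (addt t t') i = tnth t i + tnth t' i.
    by rewrite subtE opptE opprK.
  pose h2 (z : Y * Y) : R := \1_A (addt z.2.1 z.1.1) * centered g p z.1.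
  have mh1 : measurable_fun setT h1 by apply: measurable_funM => //; apply: mpre => //; exact: msubt.
  have mh2 : measurable_fun setT h2.
    apply: measurable_funM => //; apply: mpre => //; apply: msubt => //.
    exact: (measurableT_comp moppt).
  have hc1 z : `|h1 z| <= c by rewrite normrM -[c]mul1r ler_pM // centered_le.
  have hc2 z : `|h2 z| <= c by rewrite normrM -[c]mul1r ler_pM // centered_le.
  have R1 := Rint_pair_sum1 P _ (rl W mW bW) _ (rl A mA bA) iW iA h1 c mh1 hc1.
  have R2 := Rint_pair_sum2 P _ (rl W mW bW) _ (rl A mA bA) iW iA h1 c mh1 hc1.
  have S1 := Rint_pair_sum1 P _ (rl W mW bW) _ (rl D mD bD) iW iD h2 c mh2 hc2.
  have S2 := Rint_pair_sum2 P _ (rl W mW bW) _ (rl D mD bD) iW iD h2 c mh2 hc2.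
  have Lam (A' : set E) : measurable A' -> bounded_tuples A' ->
      mean_sum (fun=> true) 0 A' = \int[P]_om (size (points A' om))%:R.
    move=> mA' bA'; apply: eq_Rintegral => om _; rewrite /centered /=.
    by rewrite subr0 big_const_seq iter_addr addr0 count_predT.
  have restr (A' : set E) (f : Y -> R) (B' : set E) : measurable A' -> measurable B' -> bounded_tuples B' ->
      A' `<=` B' -> \int[P]_om \sum_(y <- points B' om) \1_A' y.1 * f y = \int[P]_om \sum_(y <- points A' om) f y.
    move=> mA' mB' bB' AB'; apply: eq_Rintegral => om _.
    by rewrite (sum_points_in_sub X X_mpp C C' A' B' f om mA' mB' bB' AB').
  have mDo : measurable [set t | D (oppt t)].
    by rewrite -[X in measurable X]setTI; exact: moppt.
  have bDo : bounded_tuples [set t | D (oppt t)].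
    exists 1 => t /= Dt i; have := Dt i; rewrite ffunE opptE; exact: unit_opp_le.
  have E2 : \int[P]_om' \sum_(y' <- points A om') \int[P]_om \sum_(y <- points W om) h1 (y, y') =
     mean_sum g p [set t | D (oppt t)] * mean_sum (fun=> true) 0 A.
    rewrite (Lam _ mA bA) -(RintZ P _ _ iA); apply: eq_Rintegral => om' _.
    rewrite -[(size _)%:R]mulr1 mulr_natl -[X in _ *+ X]count_predT -[_ *+ _]addr0 -iter_addr -big_const_seq mulr_sumr.
    rewrite big_seq [RHS]big_seq; apply: eq_bigr => y' yA.
    have Ay' : A y'.1 by exact: (points_in_window X X_mpp C C' A mA bA om' y' yA).
    rewrite mulr1 -(mean_sum_shift (row_of_tuple y'.1) g p _ mDo bDo) /mean_sum.
    pose DD : set E := shift_tuple (row_of_tuple y'.1) @^-1` [set t | D (oppt t)].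
    have mDD : measurable DD by exact: measurable_shift_preimage.
    have DW : DD `<=` W.
      move=> t /= h i; have := h i; rewrite ffunE opptE tnth_shift_tuple mxE => hi.
      exact: unit_sub_le hi (hr _ Ay' i).
    rewrite -(restr DD _ W mDD mW bW DW); apply: eq_Rintegral => om _.
    apply: eq_bigr => y _; rewrite /h1 /=; congr (_ * _); rewrite !indicE; congr (_ %:R); congr nat_of_bool.
    have e : subt y'.1 y.1 = oppt (shift_tuple (row_of_tuple y'.1) y.1).
      by apply: eq_from_tnth => i; rewrite subtE opptE tnth_shift_tuple mxE opprB.
    by apply/idP/idP => /set_mem hD; apply/mem_set; move: hD; rewrite /DD /= e.
  (* For fixed [x], the translation by [x] takes the points of [A] with difference in [D] to the
     points of [D] whose translate is in [A], and the intensity measure does not change. *)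
  have E12 : \int[P]_om \sum_(y <- points W om) \int[P]_om' \sum_(y' <- points A om') h1 (y, y') =
     \int[P]_om \sum_(y <- points W om) \int[P]_om' \sum_(y' <- points D om') h2 (y, y').
    apply: eq_Rintegral => om _; apply: eq_bigr => y _.
    pose A1 : set E := A `&` [set t | D (subt t y.1)].
    pose A2 : set E := D `&` [set t | A (addt t y.1)].
    have mA1 : measurable A1.
      apply: measurableI => //; rewrite -[X in measurable X]setTI.
      by apply: (msubt _ _ id (fun=> y.1)).
    have mA2 : measurable A2.
      apply: measurableI => //; rewrite -[X in measurable X]setTI.
      by apply: (msubt _ _ id (fun=> oppt y.1)).
    have bA1 : bounded_tuples A1 by exists r => t [/hr].
    have bA2 : bounded_tuples A2 by have [r' hr'] := bD; exists r' => t [/hr'].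
    have e1 : \int[P]_om' \sum_(y' <- points A om') h1 (y, y') =
       centered g p y * mean_sum (fun=> true) 0 A1.
      rewrite (Lam _ mA1 bA1) -RintZ; last exact: integrable_points_size.
      apply: eq_Rintegral => om' _.
      rewrite -[(size _)%:R]mulr1 mulr_natl -[X in _ *+ X]count_predT -[_ *+ _]addr0 -iter_addr -big_const_seq mulr_sumr.
      rewrite (sum_points_in_sub X X_mpp C C' A1 A _ om' mA1 mA bA); last by move=> t [].
      rewrite big_seq [RHS]big_seq; apply: eq_bigr => y' yA.
      have Ay' : A y'.1 by exact: (points_in_window X X_mpp C C' A mA bA om' y' yA).
      rewrite /h1 /= mulr1; congr (_ * _); rewrite !indicE; congr (_ %:R); congr nat_of_bool.
      by apply/idP/idP => /set_mem h; apply/mem_set; [split|case: h].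
    have e2 : \int[P]_om' \sum_(y' <- points D om') h2 (y, y') =
       centered g p y * mean_sum (fun=> true) 0 A2.
      rewrite (Lam _ mA2 bA2) -RintZ; last exact: integrable_points_size.
      apply: eq_Rintegral => om' _.
      rewrite -[(size _)%:R]mulr1 mulr_natl -[X in _ *+ X]count_predT -[_ *+ _]addr0 -iter_addr -big_const_seq mulr_sumr.
      rewrite (sum_points_in_sub X X_mpp C C' A2 D _ om' mA2 mD bD); last by move=> t [].
      rewrite big_seq [RHS]big_seq; apply: eq_bigr => y' yD.
      have Dy' : D y'.1 by exact: (points_in_window X X_mpp C C' D mD bD om' y' yD).
      rewrite /h2 /= mulr1; congr (_ * _); rewrite !indicE; congr (_ %:R); congr nat_of_bool.
      by apply/idP/idP => /set_mem h; apply/mem_set; [split|case: h].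
    rewrite e1 e2; congr (_ * _).
    rewrite -(mean_sum_shift (row_of_tuple y.1) (fun=> true) 0 A2 mA2 bA2); congr mean_sum.
    apply/seteqP; split=> t /=; rewrite /A1 /A2 /=.
      move=> [At Dt]; split => //; rewrite (_ : addt _ _ = t) //.
      by apply: eq_from_tnth => i; rewrite addtE tnth_shift_tuple mxE subrK.
    move=> [Dt At]; split => //; rewrite (_ : addt _ _ = t) // in At.
    by apply: eq_from_tnth => i; rewrite addtE tnth_shift_tuple mxE subrK.
  have E3 : \int[P]_om' \sum_(y' <- points D om') \int[P]_om \sum_(y <- points W om) h2 (y, y') =
     mean_sum g p A * mean_sum (fun=> true) 0 D.
    rewrite (Lam _ mD bD) -(RintZ P _ _ iD); apply: eq_Rintegral => om' _.
    rewrite -[(size _)%:R]mulr1 mulr_natl -[X in _ *+ X]count_predT -[_ *+ _]addr0 -iter_addr -big_const_seq mulr_sumr.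
    rewrite big_seq [RHS]big_seq; apply: eq_bigr => y' yD.
    have Dy' : D y'.1 by exact: (points_in_window X X_mpp C C' D mD bD om' y' yD).
    rewrite mulr1 -(mean_sum_shift (- row_of_tuple y'.1) g p _ mA bA) /mean_sum.
    pose AA : set E := shift_tuple (- row_of_tuple y'.1) @^-1` A.
    have mAA : measurable AA by exact: measurable_shift_preimage.
    have AW : AA `<=` W.
      move=> t /= h i; have := hr _ h i; rewrite tnth_shift_tuple !mxE opprK.
      by have := Dy' i; rewrite ffunE; exact: unit_add_le.
    rewrite -(restr AA _ W mAA mW bW AW); apply: eq_Rintegral => om _.
    apply: eq_bigr => y _; rewrite /h2 /=; congr (_ * _); rewrite !indicE; congr (_ %:R); congr nat_of_bool.
    have e : addt y'.1 y.1 = shift_tuple (- row_of_tuple y'.1) y.1.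
      by apply: eq_from_tnth => i; rewrite addtE tnth_shift_tuple !mxE opprK addrC.
    by apply/idP/idP => /set_mem hD; apply/mem_set; move: hD; rewrite /AA /= e.
  by rewrite -E2 -R2 R1 E12 -S1 S2 E3.
(* The choice [A = D] shows that the signed measure vanishes on the reflected cell [- D], which is
   the factor that appears for a general set. *)
have k0 := key D mD bD.
rewrite V0 mul0r in k0.
have L1 : mean_sum (fun=> true) 0 D != 0 := lt0r_neq0 L0.
have VD0 : mean_sum g p [set t | D (oppt t)] = 0.
  by move/eqP: k0; rewrite mulf_eq0 (negbTE L1) orbF => /eqP.
have := key B mB bB; rewrite VD0 mul0r => /esym/eqP.
by rewrite mulf_eq0 (negbTE L1) orbF => /eqP.
Qed.

End mean_measure.

(** * Volumes, convex bodies and the number of cells in a window *)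

Section lebesgue_affine.
Context {R : realType}.
Local Notation leb := (@lebesgue_measure R).
Variables (r x : R) (r0 : 0 < r).

Let g (h : measurableTypeR R) : measurableTypeR R := r * h + x.

Let mg : measurable_fun setT g.
Proof. by apply: measurable_funD => //; exact: measurable_funM. Qed.

Let pf : {measure set (measurableTypeR R) -> \bar R} :=
  measure_function_pushforward__canonical__measure_function_Measure leb mg.

Let sc : {nonneg R} := NngNum (ltW r0).

Let lebE (A : set R) : measurable A -> leb A = mscale sc pf A.
Proof.
apply: (lebesgue_measure_unique (mu := mscale sc pf)) => _ [[a b] /= _ <-].
rewrite /mscale /= /pushforward.
have -> : g @^-1` `]a, b] = `](a - x) / r, (b - x) / r]%classic.
  apply/seteqP; split=> y; rewrite /g /= !in_itv /=;
    by rewrite ltr_pdivrMr // ler_pdivlMr // ltrBlDr lerBrDr (mulrC y).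
rewrite !lebesgue_measure_itv /= !lte_fin ltr_pM2r ?invr_gt0 // ltrD2r.
case: ifP => _; last by rewrite mule0.
by rewrite -!EFinD -EFinM; congr EFin; field; rewrite gt_eqF.
Qed.

Lemma lebesgue_affine (phi : measurableTypeR R -> \bar R) : measurable_fun setT phi -> (forall h, 0 <= phi h)%E ->
  (\int[leb]_h phi h = r%:E * \int[leb]_h phi (r * h + x)%R)%E.
Proof.
move=> mphi phi0.
rewrite (eq_measure_integral (mscale sc pf)); last by move=> A mA _; exact: lebE.
rewrite ge0_integral_mscale //=; congr (_ * _)%E.
by rewrite (ge0_integral_pushforward mg).
Qed.

End lebesgue_affine.

Section tuple_volume.
Context {R : realType}.
Local Notation leb := (@lebesgue_measure R).

Lemma lebesgue_tupleS n (A : set (n.+1.-tuple (measurableTypeR R))) : measurable A ->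
  (lebesgue_tuple R n.+1 A = \int[leb]_h lebesgue_tuple R n [set v | A (tcons (h, v))])%E.
Proof.
move=> mA.
rewrite /= /cons_measure /pushforward.
rewrite [LHS]/product_measure1 /=; apply: eq_integral => h _; congr (lebesgue_tuple R n _).
by apply/seteqP; split=> v; rewrite /xsection /= ?inE.
Qed.

Definition affine_tuple n (r : R) (x : 'I_n -> R) (t : n.-tuple (measurableTypeR R)) :
  n.-tuple (measurableTypeR R) := [tuple r * tnth t i + x i | i < n].

Lemma measurable_affine_tuple n r x : measurable_fun setT (affine_tuple n r x).
Proof.
apply/measurable_fun_tnthP => i.
rewrite (_ : _ \o _ = fun t : n.-tuple (measurableTypeR R) => r * tnth t i + x i); last first.
  by apply/funext => t; rewrite /= tnth_mktuple.
by apply: measurable_funD => //; apply: measurable_funM => //; exact: measurable_tnth.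
Qed.

Lemma measurable_tconsR n h : measurable_fun setT
  (fun v : n.-tuple (measurableTypeR R) => tcons (h, v)).
Proof. exact: (@measurable_cons _ _ _ _ (fun=> h) n id). Qed.

(** Induction on the dimension: the volume is an integral of volumes of sections, and the
    one-dimensional change of variable is applied to the first coordinate. *)
Lemma lebesgue_tuple_affine n (r : R) (x : 'I_n -> R) (A : set (n.-tuple (measurableTypeR R))) :
  0 < r -> measurable A ->
  (lebesgue_tuple R n A = (r ^+ n)%:E * lebesgue_tuple R n (affine_tuple _ r x @^-1` A))%E.
Proof.
move=> r0; elim: n x A => [|n IH] x A mA.
  rewrite expr0 mul1e; congr (lebesgue_tuple R 0 _).
  by apply/seteqP; split=> t; rewrite /= !(tuple0 (affine_tuple _ _ _ _), tuple0 t).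
have mS h : measurable [set v | A (tcons (h, v))].
  by rewrite -[X in measurable X]setTI; exact: measurable_tconsR.
have mB : measurable (affine_tuple _ r x @^-1` A).
  by rewrite -[X in measurable X]setTI; exact: measurable_affine_tuple.
pose x' i := x (lift ord0 i).
have E h v : affine_tuple _ r x (tcons (h, v)) = tcons (r * h + x ord0, affine_tuple _ r x' v).
  apply: eq_from_tnth => i; rewrite tnth_mktuple.
  have [->|i0] := eqVneq i ord0; first by rewrite !tnth0.
  by case: (unliftP ord0 i) i0 => [j ->|-> /eqP//] _; rewrite !tnthS tnth_mktuple.
have mphi B : measurable B -> measurable_fun (setT : set (measurableTypeR R))
    (fun h => lebesgue_tuple R n [set v | B (tcons (h, v))]).
  move=> mB'; have mt : measurable (tcons (n := n) @^-1` B : set (measurableTypeR R * _)).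
    by rewrite -[X in measurable X]setTI; exact: (@measurable_cons _ _ _ _ fst n snd).
  have := measurable_fun_xsection (lebesgue_tuple R n) mt.
  apply: eq_measurable_fun => h _; congr (lebesgue_tuple R n _).
  by apply/seteqP; split=> v; rewrite /xsection /= ?inE.
rewrite !lebesgue_tupleS // (lebesgue_affine r (x ord0) r0) //; last exact: mphi.
rewrite exprS EFinM -muleA; congr (_ * _)%E.
rewrite -ge0_integralZl //; last 2 first.
- exact: mphi.
- by rewrite lee_fin exprn_ge0 // ltW.
apply: eq_integral => h _; rewrite (IH x') //; congr (_ * _)%E; congr (lebesgue_tuple R n _).
by apply/seteqP; split=> v; rewrite /= E.
Qed.

Lemma lebesgue_tuple_unit_box n (c : 'I_n -> R) :
  lebesgue_tuple R n [set t | forall i, c i <= tnth t i < c i + 1] = 1%E.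
Proof.
elim: n c => [|n IH] c.
  rewrite /= (_ : [set _ | _] = setT) ?diracT //.
  by apply/seteqP; split=> // t _ [].
pose I0 : set (measurableTypeR R) := `[c ord0, c ord0 + 1[%classic.
pose c' i := c (lift ord0 i).
have mC k (e : 'I_k -> R) : measurable [set t : k.-tuple (measurableTypeR R) | forall i, e i <= tnth t i < e i + 1].
  rewrite (_ : [set _ | _] = \bigcap_(i in [set: 'I_k])
     ((fun t : k.-tuple (measurableTypeR R) => tnth t i) @^-1` [set` `[e i, e i + 1[])); last first.
    apply/seteqP; split=> t h i; first by move=> _ /=; rewrite in_itv; exact: h.
    by have := h i I; rewrite /= in_itv.
  apply: fin_bigcap_measurable => // i _.
  by rewrite -[X in measurable X]setTI; apply: measurable_tnth.
rewrite [LHS](_ : _ = (leb \x lebesgue_tuple R n)%E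
   (I0 `*` [set t | forall i, c' i <= tnth t i < c' i + 1])); last first.
  rewrite /= /cons_measure /pushforward; congr (_ _).
  apply/seteqP; split=> -[h v] /=.
    move=> H; split; first by rewrite /I0 /= in_itv /=; have := H ord0; rewrite tnth0.
    by move=> i; have := H (lift ord0 i); rewrite tnthS.
  move=> [h1 h2] i; case: (unliftP ord0 i) => [j ->|->]; first by rewrite tnthS; exact: h2.
  by rewrite tnth0; move: h1; rewrite /I0 /= in_itv.
rewrite product_measure1E; [|exact: measurable_itv|exact: mC].
have lI0 : leb I0 = 1%E.
  rewrite /I0 lebesgue_measure_itv /= lte_fin ltrDl ltr01.
  by rewrite -EFinD addrAC subrr add0r.
by rewrite IH mule1.
Qed.

End tuple_volume.

Section euclidean_norm.
Context {R : realType} {d : nat}.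
Implicit Types v w c : 'rV[R]_d.

Lemma enorm_ge0 v : 0 <= enorm v. Proof. exact: sqrtr_ge0. Qed.

Lemma enormZ s v : enorm (s *: v) = `|s| * enorm v.
Proof.
rewrite /enorm (eq_bigr (fun i => s ^+ 2 * v ord0 i ^+ 2)); last first.
  by move=> i _; rewrite mxE exprMn.
by rewrite -mulr_sumr sqrtrM ?sqr_ge0 // sqrtr_sqr.
Qed.

Lemma enorm_coord v i : `|v ord0 i| <= enorm v.
Proof.
rewrite -sqrtr_sqr ler_wsqrtr // (bigD1 i) //= lerDl sumr_ge0 // => j _.
exact: sqr_ge0.
Qed.

Lemma enorm_le v (r : R) : 0 <= r -> (forall i, `|v ord0 i| <= r) -> enorm v <= d%:R * r.
Proof.
move=> r0 h.
rewrite -(ler_sqr (enorm_ge0 _)); last by rewrite nnegrE mulr_ge0.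
rewrite sqr_sqrtr; last by apply: sumr_ge0 => i _; exact: sqr_ge0.
apply: (@le_trans _ _ (\sum_(i < d) r ^+ 2)).
  by apply: ler_sum => i _; rewrite -real_normK ?num_real // lerXn2r ?nnegrE.
rewrite sumr_const card_ord -[leLHS]mulr_natl exprMn ler_wpM2r ?sqr_ge0 //.
by rewrite -natrX ler_nat; case: (d) => // k; rewrite expnS expn1 leq_pmulr.
Qed.

Lemma enorm_eq0 v : enorm v <= 0 -> v = 0.
Proof.
move=> h; apply/rowP => i; rewrite mxE; apply/eqP; rewrite -normr_le0.
exact: le_trans (enorm_coord v i) h.
Qed.

End euclidean_norm.

Section convex_bodies.
Context {R : realType} {d : nat}.
Local Notation E := (d.-tuple (measurableTypeR R)).
Local Notation mu := (lebesgue_tuple R d).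
Local Notation site := {ffun 'I_d -> int}.
Implicit Types (W : set 'rV[R]_d) (c v w x y : 'rV[R]_d).

Definition tupset W : set E := [set t | W (row_of_tuple t)].

Lemma volE W : vol W = fine (mu (tupset W)). Proof. by []. Qed.

Lemma lebesgue_cell (a : site) : mu (cell a) = 1%E.
Proof. exact: (lebesgue_tuple_unit_box d (fun i => (a i)%:~R)). Qed.

Lemma lebesgue_cells (T : seq site) : uniq T ->
  mu (\bigcup_(a in [set` T]) cell a) = (size T)%:R%:E.
Proof.
move=> uT; rewrite measure_fin_bigcup.
- rewrite (eq_fsbigr (fun=> 1%:E)); last by move=> a _; exact: lebesgue_cell.
  rewrite (fsbigE T) //; last by move=> a Ta /negP nTa; exfalso; apply: nTa.
  rewrite big_mkcond big_seq (eq_bigr (fun=> 1%:E)); last first.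
    by move=> a aT; rewrite ifT // inE.
  by rewrite -big_seq sumEFin big_const_seq iter_addr addr0 count_predT.
- exact: finite_seq.
- by move=> a b _ _ [t [/cell_inj -> /cell_inj ->]].
- by move=> a _; exact: measurable_cell.
Qed.

Lemma lebesgue_bounded (B : set E) : measurable B -> bounded_tuples B -> (mu B < +oo)%E.
Proof.
move=> mB /bounded_box_regionP[n Bn].
apply: (@le_lt_trans _ _ (mu (box_region n))).
  by apply: le_measure; rewrite ?inE //; exact: measurable_box_region.
by rewrite box_regionE lebesgue_cells ?box_uniq // ltry.
Qed.

Section body.
Variables (W : set 'rV[R]_d) (cW : closed W) (bW : bounded_tuples (tupset W)).
Hypothesis (convW : convex_set (W : set (convex_lmodType 'rV[R]_d))).

Lemma convexP x y (s : R) : 0 <= s <= 1 -> W x -> W y -> W (s *: x + (1 - s) *: y).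
Proof.
move=> s01 Wx Wy; have := convW x y (Itv01 (proj1 (andP s01)) (proj2 (andP s01))).
by rewrite !inE => /(_ Wx Wy).
Qed.

Lemma measurable_tupset : measurable (tupset W).
Proof. exact: measurable_closed_tuple. Qed.

(** For [s > 0] this is the body [s W + c], written as a preimage. *)
Definition dilate (s : R) c : set 'rV[R]_d := [set y | W (s^-1 *: (y - c))].

Lemma dilate_affine (s : R) c : 0 < s ->
  tupset (dilate s c) = affine_tuple d s^-1 (fun i => - (s^-1 * c ord0 i)) @^-1` tupset W.
Proof.
move=> s0; apply/seteqP; split=> t; rewrite /tupset /dilate /=; congr W;
  by apply/rowP => i; rewrite !mxE tnth_mktuple mulrBr.
Qed.

Lemma measurable_dilate (s : R) c : 0 < s -> measurable (tupset (dilate s c)).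
Proof.
move=> s0; rewrite dilate_affine // -[X in measurable X]setTI.
by apply: measurable_affine_tuple => //; exact: measurable_tupset.
Qed.

Lemma bounded_dilate (s : R) c : 0 < s -> bounded_tuples (tupset (dilate s c)).
Proof.
move=> s0; have [r hr] := bW; exists (s * r + `|c|) => t Wt i.
have := hr (tuple_of_row (s^-1 *: (row_of_tuple t - c))).
rewrite /tupset /= tuple_of_rowK => /(_ Wt i); rewrite tnth_mktuple !mxE => h.
have -> : tnth t i = s * (s^-1 * (tnth t i - c ord0 i)) + c ord0 i.
  by rewrite mulrA mulfV ?gt_eqF // mul1r subrK.
apply: (le_trans (ler_normD _ _)); rewrite lerD ?row_coord_le //.
by rewrite normrM gtr0_norm // ler_pM2l.
Qed.

Lemma vol_dilate (s : R) c : 0 < s -> vol (dilate s c) = s ^+ d * vol W.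
Proof.
move=> s0; rewrite !volE.
rewrite (lebesgue_tuple_affine d s^-1 (fun i => - (s^-1 * c ord0 i)) (tupset W)) ?invr_gt0 //; last first.
  exact: measurable_tupset.
rewrite -dilate_affine // fineM //=.
  by rewrite mulrA -exprMn mulfV ?gt_eqF // expr1n mul1r.
rewrite ge0_fin_numE //; apply: lebesgue_bounded; first exact: measurable_dilate.
exact: bounded_dilate.
Qed.

Section ball.
Variables (c : 'rV[R]_d) (rho : R) (rho0 : 0 < rho).
Hypothesis ballW : closed_eball c rho `<=` W.

Let Wc v (t : R) : 0 < t -> enorm v <= t * rho -> W (c + t^-1 *: v).
Proof.
move=> t0 h; apply: ballW; rewrite /closed_eball /= addrAC subrr add0r.
by rewrite enormZ gtr0_norm ?invr_gt0 // mulrC ler_pdivrMr // mulrC.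
Qed.

(** If [y = (1 - t) x + t c] with [x] in [W], then [y + v] is the convex combination of [x] and
    [c + v / t], the latter in the inscribed ball. *)
Lemma dilate_inner (t : R) y v : 0 <= t -> t < 1 -> enorm v <= t * rho ->
  dilate (1 - t) (t *: c) y -> W (y + v).
Proof.
move=> t0 t1 hv; rewrite /dilate /= => Wy.
have s0 : 0 < 1 - t by rewrite subr_gt0.
have [te0|tn0] := eqVneq t 0.
  move: Wy; rewrite te0 subr0 scale0r subr0 invr1 scale1r.
  by rewrite (enorm_eq0 v) ?addr0 //; move: hv; rewrite te0 mul0r.
have tp : 0 < t by rewrite lt_neqAle eq_sym tn0.
have := convexP _ _ t _ (Wc v t tp hv) Wy; rewrite t0 ltW // => /(_ isT).
rewrite scalerDr !scalerA divff // scale1r mulfV ?gt_eqF // scale1r.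
by rewrite addrC addrA subrK.
Qed.

(** The point [(y + v + t c) / (1 + t)] is a convex combination of [y] and of the point [c + v / t]
    of the inscribed ball. *)
Lemma dilate_outer (t : R) y v : 0 <= t -> enorm v <= t * rho ->
  W y -> dilate (1 + t) (- (t *: c)) (y + v).
Proof.
move=> t0 hv Wy; rewrite /dilate /=.
have s0 : 0 < 1 + t by rewrite ltr_pwDl.
have [te0|tn0] := eqVneq t 0.
  rewrite te0 addr0 scale0r oppr0 subr0 invr1 scale1r.
  by rewrite (enorm_eq0 v) ?addr0 //; move: hv; rewrite te0 mul0r.
have tp : 0 < t by rewrite lt_neqAle eq_sym tn0.
have := convexP _ _ (t / (1 + t)) _ (Wc v t tp hv) Wy.
rewrite divr_ge0 ?(ltW s0) // ler_pdivrMr // mul1r lerDr ler01 => /(_ isT).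
congr W.
have -> : 1 - t / (1 + t) = (1 + t)^-1 by field; rewrite gt_eqF.
rewrite opprK -[t / (1 + t)]mulrC -scalerA -scalerDr; congr (_ *: _).
by rewrite scalerDr scalerA divff // scale1r addrC addrA addrAC.
Qed.

(** The shrunken body [(1 - t) W + t c - x] lies in [W - x], and also in [W - y], because [y - x] is
    shorter than [t] times the radius of the inscribed ball. Its volume is [(1 - t) ^ d] times that
    of [W]. *)
Lemma vol_translate_cap x y (t : R) : 0 <= t -> t < 1 -> enorm (y - x) <= t * rho ->
  (1 - t) ^+ d * vol W <= vol (translate W x `&` translate W y) <= vol W.
Proof.
move=> t0 t1 hxy; have s0 : 0 < 1 - t by rewrite subr_gt0.
have trE z : translate W z = dilate 1 (- z).
  apply/seteqP; split=> u; rewrite /translate /dilate /= invr1 scale1r opprK.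
    by move=> [w Ww <-]; rewrite subrK.
  by move=> Wu; exists (u + z) => //; rewrite addrK.
have mtr z : measurable (tupset (translate W z)).
  by rewrite trE; apply: measurable_dilate.
have btr z : bounded_tuples (tupset (translate W z)).
  by rewrite trE; apply: bounded_dilate.
have mcap : measurable (tupset (translate W x `&` translate W y)).
  exact: (measurableI _ _ (mtr x) (mtr y)).
have bcap : bounded_tuples (tupset (translate W x `&` translate W y)).
  by have [r hr] := btr x; exists r => u [/hr].
have fin B : measurable B -> bounded_tuples B -> mu B \is a fin_num.
  by move=> mB bB; rewrite ge0_fin_numE //; exact: lebesgue_bounded.
apply/andP; split.
  rewrite -(vol_dilate (1 - t) (t *: c - x) s0) !volE.
  have mD := measurable_dilate (1 - t) (t *: c - x) s0.
  have bD := bounded_dilate (1 - t) (t *: c - x) s0.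
  apply: fine_le; rewrite ?fin //; apply: le_measure; rewrite ?inE //.
  move=> u; rewrite /tupset !trE /dilate /= => h.
  have h' : dilate (1 - t) (t *: c) (row_of_tuple u + x).
    by move: h; rewrite /dilate /= opprB addrA addrAC.
  rewrite !invr1 !scale1r !opprK; split.
    have := dilate_inner t _ 0 t0 t1 _ h'; rewrite addr0; apply.
    by rewrite -(scale0r (0 : 'rV[R]_d)) enormZ normr0 mul0r mulr_ge0 // ltW.
  have := dilate_inner t _ _ t0 t1 hxy h'.
  by rewrite -addrA (addrC x) subrK.
have -> : vol W = vol (translate W x) by rewrite trE vol_dilate // expr1n mul1r.
rewrite !volE; apply: fine_le; rewrite ?fin //; apply: le_measure; rewrite ?inE //.
by move=> u [].
Qed.

End ball.
End body.
End convex_bodies.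

Section lattice_cover.
Context {R : realType} {d : nat}.
Local Notation E := (d.-tuple (measurableTypeR R)).
Local Notation mu := (lebesgue_tuple R d).
Local Notation site := {ffun 'I_d -> int}.
Variables (W : set 'rV[R]_d) (cW : closed W) (bW : bounded_tuples (tupset W)).
Hypothesis (convW : convex_set (W : set (convex_lmodType 'rV[R]_d))).
Variables (c : 'rV[R]_d) (rho : R) (rho0 : 0 < rho).
Hypothesis ballW : closed_eball c rho `<=` W.
Variables (n : nat) (Wn : tupset W `<=` box_region n).

Definition hit_sites : seq site :=
  [seq a <- box n | `[< exists t, cell a t /\ tupset W t >]].

(** Sites at which no boundary effect is visible up to lattice distance [k]. *)
Definition inner_sites (k : nat) : seq site :=
  [seq a <- box n | `[< forall m, (site_norm m <= k)%N -> cell (a + m) `<=` tupset W >]].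

Lemma cell_diff (a m : site) (k : nat) (t u : E) : (site_norm m <= k)%N ->
  cell a t -> cell (a + m) u -> forall i, `|tnth u i - tnth t i| <= k%:R + 1.
Proof.
move=> mk at_ au i; have /andP[h1 h2] := at_ i; have := au i; rewrite ffunE intrD => /andP[h3 h4].
have := site_coord_le (R := R) m i; have : (site_norm m)%:R <= k%:R :> R by rewrite ler_nat.
by move=> hk; rewrite !ler_norml => /andP[h5 h6]; apply/andP; split; lra.
Qed.

Let fin B : measurable B -> bounded_tuples B -> mu B \is a fin_num.
Proof. by move=> mB bB; rewrite ge0_fin_numE //; exact: lebesgue_bounded. Qed.

Let mcells (T : seq site) : measurable (\bigcup_(a in [set` T]) cell (R := R) a).
Proof.
by apply: fin_bigcup_measurable => [|a _]; [exact: finite_seq|exact: measurable_cell].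
Qed.

Let enorm_diff (t u : E) (k : nat) : (forall i, `|tnth u i - tnth t i| <= k%:R + 1) ->
  enorm (row_of_tuple u - row_of_tuple t) <= (d%:R * k.+1%:R / rho) * rho.
Proof.
move=> h; rewrite divfK ?gt_eqF //; apply: enorm_le => // i.
by rewrite !mxE -natr1.
Qed.

(** Two points of one cell are at Euclidean distance at most [d], so the disjoint unit cells that
    meet [W] lie in the dilation of [W] by the factor [1 + d / rho]. *)
Lemma hit_sites_size :
  (size hit_sites)%:R <= (1 + d%:R / rho) ^+ d * vol W.
Proof.
pose t := d%:R / rho; have t0 : 0 <= t by rewrite divr_ge0 // ltW.
have s0 : 0 < 1 + t by rewrite ltr_pwDl.
rewrite -/t -(vol_dilate W cW bW (1 + t) (- (t *: c)) s0) volE.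
have mD := measurable_dilate W cW (1 + t) (- (t *: c)) s0.
have bD := bounded_dilate W bW (1 + t) (- (t *: c)) s0.
have -> : (size hit_sites)%:R = fine (mu (\bigcup_(a in [set` hit_sites]) cell a)) :> R.
  by rewrite lebesgue_cells // filter_uniq // box_uniq.
have sub : \bigcup_(a in [set` hit_sites]) cell a `<=` tupset (dilate W (1 + t) (- (t *: c))).
  move=> u [a /=]; rewrite mem_filter => /andP[/asboolP[u' [au' Wu']] _] au.
  rewrite /tupset /= (_ : row_of_tuple u = row_of_tuple u' + (row_of_tuple u - row_of_tuple u')); last by rewrite addrC subrK.
  apply: (dilate_outer W convW c rho ballW) => //.
  have := enorm_diff u' u 0; rewrite mulr1; apply => i.
  have := cell_diff a 0 0 u' u _ au'; rewrite addr0; apply => //.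
  by rewrite site_norm_le; apply/forallP => j; rewrite ffunE.
apply: fine_le; rewrite ?fin //.
  by have [r hr] := bD; exists r => u /sub /hr.
by apply: le_measure; rewrite ?inE.
Qed.

(** With [t = d (k + 1) / rho], a point of the dilation of [W] by [1 - t] stays in [W] after any
    move within [k] cells. Hence the inner cells cover this smaller body. *)
Lemma inner_sites_size (k : nat) : d%:R * k.+1%:R / rho < 1 ->
  (1 - d%:R * k.+1%:R / rho) ^+ d * vol W <= (size (inner_sites k))%:R.
Proof.
pose t := d%:R * k.+1%:R / rho => t1.
have t0 : 0 <= t by rewrite divr_ge0 ?mulr_ge0 // ltW.
have s0 : 0 < 1 - t by rewrite subr_gt0.
rewrite -/t -(vol_dilate W cW bW (1 - t) (t *: c) s0) volE.
have mD := measurable_dilate W cW (1 - t) (t *: c) s0.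
have bD := bounded_dilate W bW (1 - t) (t *: c) s0.
have uI : uniq (inner_sites k) by rewrite filter_uniq // box_uniq.
have -> : (size (inner_sites k))%:R = fine (mu (\bigcup_(a in [set` inner_sites k]) cell a)) :> R.
  by rewrite lebesgue_cells.
have en0 : enorm (0 : 'rV[R]_d) <= t * rho.
  by rewrite -(scale0r (0 : 'rV[R]_d)) enormZ normr0 mul0r mulr_ge0 // ltW.
have sub : tupset (dilate W (1 - t) (t *: c)) `<=` \bigcup_(a in [set` inner_sites k]) cell a.
  move=> u Du; have Wu : tupset W u.
    have := dilate_inner W convW c rho ballW t (row_of_tuple u) 0 t0 t1 en0 Du.
    by rewrite addr0.
  exists (site_of u); last exact: cell_site_of.
  rewrite /= mem_filter; apply/andP; split; last exact: Wn.
  apply/asboolP => m mk u' mu'.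
  rewrite /tupset /= (_ : row_of_tuple u' = row_of_tuple u + (row_of_tuple u' - row_of_tuple u)); last by rewrite addrC subrK.
  apply: (dilate_inner W convW c rho ballW t _ _ t0 t1 _ Du).
  by apply: enorm_diff; exact: cell_diff mk (cell_site_of u) mu'.
apply: fine_le; [exact: fin|by rewrite lebesgue_cells|].
by apply: le_measure; rewrite ?inE.
Qed.

Lemma inner_hit k : {subset inner_sites k <= hit_sites}.
Proof.
move=> a; rewrite !mem_filter => /andP[/asboolP h ->]; rewrite andbT; apply/asboolP.
pose u : E := [tuple (a i)%:~R | i < d].
have au : cell a u by move=> i; rewrite tnth_mktuple lexx ltrDl ltr01.
exists u; split => //; apply: (h 0); last by rewrite addr0.
by rewrite site_norm_le; apply/forallP => j; rewrite ffunE.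
Qed.

End lattice_cover.

Lemma inner_add_hit {R : realType} {d : nat} (W : set 'rV[R]_d) (N : nat)
  (WN : tupset W `<=` box_region N) (n : nat) (a m : {ffun 'I_d -> int}) :
  a \in inner_sites W N n -> (site_norm m <= n)%N -> a + m \in hit_sites W N.
Proof.
rewrite mem_filter => /andP[/asboolP aW _] mn; have sub := aW m mn.
pose u : d.-tuple (measurableTypeR R) := [tuple ((a + m) i)%:~R | i < d].
have au : cell (a + m) u by move=> i; rewrite tnth_mktuple lexx ltrDl ltr01.
rewrite mem_filter; apply/andP; split; first by apply/asboolP; exists u; split => //; exact: sub.
by have := WN _ (sub _ au); rewrite /box_region /= -(cell_inj _ _ au).
Qed.

Lemma cvg_exprn {R : realType} (f : nat -> R) (l : R) n :
  f k @[k --> \oo] --> l -> f k ^+ n @[k --> \oo] --> l ^+ n.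
Proof.
move=> fl; elim: n => [|n IH]; first by under eq_fun do rewrite expr0; exact: cvg_cst.
by under eq_fun do rewrite exprS; rewrite exprS; exact: cvgM.
Qed.

Section site_counts.
Context {R : realType} {d : nat}.
Variables (W : nat -> set 'rV[R]_d) (ctr : nat -> 'rV[R]_d) (rho : nat -> R) (N : nat -> nat).
Hypothesis cW : forall k, closed (W k).
Hypothesis bW : forall k, bounded_tuples (tupset (W k)).
Hypothesis convW : forall k, convex_set (W k : set (convex_lmodType 'rV[R]_d)).
Hypothesis ballW : \forall k \near \oo, 0 < rho k /\ closed_eball (ctr k) (rho k) `<=` W k.
Hypothesis rho_cvg : rho k @[k --> \oo] --> +oo.
Hypothesis v0 : \forall k \near \oo, 0 < vol (W k).
Hypothesis WN : forall k, tupset (W k) `<=` box_region (N k).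

Let ratio_cvg (x : R) : x / rho k @[k --> \oo] --> (0 : R).
Proof.
rewrite -[X in _ --> X](mulr0 x); apply: cvgMr.
apply/gtr0_cvgV0; last exact: rho_cvg.
by near=> k; have [] : 0 < rho k /\ closed_eball (ctr k) (rho k) `<=` W k by near: k.
Unshelve. all: by end_near.
Qed.

Let upper_cvg : (1 + d%:R / rho k) ^+ d @[k --> \oo] --> (1 : R).
Proof.
rewrite -[X in _ --> X](expr1n _ d) -[X in X ^+ d]addr0.
by apply: cvg_exprn; apply: cvgD; [exact: cvg_cst|exact: ratio_cvg].
Qed.

Let lower_cvg n : (1 - d%:R * n.+1%:R / rho k) ^+ d @[k --> \oo] --> (1 : R).
Proof.
rewrite -[X in _ --> X](expr1n _ d) -[X in X ^+ d]subr0.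
by apply: cvg_exprn; apply: cvgB; [exact: cvg_cst|exact: ratio_cvg].
Qed.

Let bounds n : \forall k \near \oo,
  (1 - d%:R * n.+1%:R / rho k) ^+ d <= (size (inner_sites (W k) (N k) n))%:R / vol (W k) /\
  ((size (inner_sites (W k) (N k) n))%:R / vol (W k) <= (size (hit_sites (W k) (N k)))%:R / vol (W k) /\
  (size (hit_sites (W k) (N k)))%:R / vol (W k) <= (1 + d%:R / rho k) ^+ d).
Proof.
have /cvgrPdist_lt /(_ 1 ltr01) small := ratio_cvg (d%:R * n.+1%:R).
near=> k.
have vk : 0 < vol (W k) by near: k.
have [rk bk] : 0 < rho k /\ closed_eball (ctr k) (rho k) `<=` W k by near: k.
have t1 : d%:R * n.+1%:R / rho k < 1.
  have : `|0 - d%:R * n.+1%:R / rho k| < 1 by near: k.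
  by rewrite sub0r normrN; apply: le_lt_trans; exact: ler_norm.
split.
  by rewrite ler_pdivlMr //; exact: (inner_sites_size (W k) (cW k) (bW k) (@convW k) (ctr k) (rho k) rk bk (N k) (@WN k)).
split.
  rewrite ler_pM2r ?invr_gt0 // ler_nat; apply: uniq_leq_size; last exact: inner_hit.
  by rewrite filter_uniq // box_uniq.
by rewrite ler_pdivrMr //; exact: (hit_sites_size (W k) (cW k) (bW k) (@convW k) (ctr k) (rho k) rk bk (N k)).
Unshelve. all: by end_near.
Qed.

Lemma hit_sites_cvg : (size (hit_sites (W k) (N k)))%:R / vol (W k) @[k --> \oo] --> (1 : R).
Proof.
apply: (squeeze_cvgr _ (lower_cvg 0) upper_cvg).
by apply: filterS (bounds 0) => k [h1 [h2 h3]]; rewrite h3 andbT (le_trans h1).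
Qed.

Lemma inner_sites_cvg n : (size (inner_sites (W k) (N k) n))%:R / vol (W k) @[k --> \oo] --> (1 : R).
Proof.
apply: (squeeze_cvgr _ (lower_cvg n) upper_cvg).
by apply: filterS (bounds n) => k [h1 [h2 h3]]; rewrite h1 (le_trans h2).
Qed.

End site_counts.

(** * Means and covariances of pair sums over cells *)

Lemma Rint_prod {d1 d2} {T1 : measurableType d1} {T2 : measurableType d2}
  {R : realType} (P1 : probability T1 R) (P2 : probability T2 R) (f : T1 -> R) (g : T2 -> R) :
  integrableR P1 f -> integrableR P2 g ->
  integrableR (P1 \x P2)%E (fun z => f z.1 * g z.2) /\
  \int[(P1 \x P2)%E]_z (f z.1 * g z.2) = \int[P1]_x f x * \int[P2]_y g y.
Proof.
move=> if_ ig.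
have mf := integrableR_measurable _ _ if_; have mg := integrableR_measurable _ _ ig.
have nf := integrable_norm if_; have ng := integrable_norm ig.
have [ia _] := integrableR_prod P1 P2 _ _ (fun x => normr_ge0 (f x)) (fun y => normr_ge0 (g y)) nf ng.
have i : integrableR (P1 \x P2)%E (fun z => f z.1 * g z.2).
  apply: integrableR_le ia; last by move=> z; rewrite normrM.
  by apply: measurable_funM; exact: measurableT_comp.
split=> //; rewrite Rint_fubini1 //; last by move=> x; exact: (integrableRZ P2 (f x) g ig).
transitivity (\int[P1]_x (\int[P2]_y g y * f x)).
  by apply: eq_Rintegral => x _; rewrite /= RintZ // mulrC.
by rewrite RintZ // mulrC.
Qed.

Lemma cov_gap (L D : nat) : (3 * L + 3 <= D)%N ->
  (L < D - (2 * L + 2))%N /\ (D - (2 * L + 2) + L + 2 + L = D)%N.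
Proof. lia. Qed.

Section pair_terms.
Context {R : realType} {d : nat} {dO dE dB : measure_display} {Omega : measurableType dO}
  {E : measurableType dE} {B : measurableType dB} (P : probability Omega R).
Local Notation Y := (E * B)%type.
Local Notation site := {ffun 'I_d -> int}.
Variables (s : site -> Omega -> seq Y) (rs : forall a, random_list (R := R) (s a)).
Variables (q m : R) (q4 : 4 < q).
Hypothesis mom : forall a, integrableR P (fun om => (size (s a om))%:R `^ q) /\
  \int[P]_om (size (s a om))%:R `^ q = m.
Variables (phi phi' : Y -> R) (c : R) (c0 : 0 < c).
Hypothesis (mphi : measurable_fun setT phi) (mphi' : measurable_fun setT phi').
Hypothesis (phic : forall y, `|phi y| <= c) (phic' : forall y, `|phi' y| <= c).
Variable beta : R -> R.
Hypothesis beta0 : forall n, (0 < n)%N -> 0 <= beta n%:R.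
Hypothesis mixing : forall (a : site) (L n : nat), (L < n)%N ->
  exists F F' : set (set Omega),
  [/\ [/\ sigma_algebra setT F, sigma_algebra setT F', F `<=` measurable & F' `<=` measurable],
      (beta_coef P F F' <= (beta n%:R)%:E)%E,
      forall a', (site_norm (a' - a)%R <= L)%N ->
        random_list (R := R) (T := g_sigma_algebraType (rectangles F F')) (s a' \o fst) &
      forall b, (n + L + 2 <= site_norm (b - a)%R)%N ->
        random_list (R := R) (T := g_sigma_algebraType (rectangles F F')) (s b \o snd)].
Hypothesis mean0 : forall a (u : E -> R) (b : R), measurable_fun setT u ->
  (forall t, `|u t| <= b) -> \int[P]_om (\sum_(y <- s a om) u y.1 * phi' y) = 0.

Implicit Types (h : E * E -> R) (K : R) (a b : site) (z : Y * Y).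

Local Notation N a om := ((size (s a om))%:R : R).
Local Notation th := (1 - 4 / q).

Definition weight (h : E * E -> R) (z : Y * Y) : R := h (z.1.1, z.2.1) * (phi z.1 * phi' z.2).

(** The two lists are read at two outcomes: on the diagonal this is the pair sum of the process,
    under [P \x P] that of two independent copies. *)
Definition pair_term (a b : site) (h : E * E -> R) (x : Omega * Omega) : R :=
  \sum_(y <- s a x.1) \sum_(y' <- s b x.2) weight h (y, y').

Lemma measurable_weight h : measurable_fun setT h -> measurable_fun setT (weight h).
Proof.
move=> mh; apply: measurable_funM.
  apply: (measurableT_comp mh); apply/measurable_fun_pairP; split.
    exact: (measurableT_comp measurable_fst measurable_fst).
  exact: (measurableT_comp measurable_fst measurable_snd).
by apply: measurable_funM; [exact: (measurableT_comp mphi)|exact: (measurableT_comp mphi')].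
Qed.

Lemma weight_le h K z : 0 <= K -> (forall e, `|h e| <= K) -> `|weight h z| <= K * c ^+ 2.
Proof.
move=> K0 hK; rewrite !normrM expr2; apply: ler_pM => //.
by apply: ler_pM.
Qed.

Lemma pair_term_le a b h K x : 0 <= K -> (forall e, `|h e| <= K) ->
  `|pair_term a b h x| <= K * c ^+ 2 * (N a x.1 * N b x.2).
Proof.
move=> K0 hK.
exact: (norm_pair_sum_le (s a) (s b) (weight h) (K * c ^+ 2) (fun z => weight_le h K z K0 hK) x).
Qed.

Lemma measurable_pair_term_gen {dT} {T : measurableType dT} (f g : T -> Omega) a b h :
  random_list (R := R) (s a \o f) -> random_list (R := R) (s b \o g) ->
  measurable_fun setT h -> measurable_fun setT (fun x => pair_term a b h (f x, g x)).
Proof.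
move=> ra rb mh.
have := random_list_sum _ (random_list_allpairs _ ra _ rb) _ (measurable_weight _ mh).
by apply: eq_measurable_fun => x _; rewrite big_allpairs.
Qed.

Local Notation U a b h om := (pair_term a b h (om, om)).

Lemma measurable_pair_term a b h : measurable_fun setT h ->
  measurable_fun setT (fun om => U a b h om).
Proof. by move=> mh; exact: (measurable_pair_term_gen id id a b h (rs a) (rs b) mh). Qed.

Lemma integrable_pair_term a b h K : measurable_fun setT h -> 0 <= K ->
  (forall e, `|h e| <= K) -> integrableR P (fun om => U a b h om).
Proof.
move=> mh K0 hK; apply: (integrableR_le _ _ (fun om => K * c ^+ 2 * (N a om * N b om))).
- exact: measurable_pair_term.
- by move=> om; exact: (pair_term_le a b h K (om, om) K0 hK).
- by have [i2 _] := integrable_size2 P s rs q m q4 mom a b; exact: integrableRZ.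
Qed.

Lemma pair_term_prod_le a b a' b' h h' K x x' : 0 <= K ->
  (forall e, `|h e| <= K) -> (forall e, `|h' e| <= K) ->
  `|pair_term a b h x * pair_term a' b' h' x'| <=
  (K * c ^+ 2) ^+ 2 * (N a x.1 * N b x.2 * N a' x'.1 * N b' x'.2).
Proof.
move=> K0 hK hK'; rewrite normrM.
apply: (le_trans (ler_pM (normr_ge0 _) (normr_ge0 _) (pair_term_le a b h K x K0 hK) (pair_term_le a' b' h' K x' K0 hK'))).
by rewrite le_eqVlt; apply/orP; left; apply/eqP; ring.
Qed.

Lemma integrable_pair_term_prod a b a' b' h h' K : measurable_fun setT h -> measurable_fun setT h' ->
  0 <= K -> (forall e, `|h e| <= K) -> (forall e, `|h' e| <= K) ->
  integrableR P (fun om => U a b h om * U a' b' h' om).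
Proof.
move=> mh mh' K0 hK hK'.
apply: (integrableR_le _ _ (fun om => (K * c ^+ 2) ^+ 2 * (N a om * N b om * N a' om * N b' om))).
- by apply: measurable_funM; exact: measurable_pair_term.
- by move=> om; exact: (pair_term_prod_le a b a' b' h h' K (om, om) (om, om) K0 hK hK').
- by have [i4 _] := integrable_size4 P s rs q m q4 mom a b a' b'; exact: integrableRZ.
Qed.

Definition pair_const : R := c ^+ 2 * (4 * m + 4 * ((1 + 4 * m) * 2 `^ th)).
(** Two single cells at distance [D] have the mixing gap [D - 2]. The value 1 for [D < 3], where no
    positive gap is left, stands for the plain moment bound. *)
Definition pair_decay (D : nat) : R := if (D < 3)%N then 1 else beta (D - 2)%:R `^ th.

Let m0 : 0 <= m. Proof. exact: (moment_ge0 P s q m mom 0). Qed.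

Lemma pair_term_mean_small a b h K : measurable_fun setT h -> 0 <= K ->
  (forall e, `|h e| <= K) -> `|\int[P]_om U a b h om| <= K * (c ^+ 2 * (4 * m)).
Proof.
move=> mh K0 hK; have [i2 e2] := integrable_size2 P s rs q m q4 mom a b.
apply: (@le_trans _ _ (\int[P]_om (K * c ^+ 2 * (N a om * N b om)))).
  apply: Rint_norm_le; first exact: measurable_pair_term.
    exact: integrableRZ.
  by move=> om; exact: (pair_term_le a b h K (om, om) K0 hK).
by rewrite RintZ // mulrA ler_wpM2l // mulr_ge0 // sqr_ge0.
Qed.

(** For independent copies the mean is zero: with the first point fixed, the weight is a bounded
    function of the second location and [phi'] integrates to zero against it. Mixing bounds the
    difference from the true mean. *)
Lemma pair_term_mean a b h K : measurable_fun setT h -> 0 < K ->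
  (forall e, `|h e| <= K) ->
  `|\int[P]_om U a b h om| <= K * (pair_const * pair_decay (site_norm (b - a))).
Proof.
move=> mh K0 hK; rewrite /pair_decay.
have pc0 : 0 <= 4 * ((1 + 4 * m) * 2 `^ th) by rewrite !mulr_ge0 ?powR_ge0 ?addr_ge0 ?mulr_ge0.
case: ltnP => D3.
  apply: (le_trans (pair_term_mean_small a b h K mh (ltW K0) hK)).
  rewrite mulr1 ler_pM2l // /pair_const ler_wpM2l ?sqr_ge0 //; lra.
have [n nE] : exists n, (n + 0 + 2 = site_norm (b - a)%R)%N.
  by exists (site_norm (b - a)%R - 2)%N; rewrite addn0 subnK // (leq_trans _ D3).
have n0 : (0 < n)%N by lia.
have [F [F' [[sF sF' mF mF'] bF near far]]] := mixing a 0 n n0.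
pose k := K * c ^+ 2.
have k0 : 0 < k by rewrite mulr_gt0 // exprn_gt0.
pose f x := k^-1 * pair_term a b h x.
have mf : measurable_fun (setT : set (g_sigma_algebraType (rectangles F F'))) f.
  apply: measurable_funM => //.
  have ra := near a; rewrite subrr in ra.
  have rb := far b; rewrite nE leqnn in rb.
  have z0 : (@site_norm d 0%R <= 0)%N by rewrite site_norm_le; apply/forallP => j; rewrite ffunE.
  have := measurable_pair_term_gen (T := g_sigma_algebraType (rectangles F F')) fst snd a b h
    (ra z0) (rb isT) mh.
  by under eq_fun do rewrite -surjective_pairing.
(* A product of two counts is at most its square, which fits the bound by four counts. *)
have fN x : `|f x| <= N a x.1 * N a x.1 * N b x.2 * N b x.2.
  rewrite normrM gtr0_norm ?invr_gt0 // mulrC ler_pdivrMr //.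
  apply: (le_trans (pair_term_le a b h K x (ltW K0) hK)).
  rewrite -/k mulrC ler_pM2r // -!natrM ler_nat.
  by case: (size (s a x.1)) (size (s b x.2)) => [|n1] [|n2] //; nia.
have := list_mixing P s q m q4 mom _ F F' sF sF' mF mF' (beta0 n n0) bF a a b b f mf fN.
have i1 := integrable_pair_term a b h K mh (ltW K0) hK.
have Pk : integrableR (P \x P)%E (pair_term a b h).
  apply: (integrable_pair_sum P (s a) (rs a) (s b) (rs b) _ _ (weight h) (K * c ^+ 2)).
  - exact: (integrable_size P s rs q m q4 mom).
  - exact: (integrable_size P s rs q m q4 mom).
  - exact: measurable_weight.
  - by move=> z; exact: weight_le (ltW K0) hK.
rewrite /f RintZ // RintZ //.
have -> : \int[(P \x P)%E]_x pair_term a b h x = 0.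
  have -> := Rint_pair_sum1 P (s a) (rs a) (s b) (rs b)
     (integrable_size P s rs q m q4 mom a) (integrable_size P s rs q m q4 mom b)
     (weight h) (K * c ^+ 2) (measurable_weight _ mh) (fun z => weight_le h K z (ltW K0) hK).
  rewrite -[RHS](Rint_cst P 0); apply: eq_Rintegral => om _; apply: big1 => y _.
  have ih : integrableR P (fun om' => \sum_(y' <- s b om') h (y.1, y'.1) * phi' y').
    apply: (integrable_list_sum P _ (rs b) (integrable_size P s rs q m q4 mom b) _ (K * c)).
      apply: measurable_funM => //; apply: (measurableT_comp mh).
      by apply: measurable_fun_pair.
    by move=> y'; rewrite normrM; apply: ler_pM.
  transitivity (\int[P]_om' (phi y * \sum_(y' <- s b om') h (y.1, y'.1) * phi' y')).
    apply: eq_Rintegral => om' _; rewrite mulr_sumr; apply: eq_bigr => y' _.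
    by rewrite /weight /=; ring.
  rewrite RintZ // (mean0 b (fun t => h (y.1, t)) K) ?mulr0 //.
  by apply: (measurableT_comp mh); exact: measurable_fun_pair.
rewrite mulr0 subr0 normrM gtr0_norm ?invr_gt0 // mulrC ler_pdivrMr // => H.
apply: (le_trans H).
have -> : (site_norm (b - a)%R - 2)%N = n by rewrite -nE addn0 addnK.
rewrite powRM ?beta0 // /k /pair_const.
have X0 : 0 <= beta n%:R `^ th := powR_ge0 _ _.
have Y0 : 0 <= c ^+ 2 * (4 * m) * beta n%:R `^ th by rewrite mulr_ge0 // mulr_ge0 ?sqr_ge0 // mulr_ge0.
have KY0 : 0 <= K * (c ^+ 2 * (4 * m) * beta n%:R `^ th) by rewrite mulr_ge0 // ltW.
rewrite -subr_ge0; apply: le_trans KY0 _; rewrite le_eqVlt; apply/orP; left; apply/eqP; ring.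
Qed.

Definition cov_const : R := c ^+ 4 * (4 * m + (4 * m) ^+ 2 + 4 * ((1 + 4 * m) * 2 `^ th)).
(** With [|b - a|] and [|b' - a'|] at most [L] and [|a' - a| = D], the cells [a'] and [b'] are at
    distance at least [D - L = n + L + 2] from [a], for [n = D - (2L + 2)]. The requirement [L < n]
    reads [3L + 3 <= D]; otherwise the value 1 stands for the plain moment bound. *)
Definition cov_decay (L D : nat) : R :=
  if (D < 3 * L + 3)%N then 1 else beta (D - (2 * L + 2))%:R `^ th.

(** The first pair is read at one copy of [Omega] and the second at the other, so that the product
    law gives exactly the product of the means. *)
Lemma pair_term_cov a b a' b' L h h' K : measurable_fun setT h -> measurable_fun setT h' ->
  0 < K -> (forall e, `|h e| <= K) -> (forall e, `|h' e| <= K) ->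
  (site_norm (b - a)%R <= L)%N -> (site_norm (b' - a')%R <= L)%N ->
  `|\int[P]_om (U a b h om * U a' b' h' om) -
    \int[P]_om U a b h om * \int[P]_om U a' b' h' om| <=
  K ^+ 2 * (cov_const * cov_decay L (site_norm (a' - a))).
Proof.
move=> mh mh' K0 hK hK' abL abL'; rewrite /cov_decay.
pose k := (K * c ^+ 2) ^+ 2.
have k0 : 0 < k by rewrite exprn_gt0 // mulr_gt0 // exprn_gt0.
have kE : k = K ^+ 2 * c ^+ 4 by rewrite /k exprMn -exprM.
have kk0 : 0 <= k := ltW k0.
have pc0 : 0 <= 4 * ((1 + 4 * m) * 2 `^ th) by rewrite !mulr_ge0 ?powR_ge0 ?addr_ge0 ?mulr_ge0.
have m40 : 0 <= 4 * m by rewrite mulr_ge0.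
rewrite /cov_const; case: ltnP => DL.
  have [i4 e4] := integrable_size4 P s rs q m q4 mom a b a' b'.
  have b1 : `|\int[P]_om (U a b h om * U a' b' h' om)| <= k * (4 * m).
    apply: (@le_trans _ _ (\int[P]_om (k * (N a om * N b om * N a' om * N b' om)))).
      apply: Rint_norm_le; [|exact: integrableRZ|].
        by apply: measurable_funM; exact: measurable_pair_term.
      by move=> om; exact: (pair_term_prod_le a b a' b' h h' K (om, om) (om, om) (ltW K0)).
    by rewrite RintZ // ler_wpM2l.
  have b2 : `|\int[P]_om U a b h om * \int[P]_om U a' b' h' om| <= k * (4 * m) ^+ 2.
    rewrite normrM; apply: (le_trans (ler_pM _ _ (pair_term_mean_small a b h K mh (ltW K0) hK)
      (pair_term_mean_small a' b' h' K mh' (ltW K0) hK'))) => //.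
    by rewrite le_eqVlt; apply/orP; left; apply/eqP; rewrite /k; ring.
  apply: (le_trans (ler_normB _ _)); apply: (le_trans (lerD b1 b2)).
  have k3 : 0 <= k * (4 * ((1 + 4 * m) * 2 `^ th)) by rewrite mulr_ge0.
  rewrite -subr_ge0; apply: (le_trans k3); rewrite kE le_eqVlt; apply/orP; left; apply/eqP; ring.
set D := site_norm (a' - a)%R in DL *.
pose n := (D - (2 * L + 2))%N; have [Ln nD] := cov_gap L D DL.
have n0 : (0 < n)%N by exact: leq_ltn_trans Ln.
have [F [F' [[sF sF' mF mF'] bF near far]]] := mixing a L n Ln.
pose T : measurableType _ := g_sigma_algebraType (rectangles F F').
pose f (x : Omega * Omega) := k^-1 * (pair_term a b h (x.1, x.1) * pair_term a' b' h' (x.2, x.2)).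
have z0 : (@site_norm d (a - a)%R <= L)%N.
  by rewrite subrr site_norm_le; apply/forallP => j; rewrite ffunE.
have fa' : (n + L + 2 <= site_norm (a' - a)%R)%N by rewrite -/D -nD leq_addr.
have fb' : (n + L + 2 <= site_norm (b' - a)%R)%N.
  have -> : b' - a = (b' - a') + (a' - a) by rewrite addrA subrK.
  have h1 : (D <= site_norm (b' - a')%R + site_norm ((b' - a') + (a' - a))%R)%N.
    have {1}-> : D = site_norm ((a' - b') + ((b' - a') + (a' - a)))%R.
      by rewrite /D; congr site_norm; rewrite !addrA subrK subrK.
    by apply: (leq_trans (site_normD _ _)); rewrite site_normB.
  by rewrite -(leq_add2l L) addnC nD (leq_trans h1) // leq_add2r.
have mf : measurable_fun (setT : set T) f.
  apply: measurable_funM => //; apply: measurable_funM.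
    exact: (measurable_pair_term_gen (T := T) fst fst a b h (near a z0) (near b abL) mh).
  exact: (measurable_pair_term_gen (T := T) snd snd a' b' h' (far a' fa') (far b' fb') mh').
have fN x : `|f x| <= N a x.1 * N b x.1 * N a' x.2 * N b' x.2.
  rewrite normrM gtr0_norm ?invr_gt0 // mulrC ler_pdivrMr // [_ * k]mulrC.
  exact: (pair_term_prod_le a b a' b' h h' K (x.1, x.1) (x.2, x.2) (ltW K0) hK hK').
have := list_mixing P s q m q4 mom _ F F' sF sF' mF mF' (beta0 n n0) bF a b a' b' f mf fN.
have i1 := integrable_pair_term a b h K mh (ltW K0) hK.
have i2 := integrable_pair_term a' b' h' K mh' (ltW K0) hK'.
have i12 := integrable_pair_term_prod a b a' b' h h' K mh mh' (ltW K0) hK hK'.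
have [ip ep] := Rint_prod P P _ _ i1 i2.
rewrite /f RintZ // RintZ // ep -mulrBr normrM gtr0_norm ?invr_gt0 // mulrC ler_pdivrMr // => H.
apply: (le_trans H); rewrite -/n powRM ?beta0 //.
have X0 : 0 <= beta n%:R `^ th := powR_ge0 _ _.
have Y0 : 0 <= k * ((4 * m + (4 * m) ^+ 2) * beta n%:R `^ th).
  by apply: mulr_ge0 => //; apply: mulr_ge0 => //; apply: addr_ge0 => //; exact: sqr_ge0.
rewrite -subr_ge0; apply: le_trans Y0 _; rewrite kE le_eqVlt; apply/orP; left; apply/eqP; ring.
Qed.

End pair_terms.

(** * Variance and mean of double sums over sites *)

Section site_sums.
Context {d : nat}.
Local Notation site := {ffun 'I_d -> int}.
Implicit Types (T : seq site) (a : site).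

Lemma count_near_le T a L : uniq T ->
  (count (fun b => site_norm (b - a)%R <= L)%N T <= (2 * L).+1 ^ d)%N.
Proof.
move=> uT; rewrite -size_filter -size_box -(size_map (fun b => b - a)).
apply: uniq_leq_size.
  by rewrite map_inj_uniq ?filter_uniq // => x y /addIr.
by move=> v /mapP[b]; rewrite mem_filter => /andP[bL _] ->; rewrite mem_box.
Qed.

Lemma sub_box_exists T : exists n, {subset T <= box n}.
Proof.
elim: T => [|a T [n Tn]]; first by exists 0%N.
exists (maxn n (site_norm a)) => v; rewrite in_cons mem_box => /predU1P[->|/Tn].
  exact: leq_maxr.
by rewrite mem_box => /leq_trans; apply; exact: leq_maxl.
Qed.

Lemma sum_site_diff_le {R : realDomainType} (h : site -> R) (A : R) T a : uniq T ->
  (forall v, 0 <= h v) -> (forall n, \sum_(v <- @box d n) h v <= A) ->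
  \sum_(b <- T) h (b - a) <= A.
Proof.
move=> uT h0 hA.
have [n sub] := sub_box_exists [seq b - a | b <- T].
have := ler_sum_subseq [seq b - a | b <- T] (box n) h _ sub (fun v _ => h0 v).
rewrite map_inj_uniq // => [/(_ uT)|x y /addIr //].
by rewrite big_map => /le_trans; apply.
Qed.

End site_sums.

Section variance_bound.
Context {R : realType} {d : nat} {dO : measure_display} {Omega : measurableType dO}
  (P : probability Omega R).
Local Notation site := {ffun 'I_d -> int}.
Variables (U : site -> site -> Omega -> R) (T : seq site) (uT : uniq T) (L : nat).
Hypothesis iU : forall a b, integrableR P (U a b).
Hypothesis iUU : forall a b a' b', integrableR P (fun om => U a b om * U a' b' om).
Hypothesis U0 : forall a b om, (L < site_norm (b - a)%R)%N -> U a b om = 0.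
Variables (kappa : nat -> R) (A : R).
Hypothesis kappa0 : forall n, 0 <= kappa n.
Hypothesis cov : forall a b a' b', (site_norm (b - a)%R <= L)%N -> (site_norm (b' - a')%R <= L)%N ->
  `|\int[P]_om (U a b om * U a' b' om) - \int[P]_om U a b om * \int[P]_om U a' b' om|
    <= kappa (site_norm (a' - a)%R).
Hypothesis kA : forall n, \sum_(v <- @box d n) kappa (site_norm v) <= A.

Let S om := \sum_(a <- T) \sum_(b <- T) U a b om.
Let V (p : site * site) := U p.1 p.2.
Let e p := \int[P]_om V p om.
Let Q := [seq (a, b) | a <- T, b <- T].

Let SE om : S om = \sum_(p <- Q) V p om.
Proof. by rewrite /S /Q big_allpairs. Qed.

Let ES : \int[P]_om S om = \sum_(p <- Q) e p.
Proof.
transitivity (\int[P]_om \sum_(p <- Q) V p om).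
  by apply: eq_Rintegral => om _; exact: SE.
by rewrite (Rint_sum P _ Q V) // => p; exact: iU.
Qed.

Let ciov p p' : integrableR P (fun om => (V p om - e p) * (V p' om - e p')) /\
  \int[P]_om ((V p om - e p) * (V p' om - e p')) = \int[P]_om (V p om * V p' om) - e p * e p'.
Proof.
have E om : (V p om - e p) * (V p' om - e p') =
    (V p om * V p' om - e p' * V p om) - (e p * V p' om - e p * e p') by ring.
have i1 : integrableR P (fun om => V p om * V p' om) := iUU _ _ _ _.
have i2 : integrableR P (fun om => e p' * V p om) by exact: integrableRZ (iU _ _).
have i3 : integrableR P (fun om => e p * V p' om) by exact: integrableRZ (iU _ _).
have i4 := integrableR_cst P (e p * e p').
have i12 := integrableRB _ _ _ i1 i2; have i34 := integrableRB _ _ _ i3 i4.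
split; first by under eq_fun do rewrite E; exact: integrableRB.
under eq_Rintegral do rewrite E.
rewrite (RintB _ _ _ i12 i34) (RintB _ _ _ i1 i2) (RintB _ _ _ i3 i4) Rint_cst.
rewrite (RintZ _ _ _ (iU p.1 p.2)) (RintZ _ _ _ (iU p'.1 p'.2)) -/(e p) -/(e p').
ring.
Qed.

Let cov_near p p' : `|\int[P]_om (V p om * V p' om) - e p * e p'| <=
  (site_norm (p.2 - p.1)%R <= L)%N%:R * ((site_norm (p'.2 - p'.1)%R <= L)%N%:R *
    kappa (site_norm (p'.1 - p.1)%R)).
Proof.
have [pL|pL] := leqP _ L; last first.
  have z om : V p om = 0 by exact: U0.
  rewrite /e; under eq_Rintegral do rewrite z mul0r.
  by under [X in _ - X * _]eq_Rintegral do rewrite z; rewrite Rint_cst !mul0r subrr normr0.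
have [p'L|p'L] := leqP _ L; last first.
  have z om : V p' om = 0 by exact: U0.
  rewrite /e; under eq_Rintegral do rewrite z mulr0.
  by under [X in _ - _ * X]eq_Rintegral do rewrite z; rewrite Rint_cst !mul0r !mulr0 subrr normr0.
by rewrite !mul1r; exact: cov.
Qed.

Lemma integrable_pair_sum_var : integrableR P (fun om => (S om - \int[P]_om S om) ^+ 2).
Proof.
under eq_fun do rewrite SE ES -sumrB expr2 mulr_suml; apply: integrableR_sum => p.
by under eq_fun do rewrite mulr_sumr; apply: integrableR_sum => p'; exact: (ciov p p').1.
Qed.

(** The variance is a sum over quadruples of sites. For given [a] and [a'] at most [(2L + 1) ^ d]
    sites [b], and as many [b'], contribute; the sum over [a'] of the covariance bounds is at most
    [A], for each [a] in [T]. *)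
Lemma variance_pair_sum : \int[P]_om (S om - \int[P]_om S om) ^+ 2 <=
  ((2 * L).+1 ^ d)%:R ^+ 2 * ((size T)%:R * A).
Proof.
have -> : \int[P]_om (S om - \int[P]_om S om) ^+ 2 =
    \sum_(p <- Q) \sum_(p' <- Q) (\int[P]_om (V p om * V p' om) - e p * e p').
  transitivity (\int[P]_om \sum_(p <- Q) \sum_(p' <- Q) (V p om - e p) * (V p' om - e p')).
    apply: eq_Rintegral => om _; rewrite SE ES -sumrB expr2 mulr_suml.
    by apply: eq_bigr => p _; rewrite mulr_sumr.
  rewrite (Rint_sum P _ Q (fun p om => \sum_(p' <- Q) (V p om - e p) * (V p' om - e p'))); last first.
    by move=> p; apply: integrableR_sum => p'; exact: (ciov p p').1.
  apply: eq_bigr => p _.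
  rewrite (Rint_sum P _ Q (fun p' om => (V p om - e p) * (V p' om - e p'))); last first.
    by move=> p'; exact: (ciov p p').1.
  by apply: eq_bigr => p' _; exact: (ciov p p').2.
set n := ((2 * L).+1 ^ d)%N.
have near a (x : R) : 0 <= x -> \sum_(b <- T) (site_norm (b - a)%R <= L)%N%:R * x <= n%:R * x.
  move=> x0; rewrite -mulr_suml ler_wpM2r // -natr_sum ler_nat.
  apply: leq_trans (count_near_le T a L uT).
  by rewrite -sum1_count [X in (_ <= X)%N]big_mkcond /=; apply: leq_sum => b _; case: (site_norm _ <= L)%N.
apply: (@le_trans _ _ (\sum_(a <- T) \sum_(a' <- T) n%:R * (n%:R * kappa (site_norm (a' - a)%R)))).
  rewrite /Q big_allpairs /=; apply: ler_sum => a _.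
  apply: (@le_trans _ _ (\sum_(b <- T) (site_norm (b - a)%R <= L)%N%:R *
      \sum_(a' <- T) n%:R * kappa (site_norm (a' - a)%R))).
    apply: ler_sum => b _; rewrite big_allpairs /= mulr_sumr; apply: ler_sum => a' _.
    apply: (@le_trans _ _ (\sum_(b' <- T) (site_norm (b - a)%R <= L)%N%:R *
        ((site_norm (b' - a')%R <= L)%N%:R * kappa (site_norm (a' - a)%R)))).
      by apply: ler_sum => b' _; apply: le_trans (ler_norm _) (cov_near (a, b) (a', b')).
    by rewrite -mulr_sumr ler_wpM2l // near.
  by rewrite -[leRHS]mulr_sumr; apply: near; apply: sumr_ge0 => a' _; rewrite mulr_ge0.
apply: (@le_trans _ _ (\sum_(a <- T) n%:R ^+ 2 * A)); last first.
  rewrite big_const_seq iter_addr addr0 count_predT -mulr_natl.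
  by rewrite le_eqVlt; apply/orP; left; apply/eqP; ring.
apply: ler_sum => a _; under eq_bigr do rewrite mulrA.
rewrite -mulr_sumr -expr2 ler_wpM2l ?exprn_ge0 //.
by apply: (sum_site_diff_le (fun v => kappa (site_norm v)) A T a uT).
Qed.

End variance_bound.

(** The near part has fewer than [3L + 3] shells, each of order at most [(L + 1) ^ d] sites in
    dimension [d.+1]. In the far part [n <= 3 (n - (2L + 2))], so after the shift of index the
    weight [n ^ d] costs only a factor [3 ^ d] and the mixing series bounds the rest. *)
Lemma cov_decay_sum {R : realType} (d : nat) (q S : R) (beta : R -> R) :
  (forall N, \sum_(1 <= n < N) n%:R ^+ d * beta n%:R `^ (1 - 4 / q) <= S) ->
  exists2 C : R, 0 <= C & forall L N,
    \sum_(v <- @box d.+1 N) cov_decay q beta L (site_norm v) <= C * L.+1%:R ^+ d.+1.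
Proof.
move=> hS; pose g n := beta n%:R `^ (1 - 4 / q).
have S0 : 0 <= S by have := hS 0%N; rewrite big_geq.
have g0 n : 0 <= g n by exact: powR_ge0.
pose c : R := (2 * d.+1 * 3 ^ d)%:R.
exists (1 + c * (3 ^+ d.+1 + 3 ^+ d * S)).
  by rewrite addr_ge0 // mulr_ge0 // addr_ge0 // mulr_ge0.
move=> L N.
have h0 n : 0 <= cov_decay q beta L n by rewrite /cov_decay; case: ifP => _ //; exact: powR_ge0.
apply: (le_trans (box_sum_le _ N h0)); rewrite -/c.
have -> : cov_decay q beta L 0 = 1 by rewrite /cov_decay addn3.
have x1 : 1 <= L.+1%:R ^+ d.+1 :> R by rewrite exprn_ege1 // ler1n.
rewrite mulrDl mul1r; apply: lerD => //.
rewrite -mulrA ler_wpM2l //.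
pose F k := k%:R ^+ d * g k.
have F0 k : 0 <= F k by rewrite mulr_ge0.
apply: (@le_trans _ _ (\sum_(1 <= n < N.+1) ((n < 3 * L + 3)%N%:R * (3 * L.+1%:R) ^+ d +
    (3 * L + 3 <= n)%N%:R * (3 ^+ d * F (n - (2 * L + 2))%N)))).
  apply: ler_sum => n _; rewrite /cov_decay; case: (ltnP n (3 * L + 3)) => nL.
    rewrite mul1r mul0r addr0 mulr1 lerXn2r ?nnegrE ?mulr_ge0 //.
    by rewrite -natrM ler_nat; lia.
  rewrite mul0r mul1r add0r /F mulrA -exprMn ler_wpM2r ?powR_ge0 // lerXn2r ?nnegrE ?mulr_ge0 //.
  by rewrite -natrM ler_nat; lia.
rewrite big_split /= [leRHS]mulrDl; apply: lerD.
  rewrite -mulr_suml [X in _ <= X * _]exprS [X in _ <= _ * X]exprS.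
  rewrite exprMn.
  rewrite [leRHS](_ : _ = (3 * L.+1%:R) * (3 ^+ d * L.+1%:R ^+ d)); last by ring.
  rewrite ler_wpM2r // -natr_sum -natrM ler_nat.
  have -> : (3 * L.+1)%N = size (index_iota 0 (3 * L.+1)) by rewrite size_iota subn0.
  rewrite -sum1_size (big_mkcond (r := index_iota 1 _)) /=.
  have -> : (\sum_(1 <= i < N.+1) (i < 3 * L + 3)%N = \sum_(i <- index_iota 1 N.+1 | (i < 3 * L + 3)%N) 1)%N.
    by rewrite [RHS]big_mkcond.
  rewrite -big_filter !sum1_size; apply: uniq_leq_size.
    by rewrite filter_uniq // iota_uniq.
  by move=> n; rewrite mem_filter !mem_index_iota; lia.
apply: (@le_trans _ _ (3 ^+ d * S)); last by rewrite ler_peMr // mulr_ge0.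
under eq_bigr do rewrite mulrCA.
rewrite -mulr_sumr ler_wpM2l //.
apply: le_trans (hS N.+1).
rewrite (eq_bigr (fun i => if (3 * L + 3 <= i)%N then F (i - (2 * L + 2))%N else 0)); last first.
  by move=> i _; case: ifP => _; rewrite ?mul1r ?mul0r.
rewrite -big_mkcond /= -big_filter -(big_map (fun n => (n - (2 * L + 2))%N) xpredT F).
apply: ler_sum_subseq => [|k|k _]; last exact: F0.
  rewrite map_inj_in_uniq ?filter_uniq ?iota_uniq // => x y.
  by rewrite !mem_filter; lia.
move=> /mapP[n]; rewrite mem_filter !mem_index_iota => h ->; lia.
Qed.

Lemma pair_decay_cov {R : realType} (q : R) (beta : R -> R) D : pair_decay q beta D = cov_decay q beta 0 D.
Proof. by []. Qed.

Lemma ler_norm_sum_const {R : realDomainType} {I : eqType} (s : seq I) (F : I -> R) (x : R) :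
  (forall i, i \in s -> `|F i| <= x) -> `|\sum_(i <- s) F i| <= (size s)%:R * x.
Proof.
move=> h; apply: (le_trans (ler_norm_sum _ _ _)).
apply: (@le_trans _ _ (\sum_(i <- s) x)); last first.
  by rewrite big_const_seq iter_addr addr0 count_predT mulr_natl.
by rewrite big_seq [leRHS]big_seq; apply: ler_sum => i /h.
Qed.

Section mean_pairs.
Context {R : realType} {d : nat}.
Local Notation site := {ffun 'I_d -> int}.
Variables (u : site -> site -> R) (T I : seq site) (uT : uniq T) (uI : uniq I) (n : nat).
Variables (G kap : site -> R) (v K0 K1 A eps : R) (v0 : 0 < v) (K00 : 0 <= K0) (K10 : 0 <= K1).
Hypothesis kap0 : forall m, 0 <= kap m.
Hypothesis hu : forall a b, `|u a b| <= K1 / v * kap (b - a).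
Hypothesis IT : forall a m, a \in I -> (site_norm m <= n)%N -> a + m \in T.
Hypothesis close : forall a m, a \in I -> (site_norm m <= n)%N ->
  `|u a (a + m) - G m / v| <= eps / v.
Hypothesis hG : forall m, `|G m| <= K0 * kap m.
Hypothesis kapA : forall N, \sum_(m <- @box d N) kap m <= A.

Let K1v : 0 <= K1 / v. Proof. by rewrite divr_ge0 // ltW. Qed.

Let sumG : `|\sum_(m <- box n) G m| <= K0 * \sum_(m <- @box d n) kap m.
Proof. by rewrite mulr_sumr; apply: le_trans (ler_norm_sum _ _ _) _; exact: ler_sum. Qed.

Let far a : \sum_(b <- T | (n < site_norm (b - a)%R)%N) kap (b - a) <=
  A - \sum_(m <- @box d n) kap m.
Proof.
rewrite lerBrDr -big_filter -(big_map (fun b => b - a) xpredT kap) -big_cat /=.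
have [N sub] := sub_box_exists ([seq b - a | b <- [seq b <- T | (n < site_norm (b - a)%R)%N]] ++ @box d n).
apply: le_trans (kapA N); apply: ler_sum_subseq sub _ => //.
rewrite cat_uniq box_uniq andbT map_inj_in_uniq ?filter_uniq //=; last by move=> x y _ _ /addIr.
apply/hasPn => m; rewrite mem_box => mn; apply/negP => /mapP[b].
by rewrite mem_filter ltnNge => /andP[/negP nb _] mE; apply: nb; rewrite -mE.
Qed.

Lemma sub_inner : {subset I <= T}.
Proof.
move=> a aI; rewrite -[a]addr0; apply: IT => //.
by rewrite site_norm_le; apply/forallP => j; rewrite ffunE.
Qed.

(** The four terms account for the pairs farther apart than [n], the pairs that start outside the
    inner sites [I], the replacement of [u] by [G / v] at the inner sites, and the deviation of
    [size I / v] from 1. *)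
Lemma mean_pairs_bias :
  `|\sum_(a <- T) \sum_(b <- T) u a b - \sum_(m <- box n) G m| <=
  K1 * ((size T)%:R / v) * (A - \sum_(m <- @box d n) kap m) +
  K1 * A * (((size T)%:R - (size I)%:R) / v) +
  (size I)%:R / v * ((2 * n).+1 ^ d)%:R * eps +
  K0 * A * `|(size I)%:R / v - 1|.
Proof.
pose near (a b : site) := (site_norm (b - a)%R <= n)%N.
have near_sum a : a \in I -> \sum_(b <- T | near a b) u a b = \sum_(m <- box n) u a (a + m).
  move=> aI; rewrite -(big_map (fun m => a + m) xpredT (u a)) -[LHS]big_filter; apply: perm_big.
  apply: uniq_perm; rewrite ?filter_uniq //.
    by rewrite map_inj_uniq ?box_uniq // => x y /addrI.
  move=> b; rewrite mem_filter; apply/andP/mapP => [[nb bT]|[m]].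
    by exists (b - a); rewrite ?mem_box // addrC subrK.
  by rewrite mem_box => mn ->; split; [rewrite /near addrC addKr|exact: IT].
have splitT (F : site -> R) : \sum_(a <- T) F a = \sum_(a <- I) F a + \sum_(a <- T | a \notin I) F a.
  rewrite (bigID (mem I)) /=; congr (_ + _); rewrite -[LHS]big_filter; apply: perm_big.
  apply: uniq_perm; rewrite ?filter_uniq // => a.
  by rewrite mem_filter andb_idr //; exact: sub_inner.
have E : \sum_(a <- T) \sum_(b <- T) u a b - \sum_(m <- box n) G m =
   \sum_(a <- T) \sum_(b <- T | ~~ near a b) u a b +
   \sum_(a <- T | a \notin I) \sum_(b <- T | near a b) u a b +
   \sum_(a <- I) \sum_(m <- box n) (u a (a + m) - G m / v) +
   ((size I)%:R / v - 1) * \sum_(m <- box n) G m.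
  under eq_bigr => a _ do rewrite (bigID (near a)) /=.
  rewrite big_split /= (splitT (fun a => \sum_(b <- T | near a b) u a b)).
  rewrite big_seq (eq_bigr _ near_sum) -big_seq.
  under [X in _ = _ + X + _]eq_bigr do rewrite sumrB.
  rewrite sumrB -mulr_suml big_const_seq iter_addr addr0 count_predT -mulr_natl.
  ring.
have b1 : `|\sum_(a <- T) \sum_(b <- T | ~~ near a b) u a b| <=
    K1 * ((size T)%:R / v) * (A - \sum_(m <- @box d n) kap m).
  have -> : K1 * ((size T)%:R / v) * (A - \sum_(m <- box n) kap m) =
    (size T)%:R * (K1 / v * (A - \sum_(m <- @box d n) kap m)) by ring.
  apply: ler_norm_sum_const => a _; apply: (le_trans (ler_norm_sum _ _ _)).
  apply: (@le_trans _ _ (\sum_(b <- T | (n < site_norm (b - a)%R)%N) K1 / v * kap (b - a))).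
    by under eq_bigl do rewrite /near -ltnNge; exact: ler_sum.
  by rewrite -mulr_sumr ler_wpM2l.
have b2 : `|\sum_(a <- T | a \notin I) \sum_(b <- T | near a b) u a b| <=
    K1 * A * (((size T)%:R - (size I)%:R) / v).
  have -> : K1 * A * (((size T)%:R - (size I)%:R) / v) =
      (size [seq a <- T | a \notin I])%:R * (K1 / v * A).
    have : size T = (size I + size [seq a <- T | a \notin I])%N.
      apply/eqP; rewrite -(eqr_nat R) natrD; apply/eqP.
      have := splitT (fun=> 1); rewrite -[X in _ = _ + X -> _]big_filter.
      by rewrite !big_const_seq !count_predT !iter_addr !addr0.
    by move=> ->; rewrite natrD; ring.
  rewrite -big_filter; apply: ler_norm_sum_const => a _; apply: (le_trans (ler_norm_sum _ _ _)).
  apply: (@le_trans _ _ (\sum_(b <- T | near a b) K1 / v * kap (b - a))); first exact: ler_sum.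
  rewrite -mulr_sumr ler_wpM2l //.
  apply: le_trans (sum_site_diff_le kap A T a uT kap0 kapA).
  by rewrite [leRHS](bigID (near a)) /= lerDl sumr_ge0.
have b3 : `|\sum_(a <- I) \sum_(m <- box n) (u a (a + m) - G m / v)| <=
    (size I)%:R / v * ((2 * n).+1 ^ d)%:R * eps.
  have -> : (size I)%:R / v * ((2 * n).+1 ^ d)%:R * eps =
     (size I)%:R * (((2 * n).+1 ^ d)%:R * (eps / v)) by ring.
  apply: ler_norm_sum_const => a aI; rewrite -size_box.
  by apply: ler_norm_sum_const => m; rewrite mem_box; exact: close.
have K0A : `|\sum_(m <- box n) G m| <= K0 * A.
  by apply: (le_trans sumG); rewrite ler_wpM2l.
have b4 : `|((size I)%:R / v - 1) * \sum_(m <- box n) G m| <= K0 * A * `|(size I)%:R / v - 1|.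
  by rewrite normrM mulrC ler_wpM2r.
rewrite E; apply: (le_trans (ler_normD _ _)); apply: lerD => //.
apply: (le_trans (ler_normD _ _)); apply: lerD => //.
by apply: (le_trans (ler_normD _ _)); apply: lerD.
Qed.

End mean_pairs.

Section mean_pairs_limit.
Context {R : realType} {d : nat}.
Local Notation site := {ffun 'I_d -> int}.
Variables (G kap : site -> R) (K0 A : R) (K00 : 0 <= K0).
Hypothesis kap0 : forall m, 0 <= kap m.
Hypothesis hG : forall m, `|G m| <= K0 * kap m.
Hypothesis kapA : forall N, \sum_(m <- @box d N) kap m <= A.

Let boxS n N : (n <= N)%N -> {subset @box d n <= box N}.
Proof. by move=> nN v; rewrite !mem_box => /leq_trans; apply. Qed.

Lemma box_sum_cvg : exists2 A' : R, (forall N, \sum_(m <- @box d N) kap m <= A') &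
  \sum_(m <- @box d N) kap m @[N --> \oo] --> A'.
Proof.
pose An N := \sum_(m <- @box d N) kap m.
have nd : nondecreasing_seq An.
  by move=> n N nN; apply: ler_sum_subseq => //; [exact: box_uniq|exact: boxS].
have ub : has_ubound (range An) by exists A => _ [N _ <-]; exact: kapA.
have cv := nondecreasing_cvgn nd ub.
exists (limn An); last by have := nondecreasing_is_cvgn nd ub.
by move=> N; apply: nondecreasing_cvgn_le => //; exact: nondecreasing_is_cvgn.
Qed.

(** Absolute convergence, from bounded monotone sums: both [K0 * kap] and [G + K0 * kap] are
    nonnegative with bounded sums over boxes. *)
Lemma box_sum_signed_cvg : exists sigma : R, \sum_(m <- @box d N) G m @[N --> \oo] --> sigma.
Proof.
have [A' _ cA] := box_sum_cvg.
have GA m : 0 <= G m + K0 * kap m by have := hG m; rewrite ler_norml => /andP[h _]; rewrite -lerBlDr sub0r.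
pose Bn N := \sum_(m <- @box d N) (G m + K0 * kap m).
have nd : nondecreasing_seq Bn.
  by move=> n N nN; apply: ler_sum_subseq => //; [exact: box_uniq|exact: boxS].
have ub : has_ubound (range Bn).
  exists (2 * K0 * A) => _ [N _ <-].
  apply: (@le_trans _ _ (2 * K0 * \sum_(m <- @box d N) kap m)); last by rewrite ler_wpM2l // mulr_ge0.
  rewrite mulr_sumr; apply: ler_sum => m _.
  by have := hG m; rewrite ler_norml => /andP[_ h]; lra.
exists (limn Bn - K0 * A').
have -> : (fun N => \sum_(m <- @box d N) G m) = (fun N => Bn N - K0 * \sum_(m <- @box d N) kap m).
  by apply/funext => N; rewrite /Bn big_split /= -mulr_sumr addrK.
apply: cvgB; last by apply: cvgM => //; exact: cvg_cst.
by have := nondecreasing_is_cvgn nd ub.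
Qed.

Variables (u : nat -> site -> site -> R) (T : nat -> seq site) (I : nat -> nat -> seq site)
  (v : nat -> R) (K1 : R) (sigma : R).
Hypothesis K10 : 0 <= K1.
Hypothesis hsigma : \sum_(m <- @box d N) G m @[N --> \oo] --> sigma.
Hypothesis hT : \forall k \near \oo, [/\ uniq (T k), 0 < v k &
  forall a b, `|u k a b| <= K1 / v k * kap (b - a)].
Hypothesis hI : forall n eps, 0 < eps -> \forall k \near \oo, [/\ uniq (I n k),
  forall a m, a \in I n k -> (site_norm m <= n)%N -> a + m \in T k &
  forall a m, a \in I n k -> (site_norm m <= n)%N -> `|u k a (a + m) - G m / v k| <= eps / v k].
Hypothesis T_cvg : (size (T k))%:R / v k @[k --> \oo] --> (1 : R).
Hypothesis I_cvg : forall n, (size (I n k))%:R / v k @[k --> \oo] --> (1 : R).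

(** Dominated convergence on the lattice. First [n] is fixed so that the tail beyond [n] is small
    for [kap] and for [G], then the accuracy [eps] for the finitely many sites of the box, then
    [k]. *)
Lemma mean_pairs_cvg : \sum_(a <- T k) \sum_(b <- T k) u k a b @[k --> \oo] --> sigma.
Proof.
have [A' A'ub cA'] := box_sum_cvg.
apply/cvgrPdist_lt => e e0.
have e30 : 0 < e / 4 by rewrite divr_gt0.
have aux (x y z f : R) : x < e / 4 -> y < e / 4 -> z <= f -> - (e / 4) < x + e / 4 - f -> y + z < e by lra.
have tail : K1 * (A' - \sum_(m <- @box d N) kap m) @[N --> \oo] --> K1 * (A' - A').
  by apply: cvgM; [exact: cvg_cst|apply: cvgB => //; exact: cvg_cst].
rewrite subrr mulr0 in tail.
have [n hn1 hn2] : exists2 n, K1 * (A' - \sum_(m <- @box d n) kap m) < e / 4 &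
    `|sigma - \sum_(m <- @box d n) G m| < e / 4.
  have /cvgrPdist_lt /(_ _ e30) t1 := tail.
  have /cvgrPdist_lt /(_ _ e30) t2 := hsigma.
  have [n [h1 h2]] := filter_ex (filterI t1 t2).
  by exists n => //; apply: le_lt_trans h1; rewrite sub0r normrN ler_norm.
pose B : R := ((2 * n).+1 ^ d)%:R; have B0 : 0 < B by rewrite ltr0n expn_gt0.
(* Divided by the number [B] of sites in the box, so that the replacement error adds up to [e / 4]
   in the limit. *)
pose eps := e / 4 / B; have eps0 : 0 < eps by rewrite divr_gt0.
pose F k := K1 * ((size (T k))%:R / v k) * (A' - \sum_(m <- @box d n) kap m) +
  K1 * A' * (((size (T k))%:R - (size (I n k))%:R) / v k) +
  (size (I n k))%:R / v k * B * eps +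
  K0 * A' * `|(size (I n k))%:R / v k - 1|.
have cF : F k @[k --> \oo] --> K1 * 1 * (A' - \sum_(m <- @box d n) kap m) +
  K1 * A' * (1 - 1) + 1 * B * eps + K0 * A' * `|(1 - 1 : R)|.
  apply: cvgD; [apply: cvgD; [apply: cvgD|]|].
  - by apply: cvgMl; apply: cvgMr.
  - apply: cvgMr; under eq_fun do rewrite mulrBl; exact: cvgB.
  - by apply: cvgMl; exact: cvgMl.
  - by apply: cvgMr; apply: cvg_norm; apply: cvgB => //; exact: cvg_cst.
rewrite mulr1 subrr mulr0 addr0 normr0 mulr0 addr0 mul1r [B * eps]mulrC divfK ?gt_eqF // in cF.
have /cvgrPdist_lt /(_ _ e30) dF := cF.
near=> k.
have [uTk v0 hu] : [/\ uniq (T k), 0 < v k & forall a b, `|u k a b| <= K1 / v k * kap (b - a)].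
  by near: k.
have [uIk IT cl] : [/\ uniq (I n k),
  forall a m, a \in I n k -> (site_norm m <= n)%N -> a + m \in T k &
  forall a m, a \in I n k -> (site_norm m <= n)%N -> `|u k a (a + m) - G m / v k| <= eps / v k].
  by near: k; exact: hI.
have main := mean_pairs_bias (u k) (T k) (I n k) uTk uIk n G kap (v k) K0 K1 A' eps v0 K00 K10
  kap0 hu IT cl hG A'ub.
rewrite -/(F k) in main.
have Fk : `|K1 * (A' - \sum_(m <- @box d n) kap m) + e / 4 - F k| < e / 4 by near: k.
set a := \sum_(a <- T k) _ in main *; set g := \sum_(m <- box n) G m in hn2 main.
have -> : sigma - a = (sigma - g) - (a - g) by rewrite opprB addrA subrK.
apply: le_lt_trans (ler_normB _ _) _.
move: Fk; rewrite ltr_norml => /andP[Fk _].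
exact: aux hn1 hn2 main Fk.
Unshelve. all: by end_near.
Qed.

End mean_pairs_limit.

(** * Quadratic forms in the centred marks *)

Lemma site_far_coord {R : realType} {d : nat} (a b : {ffun 'I_d -> int}) (L : nat) i (t u : R) :
  (L < `|(b - a)%R i|)%N -> (a i)%:~R <= t -> t < (a i)%:~R + 1 ->
  (b i)%:~R <= u -> u < (b i)%:~R + 1 -> L%:R < `|u - t|.
Proof.
rewrite !ffunE; move: (a i) (b i) => x y Li.
have : ((L.+1%:Z <= y - x) || (L.+1%:Z <= x - y))%R by lia.
case/orP; rewrite -(ler_int R) intrB [L.+1%:~R]mulrSr => h h1 h2 h3 h4.
  by apply: lt_le_trans (ler_norm _); lra.
by rewrite distrC; apply: lt_le_trans (ler_norm _); lra.
Qed.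

Section quadratic_forms.
Context {R : realType} {d : nat} {dO : measure_display} {Omega : measurableType dO}
  {M : topologicalType} (P : probability Omega R).
Variable X : point_family R d Omega M.
Hypothesis X_mpp : is_marked_point_process X.
Hypothesis X_stationary : stationary P X.
Variables (C C' : set M) (bC : borel C) (bC' : borel C').
Variables (q : R) (q4 : 4 < q).
Hypothesis X_moment :
  (\int[P]_om (mpp_count X om (unit_cube `*` setT) `^ q) < +oo)%E.
Variables (beta : R -> R) (beta_rate : mixing_rate P X beta).
Hypothesis cov_sum : exists2 A : R, 0 <= A & forall L N,
  \sum_(v <- @box d N) cov_decay q beta L (site_norm v) <= A * L.+1%:R ^+ d.
Variables (p p' : R).
Hypothesis lam0 : 0 < mean_sum P X C C' (fun=> true) 0 (cell 0).
Hypothesis mean1 : mean_sum P X C C' snd p' (cell 0) = 0.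

Local Notation E := (d.-tuple (measurableTypeR R)).
Local Notation Y := (E * (bool * bool))%type.
Local Notation site := {ffun 'I_d -> int}.
Local Notation points := (points_in X C C').
Local Notation cpoints := (cell_points X C C').
Local Notation phi := (centered fst p : Y -> R).
Local Notation phi' := (centered snd p' : Y -> R).
Local Notation U h a b om := (pair_term cpoints phi phi' a b h (om, om)).

(** The diagonal [y = y'] is included; it absorbs the product part of the single sum in the
    estimator. *)
Definition quad (B : set E) (h : E * E -> R) (om : Omega) : R :=
  \sum_(y <- points B om) \sum_(y' <- points B om) h (y.1, y'.1) * (phi y * phi' y').

Lemma cell_points_cell a om y : y \in cpoints a om -> cell a y.1.
Proof. exact: (points_in_window X X_mpp C C' _ (measurable_cell a) (bounded_cell a)). Qed.

Lemma pair_term_eq0 a b h om : (forall t u, cell a t -> cell b u -> h (t, u) = 0) ->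
  U h a b om = 0.
Proof.
move=> h0; rewrite /pair_term big_seq big1 // => y ya; rewrite big_seq big1 // => y' yb.
by rewrite /weight /= h0 ?mul0r //; [exact: (cell_points_cell a om y ya)|exact: (cell_points_cell b om y' yb)].
Qed.

Section window.
Variables (W : set 'rV[R]_d) (n : nat).
Hypothesis (mW : measurable (tupset W)) (Wn : tupset W `<=` box_region n).
Variables (h : E * E -> R).
Hypothesis hW : forall t u, ~ (tupset W t /\ tupset W u) -> h (t, u) = 0.
Local Notation T := (hit_sites W n).

Lemma uniq_hit_sites : uniq T.
Proof. by rewrite filter_uniq // box_uniq. Qed.

Lemma quad_cells om : quad (tupset W) h om = \sum_(a <- T) \sum_(b <- T) U h a b om.
Proof.
have red F : (forall a, (forall t, cell a t -> ~ tupset W t) -> F a = 0) ->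
    \sum_(a <- @box d n) F a = \sum_(a <- T) F a :> R.
  move=> F0; rewrite /hit_sites big_filter [RHS]big_mkcond /=; apply: eq_bigr => a _.
  case: asboolP => // nh; rewrite F0 // => t at_ Wt; apply: nh; by exists t.
rewrite /quad (sum_points_in_cells X X_mpp C C' _ n _ om mW Wn).
transitivity (\sum_(a <- box n) \sum_(b <- box n) U h a b om).
  apply: eq_bigr => a _.
  rewrite [RHS]exchange_big /=; apply: eq_bigr => y _.
  rewrite (sum_points_in_cells X X_mpp C C' _ n _ om mW Wn) mulr_sumr.
  apply: eq_bigr => b _; rewrite mulr_sumr; apply: eq_bigr => y' _.
  rewrite /weight /= !indicE.
  have [yW|nyW] := boolP (y.1 \in tupset W); last first.
    by rewrite mul0r hW ?mul0r // => -[/mem_set]; rewrite (negbTE nyW).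
  have [yW'|nyW'] := boolP (y'.1 \in tupset W); first by rewrite !mul1r.
  by rewrite mul0r mulr0 hW ?mul0r // => -[_ /mem_set]; rewrite (negbTE nyW').
rewrite red => [|a na].
  apply: eq_bigr => a _; rewrite red // => b nb.
  by apply: pair_term_eq0 => t u _ ub; apply: hW => -[_]; exact: nb.
by apply: big1 => b _; apply: pair_term_eq0 => t u at_ _; apply: hW => -[+ _]; exact: na.
Qed.

End window.

Variables (m : R) (mom : forall a, integrableR P (fun om => (size (cpoints a om))%:R `^ q) /\
  \int[P]_om (size (cpoints a om))%:R `^ q = m).

Definition centered_bound : R := (1 + `|p|) + (1 + `|p'|).
Local Notation c := centered_bound.

Let rs a := random_list_cell_points X X_mpp C C' bC bC' a.

Let c0 : 0 < c.
Proof. by rewrite /c addr_gt0 // ltr_pwDl. Qed.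

Let phic y : `|phi y| <= c.
Proof. by apply: (le_trans (centered_le _ _ _)); rewrite lerDl addr_ge0. Qed.

Let phic' y : `|phi' y| <= c.
Proof. by apply: (le_trans (centered_le _ _ _)); rewrite lerDr addr_ge0. Qed.

Let beta0 n : (0 < n)%N -> 0 <= beta n%:R.
Proof.
move=> n0; have [b0 _ _] := beta_rate; apply: b0.
by rewrite (@le_trans _ _ 1) ?ler1n // invf_le1 // ler1n.
Qed.

Let mixing a L n : (L < n)%N -> _ :=
  cell_points_mixing P X X_mpp X_stationary C C' bC bC' beta a L n beta_rate.

Let mphi : measurable_fun setT phi := measurable_centered fst p.
Let mphi' : measurable_fun setT phi' := measurable_centered snd p'.

Let is_ a : integrableR P (fun om => (size (cpoints a om))%:R) := integrable_size P _ rs q m q4 mom a.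

(** For the indicator of [A] this is the vanishing of the centred mean measure on [A] within the
    cell. [Rint_list_sum_eq0] extends it to bounded functions of the location. *)
Let mean0 a (u : E -> R) (b : R) : measurable_fun setT u ->
  (forall t, `|u t| <= b) -> \int[P]_om (\sum_(y <- cpoints a om) u y.1 * phi' y) = 0.
Proof.
apply: (Rint_list_sum_eq0 P _ (rs a) (is_ a) fst phi' c measurable_fst mphi' phic') => A mA.
have mI : measurable (cell a `&` A) by apply: measurableI => //; exact: measurable_cell.
have bI : bounded_tuples (cell (R := R) a `&` A).
  by have [r hr] := bounded_cell (R := R) a; exists r => t [/hr].
have sub : cell a `&` A `<=` cell a by move=> t [].
rewrite -[RHS](mean_sum_eq0 P X X_mpp X_stationary C C' bC bC' q q4 X_moment snd p' _ lam0 mean1 mI bI).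
apply: eq_Rintegral => om _.
rewrite (sum_points_in_sub X X_mpp C C' _ _ _ om mI (measurable_cell a) (bounded_cell a) sub).
rewrite big_seq [RHS]big_seq; apply: eq_bigr => y ya; congr (_ * _).
rewrite !indicE; congr (_ %:R); congr nat_of_bool.
apply/idP/idP => /set_mem yA; apply/mem_set; last by case: yA.
by split => //; exact: (cell_points_cell a om).
Qed.

Lemma cell_pair_mean (a b : site) (h : E * E -> R) (K : R) : measurable_fun setT h -> 0 < K -> (forall e, `|h e| <= K) ->
  `|\int[P]_om U h a b om| <= K * (pair_const q m c * cov_decay q beta 0 (site_norm (b - a)%R)).
Proof.
exact: (pair_term_mean P _ rs q m q4 mom phi phi' c c0 mphi mphi' phic phic' beta beta0 mixing mean0).
Qed.

Lemma integrable_cell_pair (a b : site) (h : E * E -> R) (K : R) : measurable_fun setT h -> 0 < K -> (forall e, `|h e| <= K) ->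
  integrableR P (fun om => U h a b om).
Proof.
move=> mh K0; apply: (integrable_pair_term P _ rs q m q4 mom phi phi' c mphi mphi' phic phic') => //.
exact: ltW.
Qed.

Lemma integrable_quad (W : set 'rV[R]_d) n (h : E * E -> R) (K : R) :
  measurable (tupset W) -> tupset W `<=` box_region n ->
  measurable_fun setT h -> 0 < K -> (forall e, `|h e| <= K) ->
  (forall t u, ~ (tupset W t /\ tupset W u) -> h (t, u) = 0) ->
  integrableR P (quad (tupset W) h).
Proof.
move=> mW Wn mh K0 hK hW.
rewrite (_ : quad _ _ = fun om => \sum_(a <- hit_sites W n) \sum_(b <- hit_sites W n) U h a b om).
  by do 2!apply: integrableR_sum => ?; exact: integrable_cell_pair K0 hK.
by apply/funext => om; exact: quad_cells.
Qed.

(** Of the exponent [3 * d], the part [2 * d] counts the partners of the two cells within the range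
    [L], and [d] comes from the sum of the covariance bounds, which are not small before distance
    [3L + 3]. *)
Lemma quad_variance : exists2 A : R, 0 <= A & forall (W : set 'rV[R]_d) n (h : E * E -> R) K L,
  measurable (tupset W) -> tupset W `<=` box_region n ->
  measurable_fun setT h -> 0 < K -> (forall e, `|h e| <= K) ->
  (forall t u, ~ (tupset W t /\ tupset W u) -> h (t, u) = 0) ->
  (forall t u i, L%:R < `|tnth u i - tnth t i| -> h (t, u) = 0) ->
  integrableR P (fun om => (quad (tupset W) h om - \int[P]_om quad (tupset W) h om) ^+ 2) /\
  \int[P]_om (quad (tupset W) h om - \int[P]_om quad (tupset W) h om) ^+ 2 <=
    A * (K ^+ 2 * (size (hit_sites W n))%:R * L.+1%:R ^+ (3 * d)).
Proof.
have [A A0 hA] := cov_sum.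
pose cc := cov_const q m c.
have m0 : 0 <= m by exact: (moment_ge0 P _ q m mom 0).
have cc0 : 0 <= cc.
  rewrite /cc /cov_const mulr_ge0 ?exprn_ge0 ?(ltW c0) // !addr_ge0 ?sqr_ge0 //.
    by rewrite mulr_ge0.
  by rewrite !mulr_ge0 ?powR_ge0 // addr_ge0 // mulr_ge0.
exists (4 ^+ d * (cc * A)); first by apply: mulr_ge0; [exact: exprn_ge0|exact: mulr_ge0].
move=> W n h K L mW Wn mh K0 hK hW hL.
have QE om := quad_cells W n mW Wn h hW om.
have -> : quad (tupset W) h = fun om => \sum_(a <- hit_sites W n) \sum_(b <- hit_sites W n) U h a b om.
  by apply/funext => om; exact: QE.
pose kappa D := K ^+ 2 * (cc * cov_decay q beta L D).
have kappa0 D : 0 <= kappa D.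
  apply: mulr_ge0; first exact: sqr_ge0.
  by apply: mulr_ge0 => //; rewrite /cov_decay; case: ifP => // _; exact: powR_ge0.
have iU a b := integrable_cell_pair a b h K mh K0 hK.
have iUU a b a' b' : integrableR P (fun om => U h a b om * U h a' b' om).
  exact: (integrable_pair_term_prod P _ rs q m q4 mom phi phi' c mphi mphi' phic phic' a b a' b' h h K mh mh (ltW K0)).
have U0 a b om : (L < site_norm (b - a)%R)%N -> U h a b om = 0.
  move=> Lab; apply: pair_term_eq0 => t u at_ ub.
  have [i Li] : exists i, (L < `|(b - a)%R i|)%N.
    apply/existsP; apply: contraLR Lab => /existsPn H.
    by rewrite -leqNgt site_norm_le; apply/forallP => i; have := H i; rewrite -leqNgt.
  apply: (hL t u i); have /andP[h1 h2] := at_ i; have /andP[h3 h4] := ub i.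
  exact: (site_far_coord _ _ _ _ _ _ Li h1 h2 h3 h4).
have cov a b a' b' : (site_norm (b - a)%R <= L)%N -> (site_norm (b' - a')%R <= L)%N ->
  `|\int[P]_om (U h a b om * U h a' b' om) - \int[P]_om U h a b om * \int[P]_om U h a' b' om|
    <= kappa (site_norm (a' - a)%R).
  by move=> hab ha'b'; apply: (pair_term_cov P _ rs q m q4 mom phi phi' c c0 mphi mphi' phic phic' beta beta0 mixing).
have kA N : \sum_(v <- @box d N) kappa (site_norm v) <= K ^+ 2 * (cc * (A * L.+1%:R ^+ d)).
  by rewrite -!mulr_sumr ler_wpM2l ?sqr_ge0 // ler_wpM2l.
split; first exact: (integrable_pair_sum_var P (fun a b om => U h a b om) _ iU iUU).
apply: (le_trans (variance_pair_sum P (fun a b om => U h a b om) _ (uniq_hit_sites W n) L iU iUU U0 kappa _ kappa0 cov kA)).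
set S := (size _)%:R; set Ld := L.+1%:R.
have Ld0 : 0 <= Ld :> R by rewrite /Ld.
have b1 : ((2 * L).+1 ^ d)%:R ^+ 2 <= 4 ^+ d * Ld ^+ d * Ld ^+ d :> R.
  rewrite (_ : 4 ^+ d * _ * _ = (2 ^+ d * Ld ^+ d) ^+ 2); last first.
    rewrite exprMn -mulrA -expr2; congr (_ * _).
    by rewrite -exprM mulnC exprM; congr (_ ^+ _); rewrite -natrX.
  rewrite lerXn2r ?nnegrE ?mulr_ge0 ?exprn_ge0 // natrX -exprMn lerXn2r ?nnegrE ?mulr_ge0 //.
  by rewrite /Ld -natrM ler_nat; lia.
have b2 : 0 <= S * (K ^+ 2 * (cc * (A * Ld ^+ d))).
  apply: mulr_ge0; first by rewrite /S.
  apply: mulr_ge0; first exact: sqr_ge0.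
  by apply: mulr_ge0 => //; apply: mulr_ge0 => //; exact: exprn_ge0.
apply: (le_trans (ler_wpM2r b2 b1)).
rewrite le_eqVlt; apply/orP; left; apply/eqP.
rewrite (_ : (3 * d = d + d + d)%N); last by lia.
by rewrite !exprD; ring.
Qed.

(** The limit [sigma] is the sum of these numbers over all sites [v]. *)
Definition cell_cov (v : site) : R :=
  \int[P]_om ((\sum_(y <- cpoints 0 om) phi y) * (\sum_(y <- cpoints v om) phi' y)).

Lemma cell_cov_shift a v : \int[P]_om U (fun=> 1) a (a + v) om = cell_cov v.
Proof.
rewrite /cell_cov -(pair_sum_shift P X X_mpp X_stationary C C' bC bC' q q4 X_moment fst p snd p' a v).
apply: eq_Rintegral => om _; rewrite mulr_suml; apply: eq_bigr => y _.
by rewrite mulr_sumr; apply: eq_bigr => y' _; rewrite /weight mul1r.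
Qed.

Let kap (v : site) := pair_const q m c * cov_decay q beta 0 (site_norm v).

Let pair_const0 : 0 <= pair_const q m c.
Proof.
have m0 : 0 <= m by exact: (moment_ge0 P _ q m mom 0).
have m40 : 0 <= 4 * m by exact: mulr_ge0.
apply: mulr_ge0; first exact: sqr_ge0.
apply: addr_ge0 => //; apply: mulr_ge0 => //; apply: mulr_ge0; last exact: powR_ge0.
exact: addr_ge0.
Qed.

Let kap0 v : 0 <= kap v.
Proof. by apply: mulr_ge0 => //; rewrite /cov_decay; case: ifP => // _; exact: powR_ge0. Qed.

Let cell_cov_le v : `|cell_cov v| <= 1 * kap v.
Proof.
rewrite -(cell_cov_shift 0) add0r.
have := cell_pair_mean 0 v (fun=> 1) 1; rewrite subr0; apply => // _.
by rewrite normr1.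
Qed.

Let kapA : exists A, forall N, \sum_(v <- @box d N) kap v <= A.
Proof.
have [A A0 hA] := cov_sum; exists (pair_const q m c * (A * 1%:R ^+ d)) => N.
by rewrite /kap -mulr_sumr ler_wpM2l.
Qed.

Lemma cell_cov_cvg : exists sigma : R, \sum_(v <- @box d N) cell_cov v @[N --> \oo] --> sigma.
Proof. by have [A hA] := kapA; exact: (box_sum_signed_cvg cell_cov kap 1 A ler01 kap0 cell_cov_le hA). Qed.

Section windows.
Variables (W : nat -> set 'rV[R]_d) (ctr : nat -> 'rV[R]_d) (rho : nat -> R) (N : nat -> nat).
Hypothesis cW : forall k, closed (W k).
Hypothesis bW : forall k, bounded_tuples (tupset (W k)).
Hypothesis convW : forall k, convex_set (W k : set (convex_lmodType 'rV[R]_d)).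
Hypothesis ballW : \forall k \near \oo, 0 < rho k /\ closed_eball (ctr k) (rho k) `<=` W k.
Hypothesis rho_cvg : rho k @[k --> \oo] --> +oo.
Hypothesis v0 : \forall k \near \oo, 0 < vol (W k).
Hypothesis WN : forall k, tupset (W k) `<=` box_region (N k).
Variables (h : nat -> E * E -> R) (K : R) (sigma : R).
Hypothesis K0 : 0 < K.
Hypothesis hsigma : \sum_(v <- @box d n) cell_cov v @[n --> \oo] --> sigma.
Hypothesis mh : forall k, measurable_fun setT (h k).
Hypothesis hK : \forall k \near \oo, forall e, `|h k e| <= K / vol (W k).
Hypothesis hW : forall k t u, ~ (tupset (W k) t /\ tupset (W k) u) -> h k (t, u) = 0.
Hypothesis close : forall n eps, 0 < eps -> \forall k \near \oo, forall t u,
  tupset (W k) t -> tupset (W k) u -> (forall i, `|tnth u i - tnth t i| <= n%:R + 1) ->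
  `|h k (t, u) - (vol (W k))^-1| <= eps / vol (W k).

(** The mean of the term of [a] and [a + v] is asymptotically [cell_cov v / |W_k|], and about
    [|W_k|] inner sites [a] occur for each [v]. The limit does not depend on the weights, so the
    constant weight and the kernel weight share it. *)
Lemma quad_mean_cvg : \int[P]_om quad (tupset (W k)) (h k) om @[k --> \oo] --> sigma.
Proof.
have [A hA] := kapA.
pose T k := hit_sites (W k) (N k).
pose I n k := inner_sites (W k) (N k) n.
pose v k := vol (W k).
pose u k a b := \int[P]_om U (h k) a b om.
pose c4 := c ^+ 2 * (4 * m).
have qE : \forall k \near \oo, \sum_(a <- T k) \sum_(b <- T k) u k a b =
    \int[P]_om quad (tupset (W k)) (h k) om.
  near=> k.
  have vk : 0 < vol (W k) by near: k.
  have hk : forall e, `|h k e| <= K / vol (W k) by near: k.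
  have Kv : 0 < K / vol (W k) by exact: divr_gt0.
  have iU a b := integrable_cell_pair a b (h k) _ (mh k) Kv hk.
  under [RHS]eq_Rintegral do
    rewrite (quad_cells (W k) (N k) (measurable_tupset _ (cW k)) (@WN k) (h k) (@hW k)).
  rewrite (Rint_sum P _ (T k) (fun a om => \sum_(b <- T k) U (h k) a b om)); last first.
    by move=> a; apply: integrableR_sum => b; exact: iU.
  by apply: eq_bigr => a _; rewrite (Rint_sum P _ (T k) (fun b om => U (h k) a b om)).
apply: cvg_trans (near_eq_cvg qE) _.
apply: (mean_pairs_cvg cell_cov kap 1 A ler01 kap0 cell_cov_le hA u T I v K sigma (ltW K0) hsigma).
- near=> k; have vk : 0 < vol (W k) by near: k.
  have hk : forall e, `|h k e| <= K / vol (W k) by near: k.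
  split => // [|a b]; first exact: uniq_hit_sites.
  by apply: cell_pair_mean => //; exact: divr_gt0.
- move=> n eps' e'0; pose eps := eps' / (c4 + 1).
  have c40 : 0 <= c4.
    by apply: mulr_ge0; [exact: sqr_ge0|apply: mulr_ge0 => //; exact: (moment_ge0 P _ q m mom 0)].
  have c41 : 0 < c4 + 1 by exact: ltr_wpDl.
  have e0 : 0 < eps by exact: divr_gt0.
  have ee : eps * c4 <= eps' by rewrite -[leRHS](divfK (lt0r_neq0 c41)) ler_wpM2l ?(ltW e0) // lerDl.
  near=> k; have vk : 0 < vol (W k) by near: k.
  have hk : forall e, `|h k e| <= K / vol (W k) by near: k.
  have cl : forall t u, tupset (W k) t -> tupset (W k) u ->
     (forall i, `|tnth u i - tnth t i| <= n%:R + 1) ->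
    `|h k (t, u) - (vol (W k))^-1| <= eps / vol (W k) by near: k; exact: close.
  have Kv : 0 < K / vol (W k) by exact: divr_gt0.
  split; first by rewrite filter_uniq // box_uniq.
    move=> a w aI wn; exact: (inner_add_hit _ _ (@WN k) n).
  move=> a w aI wn.
  have inW : cell (a + w) `<=` tupset (W k).
    by move: aI; rewrite mem_filter => /andP[/asboolP aW _]; exact: aW.
  have inW0 : cell a `<=` tupset (W k).
    move: aI; rewrite mem_filter => /andP[/asboolP aW _]; have := aW 0; rewrite addr0; apply.
    by rewrite site_norm_le; apply/forallP => j; rewrite ffunE.
  have iU := integrable_cell_pair a (a + w) (h k) _ (mh k) Kv hk.
  have i1 : integrableR P (fun om => U (fun=> 1) a (a + w) om).
    apply: (integrable_cell_pair a (a + w) (fun=> 1) 1) => // _.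
    by rewrite normr1.
  have [i2 e2] := integrable_size2 P _ rs q m q4 mom a (a + w).
  rewrite /u -(cell_cov_shift a) [X in _ - X]mulrC -RintZ // -RintB //; last exact: integrableRZ.
  have ev0 : 0 <= eps / vol (W k).
    pose t0 : E := [tuple (a i)%:~R | i < d].
    have at0 : cell a t0 by move=> i; rewrite tnth_mktuple lexx ltrDl ltr01.
    apply: le_trans (normr_ge0 _) (cl t0 t0 (inW0 _ at0) (inW0 _ at0) _) => i.
    by rewrite subrr normr0 addr_ge0.
  apply: (@le_trans _ _ (\int[P]_om (eps / vol (W k) * c ^+ 2 *
      ((size (cpoints a om))%:R * (size (cpoints (a + w) om))%:R)))); last first.
    rewrite RintZ //; apply: (@le_trans _ _ (eps / vol (W k) * c ^+ 2 * (4 * m))).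
      by rewrite ler_wpM2l // mulr_ge0 // sqr_ge0.
    rewrite (_ : _ * (4 * m) = eps * c4 / v k); last by rewrite /c4 /v; ring.
    by rewrite ler_pM2r ?invr_gt0.
  apply: Rint_norm_le.
  - exact: (integrableR_measurable _ _ (integrableRB _ _ _ iU (integrableRZ _ _ _ i1))).
  - exact: integrableRZ.
  move=> om; rewrite /pair_term mulr_sumr -sumrB /=.
  rewrite [leRHS](_ : _ = (size (cpoints a om))%:R * ((size (cpoints (a + w) om))%:R *
     (eps / vol (W k) * c ^+ 2))); last by ring.
  apply: ler_norm_sum_const => y ya; rewrite mulr_sumr -sumrB.
  apply: ler_norm_sum_const => y' yb; rewrite /weight /= mul1r -mulrBl.
  rewrite normrM; apply: ler_pM => //; last first.
    by rewrite normrM expr2; apply: ler_pM.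
  have ca := cell_points_cell _ _ _ ya; have cb := cell_points_cell _ _ _ yb.
  by apply: cl; [exact: inW0|exact: inW|exact: cell_diff wn ca cb].
- exact: (hit_sites_cvg W ctr rho N cW bW convW ballW rho_cvg v0 WN).
- by move=> n; exact: (inner_sites_cvg W ctr rho N cW bW convW ballW rho_cvg v0 WN).
Unshelve. all: by end_near.
Qed.

End windows.

End quadratic_forms.

(** * The kernel weight and the bandwidths *)

Lemma bernoulli_ge {R : realDomainType} (t : R) n : 0 <= t -> t <= 1 -> 1 - n%:R * t <= (1 - t) ^+ n.
Proof.
move=> t0 t1; elim: n => [|n IH]; first by rewrite mul0r subr0 expr0.
rewrite exprS; apply: (@le_trans _ _ ((1 - t) * (1 - n%:R * t))); last by rewrite ler_wpM2l // subr_ge0.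
have n0 : 0 <= n%:R * t ^+ 2 by rewrite mulr_ge0 // sqr_ge0.
rewrite -subr_ge0 -natr1; apply: (le_trans n0).
by rewrite le_eqVlt; apply/orP; left; apply/eqP; ring.
Qed.

Section kernel_weight.
Context {R : realType} {d : nat}.
Local Notation E := (d.-tuple (measurableTypeR R)).
Local Notation mu := (lebesgue_tuple R d).

Definition row_diff (z : E * E) : 'rV[R]_d := row_of_tuple z.2 - row_of_tuple z.1.

Definition cap_vol (W : set 'rV[R]_d) (z : E * E) : R :=
  vol (translate W (row_of_tuple z.1) `&` translate W (row_of_tuple z.2)).

Definition kernel_weight (W : set 'rV[R]_d) (w : R -> R) (s : R) (z : E * E) : R :=
  \1_(tupset W) z.1 * \1_(tupset W) z.2 * (w (enorm (row_diff z) / s) / cap_vol W z).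

Lemma measurable_enorm_diff : measurable_fun setT (fun z => enorm (row_diff z)).
Proof.
apply: (measurableT_comp (measurable_funS _ _ (continuous_measurable_fun (@sqrt_continuous R)))) => //.
apply: measurable_sum => i; apply: measurable_funX.
rewrite (_ : (fun z => _) = fun z : E * E => tnth z.2 i - tnth z.1 i); last first.
  by apply/funext => z; rewrite /row_diff !mxE.
apply: measurable_funB.
  exact: (measurableT_comp (measurable_tnth i) measurable_snd).
exact: (measurableT_comp (measurable_tnth i) measurable_fst).
Qed.

Section window.
Variables (W : set 'rV[R]_d) (cW : closed W) (bW : bounded_tuples (tupset W)).

(** The volume is that of a section of a measurable set of triples, hence a measurable function of
    the two points. *)
Lemma measurable_cap_vol : measurable_fun setT (cap_vol W).
Proof.
have mW := measurable_tupset W cW.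
pose addt (t t' : E) : E := tuple_of_row (row_of_tuple t + row_of_tuple t').
have maddt dT (T : measurableType dT) (f g : T -> E) : measurable_fun setT f -> measurable_fun setT g ->
    measurable_fun setT (fun x => addt (f x) (g x)).
  move=> mf mg; apply/measurable_fun_tnthP => i.
  rewrite (_ : _ \o _ = fun x => tnth (f x) i + tnth (g x) i).
    apply: measurable_funD; first exact: (measurableT_comp (measurable_tnth i) mf).
    exact: (measurableT_comp (measurable_tnth i) mg).
  by apply/funext => x; rewrite /= tnth_mktuple !mxE.
pose A : set ((E * E) * E) := (fun x => addt x.2 x.1.1) @^-1` tupset W `&`
  (fun x => addt x.2 x.1.2) @^-1` tupset W.
have mA : measurable A.
  apply: measurableI; rewrite -[X in measurable X]setTI.
    apply: (maddt _ _ snd (fun x => x.1.1)) => //.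
    exact: (measurableT_comp measurable_fst measurable_fst).
  apply: (maddt _ _ snd (fun x => x.1.2)) => //.
  exact: (measurableT_comp measurable_snd measurable_fst).
have := measurable_fun_xsection mu mA.
move=> /(measurableT_comp (fine_measurable measurableT)) mf.
rewrite (_ : cap_vol W = fine \o (mu \o xsection A)) //.
apply/funext => -[t t'] /=; rewrite /cap_vol /vol; congr (fine (mu _)).
have tr x y : translate W x y <-> W (y + x).
  split=> [[z Wz <-]|Wy]; first by rewrite subrK.
  by exists (y + x) => //; rewrite addrK.
apply/seteqP; split=> u /=; rewrite /xsection /A /= /tupset /addt.
  by move=> [/tr h1 /tr h2]; apply/mem_set; split; rewrite /= tuple_of_rowK.
by move=> /set_mem [] /=; rewrite !tuple_of_rowK => h1 h2; split; apply/tr.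
Qed.

Lemma measurable_kernel_weight (w : R -> R) (s : R) : measurable_fun setT w ->
  measurable_fun setT (kernel_weight W w s).
Proof.
move=> mw; have mi : measurable_fun setT (\1_(tupset W) : E -> R).
  by apply: measurable_indic; exact: measurable_tupset.
apply: measurable_funM.
  by apply: measurable_funM; [exact: (measurableT_comp mi)|exact: (measurableT_comp mi)].
apply: measurable_funM.
  apply: (measurableT_comp mw); apply: measurable_funM => //; exact: measurable_enorm_diff.
have -> : (fun z => (cap_vol W z)^-1) = fun z => cap_vol W z `^ (-1).
  by apply/funext => z; rewrite powR_inv1 // /cap_vol /vol fine_ge0.
exact: (measurableT_comp (measurable_powR _) measurable_cap_vol).
Qed.

Lemma kernel_weight_out w s t u : ~ (tupset W t /\ tupset W u) -> kernel_weight W w s (t, u) = 0.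
Proof.
rewrite /kernel_weight !indicE /= => n.
case: (boolP (t \in _)) => [/set_mem Wt|]; last by rewrite !mul0r.
case: (boolP (u \in _)) => [/set_mem Wu|]; last by rewrite mulr0 mul0r.
by exfalso; apply: n.
Qed.

Hypothesis (convW : convex_set (W : set (convex_lmodType 'rV[R]_d))).
Variables (c : 'rV[R]_d) (rho : R) (rho0 : 0 < rho).
Hypothesis ballW : closed_eball c rho `<=` W.
Hypothesis v0 : 0 < vol W.
Variable w : R -> R.

Lemma kernel_weight_in s t u : tupset W t -> tupset W u ->
  kernel_weight W w s (t, u) = w (enorm (row_diff (t, u)) / s) / cap_vol W (t, u).
Proof. by move=> Wt Wu; rewrite /kernel_weight !indicE /= !mem_set // !mul1r. Qed.

Lemma kernel_weight_diag s t : w 0 = 1 -> tupset W t -> kernel_weight W w s (t, t) = (vol W)^-1.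
Proof.
move=> w1 Wt; rewrite kernel_weight_in // /row_diff /= subrr.
have e0 : enorm (0 : 'rV[R]_d) = 0.
  by rewrite -(scale0r (0 : 'rV[R]_d)) enormZ normr0 mul0r.
rewrite e0 mul0r w1 mul1r; congr (_^-1).
have := vol_translate_cap W cW bW convW c rho rho0 ballW (row_of_tuple t) (row_of_tuple t) 0 (lexx 0) ltr01.
rewrite subrr e0 mul0r lexx subr0 expr1n mul1r => /(_ isT) /andP[h1 h2].
by apply/eqP; rewrite eq_le; apply/andP; split.
Qed.

(** The weight vanishes unless the points are within [r_w * s <= t * rho]. Then the intersection of
    the translates has volume at least [(1 - t) ^ d |W|], by Bernoulli at least [(1 - d t) |W|], and
    [d t <= 3/4] gives the constant 4. *)
Lemma kernel_weight_le s t m_w r_w z : (0 < d)%N -> 0 < s -> (forall x, 0 <= w x <= m_w) ->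
  (forall x, r_w < `|x| -> w x = 0) -> 0 <= t -> d%:R * t <= 3 / 4 -> r_w * s <= t * rho ->
  `|kernel_weight W w s z| <= 4 * m_w / vol W.
Proof.
move=> d0 s0 wm wr t0 dt rs.
have m0 : 0 <= m_w by have /andP[/le_trans] := wm 0; apply.
have b0 : 0 <= 4 * m_w / vol W by rewrite divr_ge0 ?(ltW v0) // mulr_ge0.
have dR : 1 <= d%:R :> R by rewrite ler1n.
have t1 : t < 1.
  by apply: (@le_lt_trans _ _ (d%:R * t)); [rewrite ler_peMl|apply: (le_lt_trans dt); lra].
case: z => x y; have [[Wx Wy]|nW] := pselect (tupset W x /\ tupset W y); last first.
  by rewrite kernel_weight_out // normr0.
rewrite kernel_weight_in //; set e := enorm _.
have e0 : 0 <= e by exact: enorm_ge0.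
have [er|er] := ltP r_w (e / s).
  by rewrite wr ?mul0r ?normr0 // ger0_norm // divr_ge0 // ltW.
have er' : e <= t * rho by apply: le_trans rs; rewrite -ler_pdivrMr.
have /andP[h1 _] := vol_translate_cap W cW bW convW c rho rho0 ballW (row_of_tuple x) (row_of_tuple y) t t0 t1 er'.
have h2 : 4^-1 * vol W <= cap_vol W (x, y).
  apply: le_trans h1; rewrite ler_pM2r //; apply: le_trans (bernoulli_ge t d t0 (ltW t1)).
  move: dt; set dd := _ * t => dt; lra.
have h3 : 0 < cap_vol W (x, y) by apply: lt_le_trans h2; rewrite mulr_gt0 // invr_gt0.
have /andP[w0 w1] := wm (e / s).
rewrite ger0_norm; last by rewrite divr_ge0 // ltW.
rewrite ler_pdivrMr //; apply: (le_trans w1).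
apply: (@le_trans _ _ (4 * m_w / vol W * (4^-1 * vol W))); last by rewrite ler_wpM2l.
by rewrite le_eqVlt; apply/orP; left; apply/eqP; field; rewrite gt_eqF.
Qed.

(** The ratio of [|W|] to the volume of the intersection lies between 1 and [(1 - t) ^ (-d)]; the
    errors of this ratio and of [w] are combined. *)
Lemma kernel_weight_near s t D e1 x y : 0 <= t -> t < 1 -> D <= t * rho -> 0 <= e1 ->
  tupset W x -> tupset W y -> enorm (row_diff (x, y)) <= D ->
  `|w (enorm (row_diff (x, y)) / s) - 1| <= e1 ->
  `|kernel_weight W w s (x, y) - (vol W)^-1| <=
     ((e1 + 1) * ((1 - t) ^+ d)^-1 - 1) / vol W.
Proof.
move=> t0 t1 Dt e10 Wx Wy eD we; rewrite kernel_weight_in //.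
set ww := w _ in we *.
have /andP[h1 h2] := vol_translate_cap W cW bW convW c rho rho0 ballW (row_of_tuple x) (row_of_tuple y) t t0 t1 (le_trans eD Dt).
rewrite -/(cap_vol W (x, y)) in h1 h2.
have q0 : 0 < (1 - t) ^+ d by rewrite exprn_gt0 // subr_gt0.
have c0 : 0 < cap_vol W (x, y) by apply: lt_le_trans h1; rewrite mulr_gt0.
pose r := vol W / cap_vol W (x, y).
have r1 : 1 <= r by rewrite ler_pdivlMr // mul1r.
have r2 : r <= ((1 - t) ^+ d)^-1.
  by rewrite ler_pdivrMr // mulrC ler_pdivlMr // mulrC.
have -> : ww / cap_vol W (x, y) - (vol W)^-1 = ((ww - 1) * r + (r - 1)) / vol W.
  by rewrite /r; field; rewrite !gt_eqF.
rewrite normrM [X in _ * X]gtr0_norm ?invr_gt0 // ler_pM2r ?invr_gt0 //.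
apply: (le_trans (ler_normD _ _)); rewrite normrM (ger0_norm (x := r - 1)) ?subr_ge0 //.
have r0 : 0 <= r by exact: le_trans r1.
rewrite (ger0_norm r0).
apply: (@le_trans _ _ ((e1 + 1) * r - 1)).
  by rewrite mulrDl mul1r -addrA lerD2r ler_wpM2r.
by rewrite lerD2r ler_wpM2l // addr_ge0.
Qed.

End window.

End kernel_weight.

(** The supremum that defines the inradius need not be attained; a ball with at least two thirds of
    that radius is enough. *)
Lemma inradius_ball {R : realType} {d : nat} (W : set 'rV[R]_d) : 0 < inradius W ->
  exists c (rho : R), [/\ 0 < rho, closed_eball c rho `<=` W & inradius W <= 3 / 2 * rho].
Proof.
move=> r0; pose S := [set r : R | 0 < r /\ exists2 x, W x & closed_eball x r `<=` W].
have hs : has_sup S by apply: contrapT => /sup_out; rewrite -/(inradius W) => z; rewrite z ltxx in r0.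
have e0 : 0 < inradius W / 3 by rewrite divr_gt0.
have [rho [rho0 [x Wx bx]] hr] := sup_adherent e0 hs.
exists x, rho; split => //; move: hr; rewrite -/(inradius W); lra.
Qed.

Lemma bounded_tuples_compact {R : realType} {d : nat} (W : set 'rV[R]_d) :
  compact W -> bounded_tuples (tupset W).
Proof.
move=> /compact_bounded [M [_ hM]]; exists (M + 1) => t Wt i.
have MM : M < M + 1 by rewrite ltrDl ltr01.
have h := hM (M + 1) MM _ Wt; apply: le_trans h.
by have := row_coord_le (row_of_tuple t) i; rewrite mxE.
Qed.

Lemma inradius_balls {R : realType} {d : nat} (W : nat -> set 'rV[R]_d) :
  inradius (W k) @[k --> \oo] --> +oo ->
  exists ctr (rho : nat -> R),
    (\forall k \near \oo, [/\ 0 < rho k, closed_eball (ctr k) (rho k) `<=` W k &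
       inradius (W k) <= 3 / 2 * rho k]) /\ rho k @[k --> \oo] --> +oo.
Proof.
move=> ir.
have H k : exists cr : 'rV[R]_d * R, 0 < inradius (W k) ->
   [/\ 0 < cr.2, closed_eball cr.1 cr.2 `<=` W k & inradius (W k) <= 3 / 2 * cr.2].
  have [r0|r0] := ltP 0 (inradius (W k)); last by exists (0, 0).
  by have [c [rho h]] := inradius_ball _ r0; exists (c, rho).
have [cr hcr] := choice H.
have ball : \forall k \near \oo, [/\ 0 < (cr k).2, closed_eball (cr k).1 (cr k).2 `<=` W k &
     inradius (W k) <= 3 / 2 * (cr k).2].
  have /cvgryPgt /(_ 0) h := ir.
  by apply: filterS h => k; exact: hcr.
exists (fun k => (cr k).1), (fun k => (cr k).2); split => //.
apply/cvgryPge => A; have /cvgryPge /(_ (3 / 2 * A)) h := ir.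
by apply: filterS2 ball h => k [_ _ h1] h2; have := le_trans h2 h1; rewrite ler_pM2l // divr_gt0.
Qed.

Section bandwidth.
Context {R : realType} (d : nat) (d0 : (0 < d)%N).
Variables (v b r rho : nat -> R) (r_w : R).
Hypothesis rw0 : 0 < r_w.
Hypothesis v0 : forall k, 0 <= v k.
Hypothesis b0 : forall k, 0 < b k.
Hypothesis r_rho : \forall k \near \oo, r k <= 3 / 2 * rho k.
Hypothesis b_le : \forall k \near \oo, b k <= r k / (2 * d%:R * r_w * v k `^ d%:R^-1).
Hypothesis b_cvg : b k @[k --> \oo] --> (0 : R).
Hypothesis bv_cvg : b k ^+ d * v k @[k --> \oo] --> +oo.
Hypothesis bv0_cvg : b k `^ (3 / 2 * d%:R) * v k @[k --> \oo] --> (0 : R).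
Let s k := b k * v k `^ d%:R^-1.

Let sd k : s k ^+ d = b k ^+ d * v k.
Proof.
rewrite /s exprMn -[X in _ * X = _]powR_mulrn ?powR_ge0 // -powRrM mulVf ?pnatr_eq0 -?lt0n //.
by rewrite powRr1.
Qed.

Lemma volume_gt0 : \forall k \near \oo, 0 < v k.
Proof.
have /cvgryPgt /(_ 0) h := bv_cvg; apply: filterS h => k.
by rewrite pmulr_rgt0 // exprn_gt0.
Qed.

Lemma volume_cvg : v k @[k --> \oo] --> +oo.
Proof.
apply/cvgryPge => A; have /cvgryPge /(_ `|A|) h := bv_cvg.
have /cvgrPdist_lt /(_ 1 ltr01) h1 := b_cvg.
apply: filterS2 h h1 => k hk bk.
have b1 : b k <= 1 by move: bk; rewrite sub0r normrN gtr0_norm //; exact: ltW.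
apply: (le_trans (ler_norm A)); apply: (le_trans hk).
by rewrite ler_piMl // exprn_ile1 // ltW.
Qed.

Lemma scale_gt0 : \forall k \near \oo, 0 < s k.
Proof. by apply: filterS volume_gt0 => k vk; rewrite mulr_gt0 // powR_gt0. Qed.

Lemma scale_ge1 x : \forall k \near \oo, x <= s k.
Proof.
have /cvgryPge /(_ (`|x| ^+ d)) h := bv_cvg.
apply: filterS h => k; rewrite -sd => h.
apply: (le_trans (ler_norm x)).
rewrite -(ler_pXn2r d0) ?nnegrE //.
by rewrite mulr_ge0 ?powR_ge0 // ltW.
Qed.

Lemma scale_cvg : s k @[k --> \oo] --> +oo.
Proof. by apply/cvgryPge => A; exact: scale_ge1. Qed.

(** The bound on the bandwidth says [r_w * s k <= r k / (2 d)], and the passage from the inradius to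
    an inscribed ball costs the factor [3/2]. The result [3 / (4 d)] is the ratio [t] with
    [d t = 3/4] for which the kernel weight is bounded. *)
Lemma scale_le : \forall k \near \oo, r_w * s k <= 3 / (4 * d%:R) * rho k.
Proof.
have dR : 0 < d%:R :> R by rewrite ltr0n.
near=> k; have vk : 0 < v k by near: k; exact: volume_gt0.
have bk : b k <= r k / (2 * d%:R * r_w * v k `^ d%:R^-1) by near: k.
have rk : r k <= 3 / 2 * rho k by near: k.
have V0 : 0 < v k `^ d%:R^-1 by exact: powR_gt0.
have h1 : b k * (2 * d%:R * r_w * v k `^ d%:R^-1) <= 3 / 2 * rho k.
  by apply: le_trans rk; rewrite -ler_pdivlMr // !mulr_gt0.
rewrite /s (_ : r_w * _ = b k * (2 * d%:R * r_w * v k `^ d%:R^-1) / (2 * d%:R)); last first.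
  by field; rewrite gt_eqF.
rewrite (_ : 3 / (4 * d%:R) * rho k = 3 / 2 * rho k / (2 * d%:R)); last first.
  by field; rewrite gt_eqF.
by rewrite ler_pM2r // invr_gt0 mulr_gt0.
Unshelve. all: by end_near.
Qed.

(** Since [s ^ d = b ^ d * v], the quotient [s ^ (3 d) / v] is the square of [b ^ (3 d / 2) * v].
    The constant [x] is absorbed because [s k] tends to infinity. *)
Lemma scale_pow_cvg x : (r_w * s k + x) ^+ (3 * d) / v k @[k --> \oo] --> (0 : R).
Proof.
have E k : 0 < v k -> s k ^+ (3 * d) / v k = (b k `^ (3 / 2 * d%:R) * v k) ^+ 2.
  move=> vk; rewrite mulnC exprM sd exprMn -exprM.
  rewrite (_ : (b k `^ (3 / 2 * d%:R) * v k) ^+ 2 = b k ^+ (d * 3) * v k ^+ 2).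
    by field; rewrite gt_eqF.
  rewrite exprMn -[X in X * _ = _]powR_mulrn ?powR_ge0 // -powRrM.
  rewrite -[X in _ = X * _]powR_mulrn ?(ltW (b0 k)) //.
  by congr (_ `^ _ * _); rewrite natrM; field.
have lim0 : (r_w + `|x|) ^+ (3 * d) * (b k `^ (3 / 2 * d%:R) * v k) ^+ 2 @[k --> \oo] --> (0 : R).
  have sq : (b k `^ (3 / 2 * d%:R) * v k) ^+ 2 @[k --> \oo] --> (0 * 0 : R).
    by under eq_fun do rewrite expr2; exact: cvgM.
  rewrite mul0r in sq.
  have := cvgM (cvg_cst ((r_w + `|x|) ^+ (3 * d))) sq.
  by rewrite mulr0; apply.
apply/cvgrPdist_lt => e e0; have /cvgrPdist_lt /(_ e e0) h := lim0.
near=> k; have vk : 0 < v k by near: k; exact: volume_gt0.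
have s1 : 1 <= s k by near: k; exact: scale_ge1.
have s2 : `|x| <= s k * r_w.
  by rewrite -ler_pdivrMr //; near: k; exact: scale_ge1.
have hk : `|0 - (r_w + `|x|) ^+ (3 * d) * (b k `^ (3 / 2 * d%:R) * v k) ^+ 2| < e by near: k.
apply: le_lt_trans hk; rewrite !sub0r !normrN -(E k vk).
have y0 : 0 <= r_w * s k + x.
  by have := ler_norm (- x); rewrite normrN mulrC; lra.
have y1 : r_w * s k + x <= (r_w + `|x|) * s k.
  rewrite mulrDl lerD2l; apply: (le_trans (ler_norm x)).
  by rewrite ler_peMr.
have s0 : 0 <= s k by exact: le_trans s1.
have x0 : 0 <= r_w + `|x| by rewrite addr_ge0 // ltW.
rewrite ger0_norm; last by rewrite divr_ge0 ?exprn_ge0 // ltW.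
rewrite [leRHS]ger0_norm; last first.
  by rewrite mulr_ge0 ?exprn_ge0 // divr_ge0 ?exprn_ge0 // ltW.
rewrite mulrA -exprMn ler_pM2r ?invr_gt0 //.
by apply: lerXn2r => //; rewrite nnegrE (le_trans y0 y1).
Unshelve. all: by end_near.
Qed.

End bandwidth.

(** * The estimator as a quadratic form, and Palm means *)

Section point_sums.
Context {R : realType} {d : nat} {dO : measure_display} {Omega : measurableType dO}
  {M : topologicalType} (P : probability Omega R).
Variable X : point_family R d Omega M.
Hypothesis X_mpp : is_marked_point_process X.
Variables (C C' : set M) (bC : borel C) (bC' : borel C').
Local Notation E := (d.-tuple (measurableTypeR R)).
Local Notation Y := (E * (bool * bool))%type.
Local Notation points := (points_in X C C').
Local Notation enc := (encode C C').

Section window.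
Variables (W : set 'rV[R]_d) (mW : measurable (tupset W)) (bW : bounded_tuples (tupset W)).

Let I om := indices_in X (tupset W) om.

Let finI om : finite_set (I om) := indices_in_finite X X_mpp (tupset W) mW bW om.

Let inW om n : mpp_index X om n -> ~ I om n -> \1_W (mpp_loc X n om) = 0 :> R.
Proof.
move=> nX nI; rewrite indicE memNset // => Wn; apply: nI; split => //.
by rewrite /tupset /= tuple_of_rowK.
Qed.

Let inW1 om n : I om n -> \1_W (mpp_loc X n om) = 1 :> R.
Proof. by move=> [_ Wn]; rewrite indicE mem_set //; move: Wn; rewrite /tupset /= tuple_of_rowK. Qed.

Lemma sum_pointsE (F : Y -> R) om :
  sum_points X om (fun z => \1_W z.1 * F (enc z)) = \sum_(y <- points (tupset W) om) F y.
Proof.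
rewrite /sum_points -(fsbig_widen (I om)); last 2 first.
- by move=> n [].
- by move=> n [nX nI] /=; rewrite (inW _ _ nX nI) mul0r.
rewrite fsbig_finite //= /points_in big_map big_seq [RHS]big_seq.
apply: eq_bigr => n; rewrite in_fset_set // => /set_mem nI.
by rewrite (inW1 _ _ nI) mul1r.
Qed.

(** Distinctness is a condition on the indices, so the sum is the full double sum over the window
    minus one diagonal term for each index. *)
Lemma sum_point_pairsE (F : Y -> Y -> R) om :
  sum_point_pairs X om (fun z z' => \1_W z.1 * \1_W z'.1 * F (enc z) (enc z')) =
  \sum_(y <- points (tupset W) om) \sum_(y' <- points (tupset W) om) F y y' -
  \sum_(y <- points (tupset W) om) F y y.
Proof.
pose z n := (mpp_loc X n om, mpp_mark X n om).
pose G (pq : nat * nat) := if pq.1 == pq.2 then 0 else F (enc (z pq.1)) (enc (z pq.2)).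
pose J := [set pq : nat * nat | [/\ I om pq.1, I om pq.2 & pq.1 <> pq.2]].
have JE : sum_point_pairs X om (fun z z' => \1_W z.1 * \1_W z'.1 * F (enc z) (enc z')) =
    \sum_(pq \in J) G pq.
  rewrite /sum_point_pairs -(fsbig_widen J); last 2 first.
  - by move=> pq [[h1 _] [h2 _] h3].
  - move=> [n n'] [[/= nX n'X nn'] nJ].
    have [nI|nI] := pselect (I om n); last by rewrite (inW _ _ nX nI) !mul0r.
    have [n'I|n'I] := pselect (I om n'); last by rewrite (inW _ _ n'X n'I) mulr0 mul0r.
    by exfalso; apply: nJ.
  apply: eq_fsbigr => -[n n'] /set_mem [/= nI n'I nn'].
  by rewrite (inW1 _ _ nI) (inW1 _ _ n'I) !mul1r /G /=; case: eqP.
rewrite JE (fsbig_widen J (I om `*` I om)); last 2 first.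
- by move=> pq [h1 h2 h3]; split.
- move=> [n n'] [[/= nI n'I] nJ]; rewrite /G /=; case: eqP => // nn'.
  by exfalso; apply: nJ.
transitivity (\sum_(n \in I om) \sum_(n' \in I om) G (n, n')).
  by rewrite pair_fsbig //; apply: eq_fsbigr => -[].
rewrite fsbig_finite //= /points_in !big_map -sumrB.
have us : uniq (fset_set (I om)) by exact: finmap.fset_uniq.
rewrite big_seq [RHS]big_seq; apply: eq_bigr => n nI.
rewrite fsbig_finite //= big_map (bigD1_seq n) //= [in RHS](bigD1_seq n) //=.
rewrite [X in X + _ = _](_ : _ = 0) ?add0r; last by rewrite /G /= eqxx.
rewrite [RHS]addrAC subrr add0r.
by apply: eq_bigr => n' nn'; rewrite /G /= eq_sym (negbTE nn').
Qed.

End window.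

Local Notation phi p := (centered fst p : Y -> R).
Local Notation phi' p' := (centered snd p' : Y -> R).

Let sub_indic (D D' : set M) z : \1_(D `&` D') z = (`[< D z >] && `[< D' z >])%:R :> R.
Proof. by rewrite indicE in_setI. Qed.

Let indic1 (D : set M) z : \1_D z = `[< D z >]%:R :> R.
Proof. by rewrite -[D]setIid sub_indic andbb setIid. Qed.

Section estimator.
Variables (W : set 'rV[R]_d) (cW : closed W) (bW : bounded_tuples (tupset W)).
Hypothesis (convW : convex_set (W : set (convex_lmodType 'rV[R]_d))).
Variables (c : 'rV[R]_d) (rho : R) (rho0 : 0 < rho).
Hypothesis ballW : closed_eball c rho `<=` W.
Hypothesis v0 : 0 < vol W.
Let mW := measurable_tupset W cW.
Local Notation p := (palm_mark P X C).
Local Notation p' := (palm_mark P X C').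
Local Notation xi om := (\sum_(y <- points (tupset W) om) phi p y).
Local Notation xi' om := (\sum_(y <- points (tupset W) om) phi' p' y).

Lemma mark_empiricalE om : mark_empirical P X W C om = (Num.sqrt (vol W))^-1 * xi om.
Proof.
by rewrite /mark_empirical -(sum_pointsE W mW bW).
Qed.

Lemma mark_empiricalE' om : mark_empirical P X W C' om = (Num.sqrt (vol W))^-1 * xi' om.
Proof.
by rewrite /mark_empirical -(sum_pointsE W mW bW).
Qed.

Definition flat_weight (z : E * E) : R := \1_(tupset W) z.1 * \1_(tupset W) z.2 * (vol W)^-1.

Lemma mark_empirical_prod om :
  mark_empirical P X W C om * mark_empirical P X W C' om = quad X C C' p p' (tupset W) flat_weight om.
Proof.
rewrite mark_empiricalE mark_empiricalE' mulrACA -invfM -expr2 sqr_sqrtr ?(ltW v0) //.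
rewrite /quad mulr_suml mulr_sumr big_seq [RHS]big_seq; apply: eq_bigr => y yW.
rewrite !mulr_sumr big_seq [RHS]big_seq; apply: eq_bigr => y' y'W.
rewrite /flat_weight /= !indicE !mem_set ?mul1r //.
  exact: (points_in_window X X_mpp C C' _ mW bW om).
exact: (points_in_window X X_mpp C C' _ mW bW om).
Qed.

(** On the diagonal the kernel weight is [1 / |W|] because [w 0 = 1]. Adding and removing the
    diagonal leaves [1_C 1_C' - p p' - phi phi' = p' phi + p phi'] for the single sum. *)
Lemma cov_estimatorE (w : R -> R) (b : R) om : w 0 = 1 ->
  cov_estimator P X W w b C C' om =
  (vol W)^-1 * (p' * xi om + p * xi' om) +
  quad X C C' p p' (tupset W) (kernel_weight W w (b * vol W `^ d%:R^-1)) om.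
Proof.
move=> w1; rewrite /cov_estimator.
pose kw (z : E * E) := w (enorm (row_diff z) / (b * vol W `^ d%:R^-1)) / cap_vol W z.
have -> : (fun z : 'rV[R]_d * M => \1_W z.1 * (\1_(C `&` C') z.2 - p * p')) =
    (fun z => \1_W z.1 * (fun y : Y => (y.2.1 && y.2.2)%:R - p * p') (enc z)).
  by apply/funext => z; rewrite sub_indic.
rewrite (sum_pointsE W mW bW (fun y : Y => (y.2.1 && y.2.2)%:R - p * p')).
have -> : (fun z z' : 'rV[R]_d * M =>
    \1_W z.1 * \1_W z'.1 * (\1_C z.2 - p) * (\1_C' z'.2 - p')
      / vol (translate W z.1 `&` translate W z'.1)
      * w (enorm (z'.1 - z.1) / (b * vol W `^ d%:R^-1))) =
   (fun z z' => \1_W z.1 * \1_W z'.1 *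
     (fun y y' : Y => kw (y.1, y'.1) * (phi p y * phi' p' y')) (enc z) (enc z')).
  apply/funext => z; apply/funext => z'.
  rewrite /kw /row_diff /cap_vol /= !tuple_of_rowK /centered /= !indic1.
  by rewrite -!mulrA; congr (_ * (_ * _)); ring.
rewrite (sum_point_pairsE W mW bW (fun y y' : Y => kw (y.1, y'.1) * (phi p y * phi' p' y'))).
have kE t u : tupset W t -> tupset W u ->
    kw (t, u) = kernel_weight W w (b * vol W `^ d%:R^-1) (t, u).
  by move=> Wt Wu; rewrite kernel_weight_in.
have inP y : y \in points (tupset W) om -> tupset W y.1.
  exact: (points_in_window X X_mpp C C' _ mW bW om).
have -> : \sum_(y <- points (tupset W) om) \sum_(y' <- points (tupset W) om)
      kw (y.1, y'.1) * (phi p y * phi' p' y') =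
    quad X C C' p p' (tupset W) (kernel_weight W w (b * vol W `^ d%:R^-1)) om.
  rewrite /quad big_seq [RHS]big_seq; apply: eq_bigr => y /inP yW.
  by rewrite big_seq [RHS]big_seq; apply: eq_bigr => y' /inP y'W; rewrite kE.
have -> : \sum_(y <- points (tupset W) om) kw (y.1, y.1) * (phi p y * phi' p' y) =
   (vol W)^-1 * \sum_(y <- points (tupset W) om) phi p y * phi' p' y.
  rewrite mulr_sumr big_seq [RHS]big_seq; apply: eq_bigr => y /inP yW.
  by rewrite kE // (kernel_weight_diag W cW bW convW c rho rho0 ballW).
rewrite addrCA [RHS]addrC; congr (_ + _).
rewrite -mulrBr; congr (_ * _); rewrite !mulr_sumr -sumrB -big_split /=.
apply: eq_bigr => y _; rewrite /centered.
by case: y => t [[] []] /=; ring.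
Qed.

End estimator.

Lemma unit_cell_count (g : bool * bool -> bool) (D : set M) om :
  (forall z, g (`[< C z >], `[< C' z >]) <-> D z) ->
  mpp_count X om (unit_cube_halfopen `*` D) =
  (\sum_(y <- points (cell 0) om) (g y.2)%:R)%:E.
Proof.
move=> gD; rewrite -(mpp_count_points X X_mpp C C' (cell 0) g om (measurable_cell 0) (bounded_cell 0)).
congr (mpp_count X om _); apply/seteqP; split=> -[x z] /=.
  move=> [cx Dz]; split; first exact/gD.
  by split => //= i; rewrite tnth_mktuple ffunE add0r.
by move=> [/gD Dz [cx _]]; split => //= i; have := cx i; rewrite tnth_mktuple ffunE add0r.
Qed.

End point_sums.

Section palm_mean.
Context {R : realType} {d : nat} {dO : measure_display} {Omega : measurableType dO}
  {M : topologicalType} (P : probability Omega R).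
Variable X : point_family R d Omega M.
Hypothesis X_mpp : is_marked_point_process X.
Hypothesis X_stationary : stationary P X.
Variables (C C' : set M) (bC : borel C) (bC' : borel C').
Variables (q : R) (q4 : 4 < q).
Hypothesis X_moment :
  (\int[P]_om (mpp_count X om (unit_cube `*` setT) `^ q) < +oo)%E.
Hypothesis lambda_gt0 : (0 < intensity P X)%E.

Let cnt (g : bool * bool -> bool) : R :=
  \int[P]_om \sum_(y <- points_in X C C' (cell 0) om) (g y.2)%:R.

Let icnt (g : bool * bool -> bool) :
  integrableR P (fun om => \sum_(y <- points_in X C C' (cell 0) om) ((g y.2)%:R : R)).
Proof.
have := integrable_mean_sum P X X_mpp X_stationary C C' bC bC' q q4 X_moment g 0 (cell 0)
  (measurable_cell 0) (bounded_cell 0).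
by under eq_fun do under eq_bigr do rewrite /centered subr0.
Qed.

Let cntE (g : bool * bool -> bool) (D : set M) :
  (forall z, g (`[< C z >], `[< C' z >]) <-> D z) ->
  (\int[P]_om mpp_count X om (unit_cube_halfopen `*` D) = (cnt g)%:E)%E.
Proof.
move=> gD; rewrite /cnt /Rintegral fineK; last exact: (integrable_fin_num measurableT (icnt g)).
by apply: eq_integral => om _; exact: unit_cell_count.
Qed.

Let mean_cnt g p : mean_sum P X C C' g p (cell 0) = cnt g - p * cnt (fun=> true).
Proof.
pose A (f : bool * bool -> bool) om : R := \sum_(y <- points_in X C C' (cell 0) om) (f y.2)%:R.
have eB : \int[P]_om (A g om - p * A (fun=> true) om) = cnt g - \int[P]_om (p * A (fun=> true) om).
  exact: (RintB P _ _ (icnt g) (integrableRZ P p _ (icnt (fun=> true)))).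
have eZ : \int[P]_om (p * A (fun=> true) om) = p * cnt (fun=> true).
  exact: (RintZ P p _ (icnt (fun=> true))).
rewrite -eZ -eB; apply: eq_Rintegral => om _.
by rewrite /A mulr_sumr -sumrB; apply: eq_bigr => y _; rewrite mulr1.
Qed.

Let cntT : (intensity P X = (cnt (fun=> true))%:E)%E.
Proof. by apply: cntE => z; split. Qed.

Let cntT0 : 0 < cnt (fun=> true).
Proof. by rewrite -lte_fin -cntT. Qed.

Lemma intensity_mean_gt0 : 0 < mean_sum P X C C' (fun=> true) 0 (cell 0).
Proof. by rewrite mean_cnt mul0r subr0. Qed.

(** The Palm probability is the ratio of the mean number of points of the cell with mark in [D] to
    the mean number of all its points, so centring by it gives mean zero. *)
Let palm_mean0 (g : bool * bool -> bool) (D : set M) : (forall z, g (`[< C z >], `[< C' z >]) <-> D z) ->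
  mean_sum P X C C' g (palm_mark P X D) (cell 0) = 0.
Proof.
move=> gD; rewrite mean_cnt /palm_mark (cntE g D gD) cntT /= divfK ?subrr //.
by rewrite gt_eqF.
Qed.

Lemma palm_mean_fst : mean_sum P X C C' fst (palm_mark P X C) (cell 0) = 0.
Proof. by apply: palm_mean0 => z; split => /= /asboolP. Qed.

Lemma palm_mean_snd : mean_sum P X C C' snd (palm_mark P X C') (cell 0) = 0.
Proof. by apply: palm_mean0 => z; split => /= /asboolP. Qed.

End palm_mean.

(** With [a = x - z], [e = y - z], and [f], [g] the two linear terms, the left side is
    [(a - e - f - g) ^ 2]. The sum of squares [h] is exactly the defect of the bound
    [3 (a ^ 2 + e ^ 2) + 6 (f ^ 2 + g ^ 2)]. *)
Lemma square_split_le {R : realFieldType} (x y z r t u p p' : R) :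
  (x - (r * (p' * t + p * u) + y)) ^+ 2 <=
  3 * ((x - z) ^+ 2 + (y - z) ^+ 2) +
    6 * r ^+ 2 * (p' ^+ 2 * (t * t) + p ^+ 2 * (u * u)).
Proof.
pose a := x - z; pose e := y - z; pose f := r * (p' * t); pose g := r * (p * u).
have h : 0 <= (a + e) ^+ 2 + (a + f + g) ^+ 2 + (e - f - g) ^+ 2 + 3 * (f - g) ^+ 2.
  apply: addr_ge0; last by apply: mulr_ge0; [exact: ler0n|exact: sqr_ge0].
  by apply: addr_ge0; [apply: addr_ge0|]; exact: sqr_ge0.
rewrite -subr_ge0; apply: le_trans h _.
by rewrite le_eqVlt; apply/orP; left; apply/eqP; rewrite /a /e /f /g; ring.
Qed.

(** * Consistency along the sequence of windows *)

Section window_limits.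
Context {R : realType} {d : nat} {dO : measure_display} {Omega : measurableType dO}
  {M : topologicalType} (P : probability Omega R).
Variable X : point_family R d Omega M.
Hypothesis d0 : (0 < d)%N.
Hypothesis X_mpp : is_marked_point_process X.
Hypothesis X_stationary : stationary P X.
Variables (q : R) (q4 : 4 < q).
Hypothesis X_moment :
  (\int[P]_om (mpp_count X om (unit_cube `*` setT) `^ q) < +oo)%E.
Hypothesis lambda_gt0 : (0 < intensity P X)%E.
Variables (beta : R -> R) (beta_rate : mixing_rate P X beta).
Hypothesis cov_sum : exists2 A : R, 0 <= A & forall L N,
  \sum_(v <- @box d N) cov_decay q beta L (site_norm v) <= A * L.+1%:R ^+ d.
Variables (W : nat -> set 'rV[R]_d) (ctr : nat -> 'rV[R]_d) (rho : nat -> R) (N : nat -> nat).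
Hypothesis cW : forall k, closed (W k).
Hypothesis bW : forall k, bounded_tuples (tupset (W k)).
Hypothesis convW : forall k, convex_set (W k : set (convex_lmodType 'rV[R]_d)).
Hypothesis ballW : \forall k \near \oo, 0 < rho k /\ closed_eball (ctr k) (rho k) `<=` W k.
Hypothesis rho_cvg : rho k @[k --> \oo] --> +oo.
Hypothesis v0 : \forall k \near \oo, 0 < vol (W k).
Hypothesis WN : forall k, tupset (W k) `<=` box_region (N k).
Variables (w : R -> R) (m_w r_w : R) (s : nat -> R).
Hypothesis w_ge0 : forall t, 0 <= w t.
Hypothesis mw : measurable_fun [set: R] w.
Hypothesis w1 : w 0 = 1.
Hypothesis w_cvg : w t @[t --> 0] --> (1 : R).
Hypothesis w_le : forall t, w t <= m_w.
Hypothesis rw0 : 0 < r_w.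
Hypothesis w_out : forall t, r_w < `|t| -> w t = 0.
Hypothesis s0 : \forall k \near \oo, 0 < s k.
Hypothesis s_cvg : s k @[k --> \oo] --> +oo.
Hypothesis s_le : \forall k \near \oo, r_w * s k <= 3 / (4 * d%:R) * rho k.
Hypothesis s_pow : (r_w * s k + 3) ^+ (3 * d) / vol (W k) @[k --> \oo] --> (0 : R).

Local Notation E := (d.-tuple (measurableTypeR R)).
Local Notation v k := (vol (W k)).

Let mW k : measurable (tupset (W k)) := measurable_tupset (W k) (cW k).

Let m_w0 : 0 < m_w. Proof. by apply: lt_le_trans (w_le 0); rewrite w1. Qed.

Lemma flat_weight_out (V : set 'rV[R]_d) t u :
  ~ (tupset V t /\ tupset V u) -> flat_weight V (t, u) = 0.
Proof.
rewrite /flat_weight !indicE /= => n.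
case: (boolP (t \in _)) => [/set_mem Wt|]; last by rewrite !mul0r.
case: (boolP (u \in _)) => [/set_mem Wu|]; last by rewrite mulr0 mul0r.
by exfalso; apply: n.
Qed.

Lemma flat_weight_le (V : set 'rV[R]_d) z : 0 < vol V -> `|flat_weight V z| <= 1 / vol V.
Proof.
move=> V0; rewrite /flat_weight !indicE normrM [X in _ * X]gtr0_norm ?invr_gt0 //.
rewrite ler_pM2r ?invr_gt0 //.
by case: (_ \in _); case: (_ \in _); rewrite ?mul1r ?mul0r ?mulr0 ?normr1 ?normr0.
Qed.

Lemma measurable_flat_weight k : measurable_fun setT (flat_weight (W k)).
Proof.
have mi : measurable_fun setT (\1_(tupset (W k)) : E -> R) by exact: measurable_indic.
apply: measurable_funM => //.
by apply: measurable_funM; [exact: (measurableT_comp mi)|exact: (measurableT_comp mi)].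
Qed.

Local Notation kw k := (kernel_weight (W k) w (s k)).

Let kw_bound : \forall k \near \oo, forall e, `|kw k e| <= (4 * m_w) / v k.
Proof.
have dR : 0 < d%:R :> R by rewrite ltr0n.
near=> k => e.
have [rk bk] : 0 < rho k /\ closed_eball (ctr k) (rho k) `<=` W k by near: k.
have vk : 0 < v k by near: k.
have sk : 0 < s k by near: k.
apply: (kernel_weight_le (W k) (cW k) (bW k) (@convW k) (ctr k) (rho k) rk bk vk w (s k)
  (3 / (4 * d%:R)) m_w r_w) => //.
- by move=> x; rewrite w_ge0 w_le.
- by rewrite le_eqVlt; apply/orP; left; apply/eqP; field; rewrite gt_eqF.
- by near: k.
Unshelve. all: by end_near.
Qed.

(** Points at bounded distance are close relative to [s k], so that [w] is near 1, and relative to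
    the inscribed radius, so that the intersection of the translates has almost full volume. *)
Let kw_close n eps : 0 < eps -> \forall k \near \oo, forall t u,
  tupset (W k) t -> tupset (W k) u -> (forall i, `|tnth u i - tnth t i| <= n%:R + 1) ->
  `|kw k (t, u) - (v k)^-1| <= eps / v k.
Proof.
move=> eps0; pose D : R := d%:R * (n%:R + 1).
have D0 : 0 <= D by rewrite mulr_ge0 // addr_ge0.
pose e1 := eps / 2; have e10 : 0 < e1 by rewrite divr_gt0.
have [del /= del0 wdel] : exists2 del, 0 < del & forall x, `|x| < del -> `|w x - 1| <= e1.
  have /cvgrPdist_le /(_ _ e10) [del /= del0 hdel] := w_cvg.
  exists del => // x xd; rewrite distrC; apply: hdel.
  by rewrite /ball /= sub0r normrN.
have rcv : D / rho k @[k --> \oo] --> (0 : R).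
  have : D * (rho k)^-1 @[k --> \oo] --> D * (0 : R).
    apply: cvgM; first exact: cvg_cst.
    apply/gtr0_cvgV0; last exact: rho_cvg.
    by near=> k; have [] : 0 < rho k /\ closed_eball (ctr k) (rho k) `<=` W k by near: k.
  by rewrite mulr0.
have lim : (e1 + 1) * ((1 - D / rho k) ^+ d)^-1 - 1 @[k --> \oo] --> (e1 + 1) * ((1 - 0) ^+ d)^-1 - 1.
  apply: cvgB; last exact: cvg_cst.
  apply: cvgM; first exact: cvg_cst.
  apply: cvgV; first by rewrite subr0 expr1n oner_neq0.
  by apply: cvg_exprn; apply: cvgB => //; exact: cvg_cst.
rewrite subr0 expr1n invr1 mulr1 addrK in lim.
have /cvgrPdist_lt /(_ _ e10) near1 := lim.
have /cvgrPdist_lt /(_ _ ltr01) near2 := rcv.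
have /cvgryPgt /(_ (D / del)) near3 := s_cvg.
near=> k => t u Wt Wu tu.
have [rk bk] : 0 < rho k /\ closed_eball (ctr k) (rho k) `<=` W k by near: k.
have vk : 0 < v k by near: k.
have sk : 0 < s k by near: k.
have h1 : `|e1 - ((e1 + 1) * ((1 - D / rho k) ^+ d)^-1 - 1)| < e1 by near: k.
have h2 : `|0 - D / rho k| < 1 by near: k.
have h3 : D / del < s k by near: k.
have t0 : 0 <= D / rho k by rewrite divr_ge0 // ltW.
have t1 : D / rho k < 1 by move: h2; rewrite sub0r normrN ger0_norm.
have eD : enorm (row_diff (t, u)) <= D.
  apply: enorm_le; first by rewrite addr_ge0.
  by move=> i; rewrite !mxE; exact: tu.
have we : `|w (enorm (row_diff (t, u)) / s k) - 1| <= e1.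
  apply: wdel; rewrite ger0_norm; last by rewrite divr_ge0 ?enorm_ge0 // ltW.
  rewrite ltr_pdivrMr //; apply: (le_lt_trans eD); rewrite mulrC -ltr_pdivrMr //.
have Dt : D <= D / rho k * rho k by rewrite divfK ?gt_eqF.
apply: (le_trans (kernel_weight_near (W k) (cW k) (bW k) (@convW k) (ctr k) (rho k) rk bk vk w (s k)
  (D / rho k) D e1 t u t0 t1 Dt (ltW e10) Wt Wu eD we)).
rewrite ler_pM2r ?invr_gt0 //.
move: h1; rewrite distrC ltr_norml => /andP[_ h1].
by rewrite (splitr eps) -/e1; apply: ltW; rewrite -ltrBlDr.
Unshelve. all: by end_near.
Qed.

Let Ls k := (Num.truncn (r_w * s k)).+1.

Let kw_far k : 0 < s k -> forall t u i, (Ls k)%:R < `|tnth u i - tnth t i| -> kw k (t, u) = 0.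
Proof.
move=> sk t u i tu; rewrite /kernel_weight w_out ?mul0r ?mulr0 //.
have rs : r_w * s k < (Ls k)%:R by exact: truncnS_gt.
rewrite ger0_norm; last by rewrite divr_ge0 ?enorm_ge0 // ltW.
rewrite ltr_pdivlMr //; apply: (lt_trans rs); apply: (lt_le_trans tu).
by have := enorm_coord (row_diff (t, u)) i; rewrite !mxE.
Qed.

Section pair.
Variables (C C' : set M) (bC : borel C) (bC' : borel C').
Local Notation p := (palm_mark P X C).
Local Notation p' := (palm_mark P X C').

(** The product of the empirical marks is the quadratic form with weight [1 / |W_k|], so
    [quad_mean_cvg] gives it the same limit as the kernel form. Any two limits of the cell
    covariances along boxes agree, and here one [sigma] is fixed beforehand for both forms. *)
Lemma pair_limits : exists sigma : R,
  [/\ \int[P]_om (mark_empirical P X (W k) C om * mark_empirical P X (W k) C' om)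
        @[k --> \oo] --> sigma,
      \int[P]_om quad X C C' p p' (tupset (W k)) (kw k) om @[k --> \oo] --> sigma,
      \forall k \near \oo,
        [/\ integrableR P (fun om => mark_empirical P X (W k) C om * mark_empirical P X (W k) C' om),
            integrableR P (quad X C C' p p' (tupset (W k)) (kw k)) &
            integrableR P (fun om => (quad X C C' p p' (tupset (W k)) (kw k) om -
              \int[P]_om quad X C C' p p' (tupset (W k)) (kw k) om) ^+ 2)] &
      \int[P]_om (quad X C C' p p' (tupset (W k)) (kw k) om -
              \int[P]_om quad X C C' p p' (tupset (W k)) (kw k) om) ^+ 2 @[k --> \oo] --> (0 : R)].
Proof.
have [m m0 mom] := cell_moment P X X_mpp X_stationary C C' bC bC' q (lt_trans (ltr0n R 4) q4) X_moment.
have lam0 := intensity_mean_gt0 P X X_mpp X_stationary C C' bC bC' q q4 X_moment lambda_gt0.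
have mean1 := palm_mean_snd P X X_mpp X_stationary C C' bC bC' q q4 X_moment lambda_gt0.
have [sigma hsigma] := cell_cov_cvg P X X_mpp X_stationary C C' bC bC' q q4 X_moment beta beta_rate
  cov_sum p p' lam0 mean1 m mom.
have K0 : 0 < 4 * m_w by rewrite mulr_gt0.
have mkw k := measurable_kernel_weight (W k) (cW k) w (s k) mw.
have kwo k t u := kernel_weight_out (W k) w (s k) t u.
have var := quad_variance P X X_mpp X_stationary C C' bC bC' q q4 X_moment beta beta_rate
  cov_sum p p' lam0 m mom.
exists sigma; split.
- have main := quad_mean_cvg P X X_mpp X_stationary C C' bC bC' q q4 X_moment beta beta_rate cov_sum p p'
    lam0 mean1 m mom W ctr rho N cW bW convW ballW rho_cvg v0 WN (fun k => flat_weight (W k)) 1 sigma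
    ltr01 hsigma measurable_flat_weight.
  apply: cvg_trans (main _ _ _).
  + apply: near_eq_cvg; near=> k; have vk : 0 < v k by near: k.
    by apply: eq_Rintegral => om _; rewrite (mark_empirical_prod P X X_mpp C C' (W k) (cW k) (bW k) vk).
  + by near=> k => e; apply: flat_weight_le; near: k.
  + by move=> k t u; exact: flat_weight_out.
  + move=> n eps eps0; near=> k => t u Wt Wu _; have vk : 0 < v k by near: k.
    by rewrite /flat_weight !indicE !mem_set // !mul1r subrr normr0 divr_ge0 // ltW.
- exact: (quad_mean_cvg P X X_mpp X_stationary C C' bC bC' q q4 X_moment beta beta_rate cov_sum p p'
    lam0 mean1 m mom W ctr rho N cW bW convW ballW rho_cvg v0 WN (fun k => kw k) (4 * m_w) sigma
    K0 hsigma mkw kw_bound kwo kw_close).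
- near=> k; have vk : 0 < v k by near: k.
  have kb : forall e, `|kw k e| <= 4 * m_w / v k by near: k.
  have Kv : 0 < 4 * m_w / v k by exact: divr_gt0.
  have sk : 0 < s k by near: k.
  split; last first.
  + by have [? _ /(_ _ _ _ _ _ (mW k) (@WN k) (mkw k) Kv kb (@kwo k) (kw_far k sk)) []] := var.
  + exact: (integrable_quad P X X_mpp C C' bC bC' q q4 p p' m mom (W k) (N k) _ _ (mW k) (@WN k) (mkw k) Kv kb (@kwo k)).
  have v1 : 0 < 1 / v k by exact: divr_gt0.
  have := integrable_quad P X X_mpp C C' bC bC' q q4 p p' m mom (W k) (N k) _ _ (mW k) (@WN k)
    (measurable_flat_weight k) v1 (fun e => flat_weight_le _ e vk) (@flat_weight_out (W k)).
  congr (integrableR P _); apply/funext => om.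
  by rewrite (mark_empirical_prod P X X_mpp C C' (W k) (cW k) (bW k) vk).
- have [A A0 hA] := var.
  (* The variance bound with weights of size [4 m_w / |W_k|] and range [Ls k], arranged as a cell
     count over [|W_k|], which tends to 1, times the quotient that tends to zero. *)
  pose up k := A * (4 * m_w) ^+ 2 * ((size (hit_sites (W k) (N k)))%:R / v k) *
    ((r_w * s k + 3) ^+ (3 * d) / v k).
  have up_cvg : up k @[k --> \oo] --> A * (4 * m_w) ^+ 2 * 1 * (0 : R).
    apply: cvgM => //; apply: cvgM; first exact: cvg_cst.
    exact: (hit_sites_cvg W ctr rho N cW bW convW ballW rho_cvg v0 WN).
  rewrite mulr0 in up_cvg.
  apply: (squeeze_cvgr _ (cvg_cst 0) up_cvg).
  near=> k; have vk : 0 < v k by near: k.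
  have kb : forall e, `|kw k e| <= 4 * m_w / v k by near: k.
  have Kv : 0 < 4 * m_w / v k by exact: divr_gt0.
  have sk : 0 < s k by near: k.
  have [_ le] := hA (W k) (N k) (kw k) _ _ (mW k) (@WN k) (mkw k) Kv kb (@kwo k) (kw_far k sk).
  apply/andP; split; first by apply: Rint_ge0 => om; exact: sqr_ge0.
  apply: (le_trans le); rewrite /up.
  rewrite [leRHS](_ : _ = A * ((4 * m_w / v k) ^+ 2 * (size (hit_sites (W k) (N k)))%:R *
    (r_w * s k + 3) ^+ (3 * d))); last by field; rewrite gt_eqF.
  have rs0 : 0 <= r_w * s k by rewrite mulr_ge0 // ltW.
  apply: ler_wpM2l => //; apply: ler_wpM2l; first by rewrite mulr_ge0 // sqr_ge0.
  have tr : (Num.truncn (r_w * s k))%:R <= r_w * s k by have /andP[] := truncn_itv rs0.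
  have b : (Ls k).+1%:R <= r_w * s k + 3.
    by rewrite /Ls -[_.+2]addn2 natrD; apply: lerD => //; rewrite ler_nat.
  by apply: lerXn2r => //; rewrite nnegrE; [exact: ler0n|exact: addr_ge0].
Unshelve. all: by end_near.
Qed.

End pair.
Hypothesis v_cvg : vol (W k) @[k --> \oo] --> +oo.
Variables (b : nat -> R) (sb : forall k, s k = b k * vol (W k) `^ d%:R^-1).

(** The error splits into the bias of the kernel form, its deviation from its mean, and the linear
    term [|W_k| ^ (-1/2) (p' Y_k(C) + p Y_k(C'))], whose second moment is of order [1 / |W_k|]. *)
Lemma cov_estimator_consistent (C C' : set M) : borel C -> borel C' -> exists sigma : R,
  [/\ \int[P]_om (mark_empirical P X (W k) C om * mark_empirical P X (W k) C' om)
        @[k --> \oo] --> sigma,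
      \int[P]_om (sigma - cov_estimator P X (W k) w (b k) C C' om) ^+ 2 @[k --> \oo] --> (0 : R) &
      \forall k \near \oo,
        integrableR P (fun om => mark_empirical P X (W k) C om * mark_empirical P X (W k) C' om) /\
        integrableR P (fun om => (sigma - cov_estimator P X (W k) w (b k) C C' om) ^+ 2)].
Proof.
move=> bC bC'.
have [sigma [lY lS int lV]] := pair_limits C C' bC bC'.
(* The pairs [(C, C)] and [(C', C')] provide convergence, hence boundedness, of the second moments
   of [Y_k(C)] and [Y_k(C')] in the linear term. *)
have [sigma1 [lY1 _ int1 _]] := pair_limits C C bC bC.
have [sigma2 [lY2 _ int2 _]] := pair_limits C' C' bC' bC'.
pose p := palm_mark P X C; pose p' := palm_mark P X C'.
pose Y k om := mark_empirical P X (W k) C om.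
pose Y' k om := mark_empirical P X (W k) C' om.
pose S k om := quad X C C' p p' (tupset (W k)) (kw k) om.
pose ES k := \int[P]_om S k om.
pose est k om := cov_estimator P X (W k) w (b k) C C' om.
pose G k om := 3 * ((sigma - ES k) ^+ 2 + (S k om - ES k) ^+ 2) +
  6 / v k * (p' ^+ 2 * (Y k om * Y k om) + p ^+ 2 * (Y' k om * Y' k om)).
have main : \forall k \near \oo, [/\ integrableR P (fun om => (sigma - est k om) ^+ 2),
    integrableR P (G k) & forall om, (sigma - est k om) ^+ 2 <= G k om].
  apply: filterS (filterI (filterI int (filterI int1 int2)) (filterI v0 ballW)) => k.
  move=> [[[i1 iS iV] [[iYY _ _] [iYY' _ _]]] [vk [rk bk]]].
  have YE om := mark_empiricalE P X X_mpp C C' (W k) (cW k) (bW k) om.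
  have YE' om := mark_empiricalE' P X X_mpp C C' (W k) (cW k) (bW k) om.
  have mY : measurable_fun setT (Y k).
    rewrite (_ : Y k = fun om => (Num.sqrt (v k))^-1 *
        \sum_(y <- points_in X C C' (tupset (W k)) om) centered fst p y); last first.
      by apply/funext => om; exact: YE.
    apply: measurable_funM; first exact: measurable_cst.
    apply: (integrableR_measurable P).
    exact: (integrable_mean_sum P X X_mpp X_stationary C C' bC bC' q q4 X_moment fst p _ (mW k) (bW k)).
  have mY' : measurable_fun setT (Y' k).
    rewrite (_ : Y' k = fun om => (Num.sqrt (v k))^-1 *
        \sum_(y <- points_in X C C' (tupset (W k)) om) centered snd p' y); last first.
      by apply/funext => om; exact: YE'.
    apply: measurable_funM; first exact: measurable_cst.
    apply: (integrableR_measurable P).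
    exact: (integrable_mean_sum P X X_mpp X_stationary C C' bC bC' q q4 X_moment snd p' _ (mW k) (bW k)).
  pose r := (Num.sqrt (v k))^-1.
  have r2 : r ^+ 2 = (v k)^-1 by rewrite /r exprVn sqr_sqrtr // ltW.
  have estE om : est k om = r * (p' * Y k om + p * Y' k om) + S k om.
    rewrite /est (cov_estimatorE P X X_mpp C C' (W k) (cW k) (bW k) (@convW k) (ctr k) (rho k) rk bk w (b k) om w1).
    rewrite -sb /Y /Y' YE YE' -r2 /S -/p -/p' -/r; congr (_ + _).
    by set x := \sum_(y <- _) _; set x' := \sum_(y <- _) _; rewrite expr2; ring.
  have le om : (sigma - est k om) ^+ 2 <= G k om.
    rewrite estE /G (_ : 6 / v k = 6 * r ^+ 2); last by rewrite r2.
    exact: square_split_le.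
  have iG : integrableR P (G k).
    apply: integrableRD; apply: integrableRZ; apply: integrableRD => //.
    - exact: integrableR_cst.
    - exact: integrableRZ.
    - exact: integrableRZ.
  split => //; apply: integrableR_le iG.
    rewrite (_ : (fun om => _) = fun om => (sigma - (r * (p' * Y k om + p * Y' k om) + S k om)) ^+ 2); last first.
      by apply/funext => om; rewrite estE.
    apply: measurable_funX; apply: measurable_funB => //; apply: measurable_funD; last exact: integrableR_measurable iS.
    by apply: measurable_funM => //; apply: measurable_funD; apply: measurable_funM.
  by move=> om; rewrite ger0_norm ?sqr_ge0.
exists sigma; split => //; last first.
  by apply: filterS2 int main => k [h _ _] [h' _ _].
pose up k := 3 * ((sigma - ES k) ^+ 2 + \int[P]_om (S k om - ES k) ^+ 2) +
  6 * (v k)^-1 * (p' ^+ 2 * \int[P]_om (Y k om * Y k om) + p ^+ 2 * \int[P]_om (Y' k om * Y' k om)).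
have vinv : (v k)^-1 @[k --> \oo] --> (0 : R) by apply/gtr0_cvgV0; [exact: v0|exact: v_cvg].
have up_cvg : up k @[k --> \oo] --> 3 * ((sigma - sigma) ^+ 2 + 0) + 6 * 0 * (p' ^+ 2 * sigma1 + p ^+ 2 * sigma2).
  apply: cvgD; apply: cvgM.
  - exact: cvg_cst.
  - by apply: cvgD => //; apply: cvg_exprn; apply: cvgB => //; exact: cvg_cst.
  - by apply: cvgM => //; exact: cvg_cst.
  - by apply: cvgD; apply: cvgM => //; exact: cvg_cst.
rewrite subrr expr0n /= addr0 !mulr0 mul0r addr0 in up_cvg.
apply: (squeeze_cvgr _ (cvg_cst 0) up_cvg).
apply: filterS (filterI main (filterI int (filterI int1 int2))) => k.
move=> [[iest iG le] [[_ iS iV] [[iYY _ _] [iYY' _ _]]]].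
apply/andP; split; first by apply: Rint_ge0 => om; exact: sqr_ge0.
apply: (le_trans (Rint_le P _ _ iest iG le)).
have j1 := integrableRZ P (p' ^+ 2) _ iYY; have j2 := integrableRZ P (p ^+ 2) _ iYY'.
have j3 := integrableRD P _ _ (integrableR_cst P ((sigma - ES k) ^+ 2)) iV.
have j4 := integrableRD P _ _ j1 j2.
rewrite /G (RintD P _ _ (integrableRZ P 3 _ j3) (integrableRZ P (6 / v k) _ j4)).
rewrite (RintZ P 3 _ j3) (RintZ P (6 / v k) _ j4) (RintD P _ _ (integrableR_cst P _) iV) (RintD P _ _ j1 j2).
by rewrite (RintZ P _ _ iYY) (RintZ P _ _ iYY') Rint_cst.
Qed.

End window_limits.

Lemma cov_decay_series {R : realType} (d : nat) (beta : R -> R) (q : R) : (0 < d)%N -> 4 < q ->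
  (forall b, 2^-1 <= b -> 0 <= beta b) ->
  (forall b c, 2^-1 <= b -> b <= c -> beta c <= beta b) ->
  (\int[@lebesgue_measure R]_(r in `[1%R, +oo[)
     (r ^+ d.-1 * beta r `^ (1 - 4 / q))%R%:E < +oo)%E ->
  exists2 A : R, 0 <= A & forall L N,
    \sum_(v <- @box d N) cov_decay q beta L (site_norm v) <= A * L.+1%:R ^+ d.
Proof.
case: d => [//|d] _ q4 b0 bd fin.
have th0 : 0 < 1 - 4 / q by rewrite subr_gt0 ltr_pdivrMr ?mul1r // (lt_trans _ q4).
have [S _ hS] := beta_series_bounded R d beta _ th0 b0 bd fin.
exact: cov_decay_sum hS.
Qed.

Lemma expectation_Rint {R : realType} {dO : measure_display} {Omega : measurableType dO}
  (P : probability Omega R) (f : Omega -> R) :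
  integrableR P f -> (expectation P f = (\int[P]_om f om)%:E)%E.
Proof. by move=> i; rewrite unlock /Rintegral fineK //; exact: (integrable_fin_num measurableT i). Qed.

Lemma cvg_expectation {R : realType} {dO : measure_display} {Omega : measurableType dO}
  (P : probability Omega R) (f : nat -> Omega -> R) (l : R) :
  (\forall k \near \oo, integrableR P (f k)) ->
  \int[P]_om f k om @[k --> \oo] --> l -> expectation P (f k) @[k --> \oo] --> l%:E.
Proof.
move=> i fl; apply: (@cvg_trans _ ((\int[P]_om f k om)%:E @[k --> \oo])).
  by apply: near_eq_cvg; apply: filterS i => k /expectation_Rint ->.
by apply: cvg_EFin => //; near=> k.
Unshelve. all: by end_near.
Qed.

Theorem theorem3p5 (R : realType) (d : nat) (d_gt0 : (0 < d)%N)
    (M : topologicalType) (M_polish : polish R M)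
    (dO : measure_display) (Omega : measurableType dO) (P : probability Omega R)
    (W : nat -> set 'rV[R]_d) (W_cas : convex_averaging_sequence W)
    (w : R -> R) (b : nat -> R) (wb : condition_wb W w b)
    (X : point_family R d Omega M)
    (X_mpp : is_marked_point_process X)
    (X_simple : simple_mpp P X)
    (X_stationary : stationary P X)
    (lambda_gt0 : (0 < intensity P X)%E)
    (beta : R -> R) (beta_rate : mixing_rate P X beta)
    (delta : R) (delta_gt0 : 0 < delta)
    (X_moment : (\int[P]_om (mpp_count X om (unit_cube `*` setT) `^ (4 + delta)) < +oo)%E)
    (beta_int : (\int[@lebesgue_measure R]_(r in `[1%R, +oo[)
       (r ^+ d.-1 * beta r `^ (delta / (4 + delta)))%R%:E < +oo)%E)
    (l : nat) (C : 'I_l -> set M) (C_borel : forall i, borel (C i)) :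
  exists sigma : 'M[R]_l, forall i j : 'I_l,
    expectation P (fun om => mark_empirical P X (W k) (C i) om *
                             mark_empirical P X (W k) (C j) om) @[k --> \oo]
      --> (sigma i j)%:E /\
    expectation P (fun om =>
        (sigma i j - cov_estimator P X (W k) w (b k) (C i) (C j) om) ^+ 2)
      @[k --> \oo] --> 0%:E.
Proof.
have [W_nd W_convex W_compact W_inradius] := W_cas.
have [[w_ge0 w_sym mw w1 w_cvg] [m_w w_le] [r_w [rw0 w_out [b0 b_le b_cvg bv_cvg bv0_cvg]]]] := wb.
have [beta0 beta_dec _] := beta_rate.
have q4 : 4 < 4 + delta by rewrite ltrDl.
have q0 : 4 + delta != 0 by rewrite gt_eqF // (lt_trans _ q4).
have cov_sum := cov_decay_series d beta (4 + delta) d_gt0 q4 beta0 beta_dec.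
(* For [q = 4 + delta] the exponent of the covariance inequality is the one in the integrability
   assumption on the mixing rate. *)
rewrite (_ : 1 - 4 / (4 + delta) = delta / (4 + delta)) in cov_sum; last by field.
have {}cov_sum := cov_sum beta_int.
have cW k : closed (W k) by apply: compact_closed => //; exact: norm_hausdorff.
have bW k := bounded_tuples_compact (W k) (W_compact k).
have [N WN] := choice (fun k => bounded_box_regionP (tupset (W k)) (bW k)).
have [ctr [rho [balls rho_cvg]]] := inradius_balls W W_inradius.
have ballW : \forall k \near \oo, 0 < rho k /\ closed_eball (ctr k) (rho k) `<=` W k.
  by apply: filterS balls => k [].
have r_rho : \forall k \near \oo, inradius (W k) <= 3 / 2 * rho k.
  by apply: filterS balls => k [].
have vol_ge0 k : 0 <= vol (W k) by rewrite /vol fine_ge0.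
pose s k := b k * vol (W k) `^ d%:R^-1.
have H (ij : 'I_l * 'I_l) := cov_estimator_consistent P X d_gt0 X_mpp X_stationary (4 + delta) q4
  X_moment lambda_gt0 beta beta_rate cov_sum W ctr rho N cW bW W_convex ballW rho_cvg
  (volume_gt0 d _ b b0 bv_cvg) WN w m_w r_w s w_ge0 mw w1 w_cvg w_le rw0 w_out
  (scale_gt0 d _ b b0 bv_cvg) (scale_cvg d d_gt0 _ b vol_ge0 b0 bv_cvg)
  (scale_le d d_gt0 _ b _ rho r_w rw0 b0 r_rho b_le bv_cvg)
  (scale_pow_cvg d d_gt0 _ b r_w rw0 vol_ge0 b0 bv_cvg bv0_cvg 3)
  (volume_cvg d _ b vol_ge0 b0 b_cvg bv_cvg) b (fun=> erefl) (C ij.1) (C ij.2)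
  (C_borel ij.1) (C_borel ij.2).
have [sigma hsigma] := choice H.
exists (\matrix_(i, j) sigma (i, j)) => i j; rewrite mxE.
have [lim1 lim2 int] := hsigma (i, j).
by split; apply: cvg_expectation => //; apply: filterS int => k [].
Qed.
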